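(* Let $d \ge 1$ and let $k$ be a nonnegative integer. Assume $f$ is a locally integrable function on $\mathbb{R}^d$ with $f(x)(1+|x|)^{-k} \in L^\infty(\mathbb{R}^d)$. Assume $\psi$ is integrable on $\mathbb{R}^d$ with $\psi(x)(1+|x|)^k \in L^1(\mathbb{R}^d)$ and $\widehat{\psi} \in C^\infty(\mathbb{R}^d\setminus\{0\})$, and suppose $$\langle f, \psi_{s,t} \rangle = 0 \qquad \text{for all } s>0,\ t \in \mathbb{R}^d .$$ If $\widehat{\psi}$ is nontrivial in every direction, then $f$ is equal almost everywhere to a polynomial of degree $\le k$. (For example, if $f$ is bounded, i.e. $k=0$, then $f$ is equal almost everywhere to a constant.)
   Context: Functions are complex-valued on $\mathbb{R}^d$, and polynomials are polynomials in $x=(x_1,\dots,x_d)$ with complex coefficients. For $s>0$ and $t \in \mathbb{R}^d$, $\psi_{s,t}(x) = s^{-d/2}\, \psi\big(\frac{x-t}{s}\big)$, and $\langle f, \psi_{s,t}\rangle = \int_{\mathbb{R}^d} f(x)\, \overline{\psi_{s,t}(x)}\, dx$ (the continuous wavelet transform of $f$ with respect to $\psi$ at $(s,t)$). The Fourier transform is normalized by $\widehat{\psi}(\omega) = \int_{\mathbb{R}^d} \psi(x) e^{-2\pi i \omega\cdot x}\, dx$. The hypothesis $\widehat{\psi} \in C^\infty(\mathbb{R}^d\setminus\{0\})$ means that $\widehat{\psi}$ is smooth away from the origin. A function $\lambda$ is nontrivial in direction $\xi$, where $\xi$ is a unit vector in $\mathbb{R}^d$, if the set $\{ r>0 : \lambda(r\xi)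 \neq 0\}$ has positive measure (for $\lambda$ continuous this means $\lambda(r\xi)\ne 0$ for some $r>0$). ''Nontrivial in every direction'' means nontrivial in direction $\xi$ for every unit vector $\xi$. *)

(* Defs.v *)
From HB Require Import structures.
From mathcomp Require Import all_boot all_order all_algebra.
From mathcomp Require Import all_classical all_reals all_analysis.
From mathcomp.real_closed Require Import complex.

Set Implicit Arguments.
Unset Strict Implicit.
Unset Printing Implicit Defensive.
Import Order.TTheory GRing.Theory Num.Theory.
Import numFieldNormedType.Exports.

Local Open Scope classical_set_scope.
Local Open Scope ring_scope.
Local Open Scope complex_scope.

(* Vectors of R^d are rows 'rV[R]_d, complex numbers are R[i]. The library
   norm on 'rV[R]_d is the sup norm, hence a separate Euclidean norm. *)
Definition dotp (R : realType) (d : nat) (x y : 'rV[R]_d) : R :=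
  \sum_(i < d) x ord0 i * y ord0 i.

Definition enorm (R : realType) (d : nat) (x : 'rV[R]_d) : R :=
  Num.sqrt (dotp x x).

(* Borel sets of R^d: the sigma-algebra generated by the coordinates, as the
   library does for tuples. *)
Section borel.
Variables (R : realType) (d : nat).

Let coord (i : 'I_d) (x : 'rV[R]_d) : measurableTypeR R := x ord0 i.

Let borel0 : g_sigma_preimage coord set0.
Proof. exact: sigma_algebra0. Qed.

Let borelC A : g_sigma_preimage coord A -> g_sigma_preimage coord (~` A).
Proof. exact: sigma_algebraC. Qed.

Let borel_bigcup (F : (set 'rV[R]_d)^nat) :
  (forall i, g_sigma_preimage coord (F i)) ->
  g_sigma_preimage coord (\bigcup_i (F i)).
Proof. exact: sigma_algebra_bigcup. Qed.

HB.instance Definition _ := @isMeasurable.Build default_measure_display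
  'rV[R]_d (g_sigma_preimage coord) borel0 borelC borel_bigcup.

End borel.

Definition row_cons (R : realType) (d : nat)
    (p : measurableTypeR R * 'rV[R]_d) : 'rV[R]_d.+1 :=
  row_mx (p.1%:M : 'rV[R]_1) p.2.

(* d-fold product of the one-dimensional Lebesgue measure, on Borel sets; it is
   a point mass when d = 0. *)
Fixpoint borel_lebesgue (R : realType) (d : nat) : set 'rV[R]_d -> \bar R :=
  match d return set 'rV[R]_d -> \bar R with
  | 0 => \d_(0 : 'rV[R]_0)
  | n.+1 => pushforward (@lebesgue_measure R \x @borel_lebesgue R n)%E
                        (@row_cons R n)
  end.

Lemma measurable_coord (R : realType) (d : nat) (i : 'I_d) :
  measurable_fun setT (fun x : 'rV[R]_d => x ord0 i : measurableTypeR R).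
Proof.
move=> _ Y mY; rewrite setTI; apply: sub_sigma_algebra => /=.
rewrite -bigcup_seq/=; exists i => /=; first by rewrite mem_index_enum.
by exists Y => //; rewrite setTI.
Qed.

Lemma measurable_fun_rV (R : realType) (disp : measure_display)
    (T : measurableType disp) (d : nat) (f : T -> 'rV[R]_d) :
  (forall i, measurable_fun setT (fun t => f t ord0 i : measurableTypeR R)) ->
  measurable_fun setT f.
Proof.
move=> mf _ A mA; rewrite setTI; move: A mA.
suff H : g_sigma_preimage (fun (i : 'I_d) (t : T) =>
    f t ord0 i : measurableTypeR R) `<=` measurable.
  move=> A mA; apply: H.
  rewrite (g_sigma_preimage_comp
    (fun (i : 'I_d) (x : 'rV[R]_d) => x ord0 i : measurableTypeR R) f).
  by exists A => //; rewrite setTI.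
apply: smallest_sub; first exact: sigma_algebra_measurable.
rewrite -bigcup_seq; apply: bigcup_sub => i _ _ [B mB <-].
exact: mf.
Qed.

Lemma row_cons0 (R : realType) (d : nat) (p : measurableTypeR R * 'rV[R]_d) :
  row_cons p ord0 ord0 = p.1.
Proof.
have -> : ord0 = lshift d (ord0 : 'I_1) by exact: val_inj.
by rewrite [LHS]row_mxEl mxE.
Qed.

Lemma row_consS (R : realType) (d : nat) (p : measurableTypeR R * 'rV[R]_d)
  (i : 'I_d) : row_cons p ord0 (lift ord0 i) = p.2 ord0 i.
Proof.
have -> : lift ord0 i = rshift 1 i by exact: val_inj.
by rewrite [LHS]row_mxEr.
Qed.

Lemma measurable_row_cons (R : realType) (d : nat) :
  measurable_fun setT (@row_cons R d).
Proof.
apply: measurable_fun_rV => i; case: (unliftP ord0 i) => [j ->|->].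
  rewrite (_ : (fun _ => _) = (fun x : 'rV[R]_d => x ord0 j) \o snd).
    by apply: measurableT_comp => //; exact: measurable_coord.
  by apply/funext => p /=; rewrite row_consS.
rewrite (_ : (fun _ => _) = fst) //.
by apply/funext => p /=; rewrite row_cons0.
Qed.

Section sigma_finite_copy.
Context (disp : measure_display) (T : measurableType disp) (R : realType).
Variables (m : {measure set T -> \bar R}) (sm : sigma_finite setT m).

(* m, with the structure of a sigma-finite measure provided by the proof sm *)
Definition sigma_finite_copy : set T -> \bar R := let _ := sm in m.

HB.instance Definition _ := Measure.on sigma_finite_copy.
HB.instance Definition _ :=
  Measure_isSigmaFinite.Build _ _ _ sigma_finite_copy sm.

End sigma_finite_copy.

Section borel_lebesgue_measure.
Variable R : realType.
Local Open Scope ereal_scope.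

Let pushforward_measure d (m : {sigma_finite_measure set 'rV[R]_d -> \bar R}) :
    {measure set 'rV[R]_d.+1 -> \bar R} :=
  measure_function_pushforward__canonical__measure_function_Measure
    (@lebesgue_measure R \x m) (@measurable_row_cons R d).

Let pushforward_cons d (m : {sigma_finite_measure set 'rV[R]_d -> \bar R}) :
  sigma_finite setT (pushforward (@lebesgue_measure R \x m) (@row_cons R d)).
Proof.
have /sigma_finiteP[F [TF ndF Foo]] := sigma_finiteT (@lebesgue_measure R).
have /sigma_finiteP[G [TG ndG Goo]] := sigma_finiteT m.
pose uncons (v : 'rV[R]_d.+1) : measurableTypeR R * 'rV[R]_d :=
  (v ord0 ord0, \row_j v ord0 (lift ord0 j)).
have row_consK p : uncons (row_cons p) = p.
  rewrite /uncons row_cons0 [RHS]surjective_pairing; congr pair.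
  by apply/rowP => j; rewrite mxE row_consS.
have muncons : measurable_fun setT uncons.
  apply/measurable_fun_pairP; split; first exact: measurable_coord.
  apply: measurable_fun_rV => j.
  under eq_fun do rewrite /= mxE.
  exact: measurable_coord.
exists (fun n => uncons @^-1` (F n `*` G n)) => [|n].
  rewrite -preimage_bigcup (_ : \bigcup_n _ = setT) ?preimage_setT//.
  rewrite -subTset => -[x y] _.
  have [i _ Fix] : (\bigcup_k F k) x by rewrite -TF.
  have [j _ Gjy] : (\bigcup_k G k) y by rewrite -TG.
  exists (maxn i j) => //; split.
    by move: x Fix; exact/subsetPset/ndF/leq_maxl.
  by move: y Gjy; exact/subsetPset/ndG/leq_maxr.
have [mF Fn] := Foo n; have [mG Gn] := Goo n; split.
  by rewrite -[X in measurable X]setTI; apply: muncons => //; exact: measurableX.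
rewrite /pushforward (_ : _ @^-1` _ = F n `*` G n).
  by rewrite product_measure1E// lte_mul_pinfty// ge0_fin_numE.
by apply/seteqP; split => p; rewrite /preimage /mkset row_consK.
Qed.

Lemma borel_lebesgueP (d : nat) :
  exists m : {sigma_finite_measure set 'rV[R]_d -> \bar R},
    (m : set 'rV[R]_d -> \bar R) = @borel_lebesgue R d.
Proof.
elim: d => [|d [m mE]]; first by exists (dirac (0%R : 'rV[R]_0)).
rewrite /= -mE.
pose mu := pushforward_measure m.
have smu : sigma_finite setT mu := pushforward_cons m.
by exists (sigma_finite_copy smu).
Qed.

Variable d : nat.
Notation mu := (@borel_lebesgue R d).

Let mu0 : mu set0 = 0. Proof. by have [m <-] := borel_lebesgueP d. Qed.
Let mu_ge0 A : 0 <= mu A. Proof. by have [m <-] := borel_lebesgueP d. Qed.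
Let mu_sigma_additive : semi_sigma_additive mu.
Proof.
by have [m <-] := borel_lebesgueP d; exact: measure_semi_sigma_additive.
Qed.
Let mu_sigma_finite : sigma_finite setT mu.
Proof. by have [m <-] := borel_lebesgueP d; exact: sigma_finiteT. Qed.

HB.instance Definition _ :=
  isMeasure.Build _ _ _ mu mu0 mu_ge0 mu_sigma_additive.
HB.instance Definition _ :=
  Measure_isSigmaFinite.Build _ _ _ mu mu_sigma_finite.

End borel_lebesgue_measure.

(* Lebesgue measure on R^d, on the sigma-algebra of all Lebesgue measurable
   sets (completion of the Borel product measure). *)
Definition lebesgue_space (R : realType) (d : nat) : measurableType _ :=
  caratheodory_type (@borel_lebesgue R d)^*%mu.

Definition lebesgue_rV (R : realType) (d : nat) :
    {measure set (lebesgue_space R d) -> \bar R} :=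
  @completed_measure_extension _ _ _ (@borel_lebesgue R d).

Lemma lebesgue_rV_box (R : realType) (d : nat)
    (A : 'I_d -> set (measurableTypeR R)) :
  (forall i, measurable (A i)) ->
  lebesgue_rV R d [set x : 'rV[R]_d | forall i, A i (x ord0 i)] =
  (\prod_(i < d) lebesgue_measure (A i))%E.
Proof.
have mbox n (B : 'I_n -> set (measurableTypeR R)) :
    (forall i, measurable (B i)) -> measurable [set x : 'rV[R]_n | forall i, B i (x ord0 i)].
  move=> mB; rewrite (_ : mkset _ =
      \bigcap_(i in setT) ((fun x : 'rV[R]_n => x ord0 i) @^-1` B i)).
    apply: fin_bigcap_measurable; first exact: finite_finset.
    move=> i _; rewrite -[X in measurable X]setTI.
    exact: (measurable_coord i measurableT (mB i)).
  by apply/seteqP; split => [x Bx i _|x Bx i]; [exact: Bx|exact: Bx].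
move=> mA; rewrite /lebesgue_rV/= /completed_measure_extension.
rewrite measurable_mu_extE; last exact: mbox.
elim: d A mA => [|d IHd] A mA.
  rewrite big_ord0 /= diracE mem_set//.
  by case.
rewrite big_ord_recl -IHd //= /pushforward -product_measure1E; last 2 first.
- exact: mA.
- exact: (mbox _ _ (fun i => mA (lift ord0 i))).
congr (product_measure1 _ _ _); apply/seteqP; split => p /=.
  by move=> Ap; split=> [|i]; [rewrite -row_cons0|rewrite -row_consS].
move=> [Ap1 Ap2] i; case: (unliftP ord0 i) => [j ->|->].
  by rewrite row_consS.
by rewrite row_cons0.
Qed.

Section complex_valued.
Context (R : realType) (d : nat).
Implicit Types (f g psi : 'rV[R]_d -> R[i]) (x t omega xi : 'rV[R]_d).
Local Notation mu := (lebesgue_rV R d).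

Definition measurable_cfun f : Prop :=
  measurable_fun [set: lebesgue_space R d]
    (fun x => complex.Re (f x) : measurableTypeR R) /\
  measurable_fun [set: lebesgue_space R d]
    (fun x => complex.Im (f x) : measurableTypeR R).

(* L^p membership of a complex-valued function: Normc.normc is the modulus, as a
   real number; for p = +oo the library norm is the essential supremum. *)
Definition inLp (p : \bar R) f : Prop :=
  measurable_cfun f /\ finite_norm mu p (fun x => Normc.normc (f x)).

Definition locally_integrableC f : Prop :=
  measurable_cfun f /\
  forall K : set 'rV[R]_d, compact K ->
    (\int[mu]_(x in K) (Normc.normc (f x))%:E < +oo)%E.

Definition integralC f : R[i] :=
  (\int[mu]_x complex.Re (f x)) +i* (\int[mu]_x complex.Im (f x)).

Definition wavelet psi (s : R) t : 'rV[R]_d -> R[i] :=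
  fun x => (s `^ (- (d%:R / 2)))%:C * psi (s^-1 *: (x - t)).

Definition inner f g : R[i] := integralC (fun x => f x * (g x)^*).

(* exp (i theta), by Euler's formula *)
Definition expi (theta : R) : R[i] := cos theta +i* sin theta.

Definition fourier psi : 'rV[R]_d -> R[i] :=
  fun omega => integralC (fun x => psi x * expi (- (2 * pi * dotp omega x))).

(* C^n on an open set U: all partial derivatives up to order n exist and are
   continuous on U. *)
Fixpoint Cn_on (n : nat) (U : set 'rV[R]_d) (h : 'rV[R]_d -> R) : Prop :=
  (forall x, U x -> {for x, continuous h}) /\
  match n with
  | 0 => True
  | m.+1 => forall i : 'I_d,
      (forall x, U x -> derivable h x (delta_mx ord0 i)) /\
      Cn_on m U (fun x => 'D_(delta_mx ord0 i) h x)
  end.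

Definition smooth_onC (U : set 'rV[R]_d) f : Prop :=
  forall n, Cn_on n U (fun x => complex.Re (f x)) /\
            Cn_on n U (fun x => complex.Im (f x)).

Definition nontrivial_in_direction f xi : Prop :=
  (0 < lebesgue_measure [set r : R | (0 < r)%R /\ f (r *: xi) != 0%R])%E.

Definition nontrivial_in_every_direction f : Prop :=
  forall xi, enorm xi = 1 -> nontrivial_in_direction f xi.

End complex_valued.

(* Main.v *)
Require Import Defs.
From mathcomp Require Import all_boot all_order all_algebra.
From mathcomp Require Import all_classical all_reals all_analysis.
From mathcomp.real_closed Require Import complex.
From mathcomp Require mpoly.
From mathcomp Require finmap.
Import (canonicals, coercions) mpoly finmap.
From mathcomp Require Import measurable_realfun ring lra.

Set Implicit Arguments.
Unset Strict Implicit.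
Unset Printing Implicit Defensive.
Import Order.TTheory GRing.Theory Num.Theory.
Import numFieldNormedType.Exports.

Local Open Scope classical_set_scope.
Local Open Scope ring_scope.
Local Open Scope complex_scope.

(* The hypothesis says that [f] annihilates the inverse Fourier transform of
   [g * conj (psi^ (- s .))] for every compactly supported [C^N] function [g] and every
   scale [s]. On an annulus, finitely many scales [s_j] make the sum of the
   [|psi^ (- s_j w)|^2] positive; dividing by it, [f] annihilates the inverse Fourier
   transform of every [C^N] function with compact support away from [0]. Differences of
   dilates of a low-pass filter are such functions, so, [Phi] being the kernel of the
   filter, [F a = \int f (a + s z) Phi z dz] does not depend on [s > 0]. As [s] tends to
   infinity, a Taylor expansion of [Phi] shows that [F] is polynomial of degree [<= k]
   along every line, hence a polynomial of degree [<= k]. As [s] tends to [0], [Phi] acts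
   as an approximate identity of mass [c = \int Phi], so [F = c f] almost everywhere, and
   [c] is nonzero. *)

(** * Real-valued integrals *)

(** The obstacle is that $f$ only grows polynomially, so that it has no Fourier transform as a
    function. Every pairing with $f$ must converge absolutely, and this fixes $N = k + 2d$: a
    compactly supported $C^N$ function has an inverse transform of size $(1+|x|)^{-N}$, and
    $(1+|x|)^{k-N} = (1+|x|)^{-2d}$ is integrable. The kernel [Phi] depends on $k$ and $d$ for this
    reason. The minus sign in $\widehat\psi(-sw)$ comes from pairing $f$ with conjugates. The scales
    are finite in number by compactness of the annulus. Near the origin $\widehat\psi$ gives no
    control, so one low-pass filter cannot be reached, only a difference of two filters that agree
    there. The degree comes from a count of powers: $f(a+sz)$ costs $s^k$ and the Taylor remainder
    of order $k+1$ gains $s^{-k-1}$, which leaves $1/s$. At small scales $f$ need not be continuous,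
    so the limit is tested on boxes. The analysis is done for Borel functions and the product
    measure, where Fubini applies; $f$ and $\psi$ are exchanged for Borel versions with bounds that
    hold everywhere. *)

Section Rint.
Context d (T : measurableType d) (R : realType).
Variable m : {measure set T -> \bar R}.
Implicit Types f g : T -> R.

Definition rintegrable f := m.-integrable setT (EFin \o f).

Lemma rintegrable_measurable f : rintegrable f -> measurable_fun setT f.
Proof. by move=> /integrableP[/measurable_EFinP]. Qed.

Lemma rintegrable_le f g : measurable_fun setT f -> rintegrable g ->
  (forall x, `|f x| <= g x) -> rintegrable f.
Proof.
move=> mf ig fg; apply: le_integrable ig => //.
  exact/measurable_EFinP.
by move=> x _ /=; rewrite lee_fin (le_trans (fg x))// ler_norm.
Qed.

Lemma rintegrableD f g : rintegrable f -> rintegrable g ->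
  rintegrable (fun x => f x + g x).
Proof. by move=> fi gi; apply: eq_integrable (integrableD _ fi gi). Qed.

Lemma rintegrableZ c f : rintegrable f -> rintegrable (fun x => c * f x).
Proof. by move=> fi; apply: eq_integrable (integrableZl _ c fi). Qed.

Lemma rintegrable0 : rintegrable (fun=> 0).
Proof. exact: integrable0. Qed.

Lemma rintegrable_norm f : rintegrable f -> rintegrable (fun x => `|f x|).
Proof. by move=> fi; apply: eq_integrable (integrable_norm fi). Qed.

Lemma Rintegral_ae f g : measurable_fun setT f -> measurable_fun setT g ->
  {ae m, forall x, f x = g x} -> \int[m]_x f x = \int[m]_x g x.
Proof.
move=> mf mg fg; rewrite /Rintegral; congr fine; apply: ae_eq_integral => //.
- exact/measurable_EFinP.
- exact/measurable_EFinP.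
- by apply: filterS fg => x -> _.
Qed.

Lemma Rintegral_dct (f_ : nat -> T -> R) f g :
  (forall n, measurable_fun setT (f_ n)) -> measurable_fun setT f ->
  rintegrable g -> (forall n x, `|f_ n x| <= g x) ->
  {ae m, forall x, f_ ^~ x @ \oo --> f x} ->
  (\int[m]_x f_ n x) @[n --> \oo] --> \int[m]_x f x.
Proof.
move=> mf_ mf ig fg cf.
have [fi _ H] : [/\ m.-integrable setT (EFin \o f),
  [sequence (\int[m]_(x in setT) (`|(f_ n x)%:E - (f x)%:E|))%E]_n @ \oo --> 0%E &
  [sequence (\int[m]_(x in setT) ((f_ n x)%:E))%E]_n @ \oo --> (\int[m]_(x in setT) (f x)%:E)%E].
  apply: (@dominated_convergence _ _ _ m setT measurableT
     (fun n x => (f_ n x)%:E) (fun x => (f x)%:E) (EFin \o g)) => //.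
  - by move=> n; apply/measurable_EFinP.
  - exact/measurable_EFinP.
  - by apply: filterS cf => x cx _; apply/cvg_EFin => //; apply: nearW.
  - by apply: nearW => x n _ /=; rewrite lee_fin.
move: H; rewrite -(fineK (integrable_fin_num measurableT fi)) => H.
exact: (fine_cvg H).
Qed.

End Rint.

(** * Fubini and Tonelli for real-valued integrals *)

Section Rfubini.
Context d1 d2 (T1 : measurableType d1) (T2 : measurableType d2) (R : realType).
Variable m1 : {sigma_finite_measure set T1 -> \bar R}.
Variable m2 : {sigma_finite_measure set T2 -> \bar R}.
Implicit Types F : T1 * T2 -> R.

(** The integral is the difference of two Tonelli integrals, each measurable in $x$ whatever values
    it takes, and [fine] is measurable. *)
Lemma measurable_Rintegral F : measurable_fun setT F ->
  measurable_fun setT (fun x => \int[m2]_y F (x, y)).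
Proof.
move=> mF; pose f := EFin \o F.
have mf : measurable_fun setT f by apply/measurable_EFinP.
apply: measurableT_comp => //.
rewrite (_ : (fun _ => _) = fun x => (\int[m2]_y f^\+ (x, y) - \int[m2]_y f^\- (x, y))%E).
  apply: emeasurable_funB.
    by apply: (measurable_fun_fubini_tonelli_F f^\+%E) => //; exact: measurable_funepos.
  by apply: (measurable_fun_fubini_tonelli_F f^\-%E) => //; exact: measurable_funeneg.
apply/funext => x; rewrite -[fun y => _]/(f \o pair x) [LHS]integralE.
by rewrite funepos_comp funeneg_comp.
Qed.

(** Serves where the integrand has no bound by a product of functions of $x$ and of $y$, but its
    partial integrals are controlled. *)
Lemma rintegrable_tonelli F (G : T2 -> R) : measurable_fun setT F ->
  (forall z, 0 <= F z) -> (forall y, rintegrable m1 (fun x => F (x, y))) ->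
  rintegrable m2 G -> (forall y, \int[m1]_x F (x, y) <= G y) ->
  rintegrable (m1 \x m2)%E F.
Proof.
move=> mF F0 iF iG FG; apply/(@integrable21ltyP _ _ _ _ _ m1 m2).
  exact/measurable_EFinP.
case/integrableP : iG => mG; apply: le_lt_trans; apply: ge0_le_integral => //.
- by move=> y _; apply: integral_ge0.
- apply: (measurable_fun_fubini_tonelli_G (fun z => `|(F z)%:E|)%E) => //.
  by apply: measurableT_comp => //; exact/measurable_EFinP.
- exact: measurableT_comp.
- move=> y _; under eq_integral do rewrite /= ger0_norm//.
  rewrite -[X in (X <= _)%E]fineK; last exact: (integrable_fin_num measurableT (iF y)).
  by rewrite /= lee_fin (le_trans (FG y))// ler_norm.
Qed.

Lemma rintegrable_prod (a : T1 -> R) (b : T2 -> R) :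
  rintegrable m1 a -> rintegrable m2 b ->
  rintegrable (m1 \x m2)%E (fun z => a z.1 * b z.2).
Proof.
move=> ia ib.
have ma := rintegrable_measurable ia; have mb := rintegrable_measurable ib.
have mF : measurable_fun setT (fun z : T1 * T2 => a z.1 * b z.2).
  by apply: measurable_funM; exact: measurableT_comp.
apply: (@rintegrable_le _ _ _ _ _ (fun z => `|a z.1 * b z.2|)) => //.
apply: (@rintegrable_tonelli _ (fun y => (\int[m1]_x `|a x|) * `|b y|)) => //.
- exact: measurableT_comp.
- move=> y; apply: (@rintegrable_le _ _ _ _ _ (fun x => `|b y| * `|a x|)).
  + by apply: measurableT_comp => //; apply: (@measurable_funM _ _ _ _ a (cst (b y))).
  + by apply: (@rintegrableZ _ _ _ m1 `|b y| (fun x => `|a x|)); exact: rintegrable_norm.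
  + by move=> x /=; rewrite normr_id normrM mulrC.
- apply: (@rintegrableZ _ _ _ m2 _ (fun x => `|b x|)); exact: rintegrable_norm.
- move=> y /=; rewrite -RintegralZr//.
    by under eq_Rintegral do rewrite normrM.
  exact: rintegrable_norm.
Qed.

Lemma Rintegral_fubini F : rintegrable (m1 \x m2)%E F ->
  \int[m1]_x \int[m2]_y F (x, y) = \int[m2]_y \int[m1]_x F (x, y).
Proof.
move=> iF; rewrite /Rintegral.
have mF := rintegrable_measurable iF.
(* The inner real integral is [fine] of the extended one; they agree where the latter is finite,
   that is, almost everywhere. *)
transitivity (fine (\int[m1]_x \int[m2]_y (F (x, y))%:E)).
  congr fine; apply: ae_eq_integral => //.
  - by apply/measurable_EFinP; apply: measurable_Rintegral.
  - exact: (measurable_fubini_F iF).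
  - have := integrable_ae measurableT (integrable_fubini_F iF).
    by apply: filterS => x /= /(_ I) h _; rewrite fineK.
rewrite (Fubini iF); congr fine; apply: ae_eq_integral => //.
- exact: (measurable_fubini_G iF).
- apply: (measurableT_comp (@EFin_measurable R setT)).
  by apply: measurableT_comp => //; exact: (measurable_fubini_G iF).
- apply: filterS (ae_integrable2 iF) => y iy _.
  by rewrite fineK//; exact: (integrable_fin_num measurableT iy).
Qed.

End Rfubini.

(** * Complex-valued integrals *)

Section normc_theory.
Context {R : realType}.
Implicit Types z w : R[i].
Notation normc := (@Normc.normc R).

Lemma normc_ge0 z : 0 <= normc z.
Proof. by case: z => a b; exact: sqrtr_ge0. Qed.

Lemma normcD z w : normc (z + w) <= normc z + normc w.
Proof. exact: le_normcD. Qed.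

Lemma normcB z w : normc (z - w) <= normc z + normc w.
Proof. by rewrite -(normcN w); exact: normcD. Qed.

Lemma normc_Re z : `|complex.Re z| <= normc z.
Proof.
by case: z => a b /=; rewrite -sqrtr_sqr ler_wsqrtr// lerDl sqr_ge0.
Qed.

Lemma normc_Im z : `|complex.Im z| <= normc z.
Proof.
by case: z => a b /=; rewrite -sqrtr_sqr ler_wsqrtr// lerDr sqr_ge0.
Qed.

Lemma normc_le_ReIm z : normc z <= `|complex.Re z| + `|complex.Im z|.
Proof.
case: z => a b /=; rewrite -[leRHS]ger0_norm ?addr_ge0// -sqrtr_sqr ler_wsqrtr//.
by rewrite sqrrD !real_normK ?num_real// lerD2r lerDl mulrn_wge0// mulr_ge0.
Qed.

Lemma normc_real (x : R) : normc x%:C = `|x|.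
Proof. by rewrite /= expr0n addr0 sqrtr_sqr. Qed.

Lemma normcJ z : normc z^*%R = normc z.
Proof. by case: z => a b /=; rewrite sqrrN. Qed.

Lemma normcX z n : normc (z ^+ n) = normc z ^+ n.
Proof.
elim: n => [|n IH]; first by rewrite !expr0 Normc.normc1.
by rewrite !exprS Normc.normcM IH.
Qed.

Lemma cReM z w :
  complex.Re (z * w) = complex.Re z * complex.Re w - complex.Im z * complex.Im w.
Proof. by case: z w => a b [e f]. Qed.

Lemma cImM z w :
  complex.Im (z * w) = complex.Re z * complex.Im w + complex.Im z * complex.Re w.
Proof. by case: z w => a b [e f]. Qed.

Lemma cReD z w : complex.Re (z + w) = complex.Re z + complex.Re w.
Proof. by case: z w => a b [e f]. Qed.

Lemma cImD z w : complex.Im (z + w) = complex.Im z + complex.Im w.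
Proof. by case: z w => a b [e f]. Qed.

Lemma normc_expi (t : R) : normc (expi t) = 1.
Proof. by rewrite /expi /= cos2Dsin2 sqrtr1. Qed.

Lemma expiD (s t : R) : expi (s + t) = expi s * expi t.
Proof.
rewrite /expi cosD sinD; apply/eqP; rewrite eq_complex /= eqxx/=.
by rewrite addrC [X in X + _]mulrC eqxx.
Qed.

Lemma expiN (t : R) : expi (- t) = (expi t)^*%R.
Proof. by rewrite /expi cosN sinN. Qed.

Lemma expi_pi : expi (pi : R) = -1.
Proof. by rewrite /expi cospi sinpi; apply/eqP; rewrite eq_complex /= oppr0 !eqxx. Qed.

End normc_theory.

Section cmeasurable.
Context {d} {T : measurableType d} {R : realType}.
Implicit Types f g : T -> R[i].

Definition cmeasurable f :=
  measurable_fun setT (fun x => complex.Re (f x)) /\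
  measurable_fun setT (fun x => complex.Im (f x)).

Lemma cmeasurable_cst (z : R[i]) : cmeasurable (fun=> z).
Proof. by split; exact: measurable_cst. Qed.

Lemma cmeasurableD f g : cmeasurable f -> cmeasurable g ->
  cmeasurable (fun x => f x + g x).
Proof.
move=> [f1 f2] [g1 g2]; split.
  by under eq_fun do rewrite cReD; exact: measurable_funD.
by under eq_fun do rewrite cImD; exact: measurable_funD.
Qed.

Lemma cmeasurableM f g : cmeasurable f -> cmeasurable g ->
  cmeasurable (fun x => f x * g x).
Proof.
move=> [f1 f2] [g1 g2]; split.
  by under eq_fun do rewrite cReM; apply: measurable_funB; exact: measurable_funM.
by under eq_fun do rewrite cImM; apply: measurable_funD; exact: measurable_funM.
Qed.

Lemma cmeasurableJ f : cmeasurable f -> cmeasurable (fun x => (f x)^*%R).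
Proof.
move=> [f1 f2]; split.
  by apply: eq_measurable_fun f1 => x _; case: (f x).
rewrite (_ : (fun _ => _) = fun x => - complex.Im (f x)).
  exact: measurable_funN.
by apply/funext => x; case: (f x).
Qed.

Lemma cmeasurable_real (f : T -> R) : measurable_fun setT f ->
  cmeasurable (fun x => (f x)%:C).
Proof. by move=> mf; split => //; exact: measurable_cst. Qed.

Lemma cmeasurable_expi (f : T -> R) : measurable_fun setT f ->
  cmeasurable (fun x => expi (f x)).
Proof.
move=> mf; split; apply: measurableT_comp => //; apply: continuous_measurable_fun.
  exact: continuous_cos.
exact: continuous_sin.
Qed.

Lemma cmeasurable_normc f : cmeasurable f ->
  measurable_fun setT (fun x => Normc.normc (f x)).
Proof.
move=> [f1 f2].
rewrite (_ : (fun _ => _) =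
  fun x => Num.sqrt (complex.Re (f x) ^+ 2 + complex.Im (f x) ^+ 2)).
  apply: (measurableT_comp (continuous_measurable_fun (@sqrt_continuous R))).
  by apply: measurable_funD; exact: measurable_funX.
by apply/funext => x; case: (f x).
Qed.

End cmeasurable.

Lemma cmeasurable_comp {d d'} {T : measurableType d} {T' : measurableType d'}
    {R : realType} (f : T' -> R[i]) (phi : T -> T') :
  cmeasurable f -> measurable_fun setT phi -> cmeasurable (fun x => f (phi x)).
Proof.
move=> [f1 f2] mphi; split.
  exact: (measurableT_comp f1 mphi).
exact: (measurableT_comp f2 mphi).
Qed.

Section cintegral.
Context {d} {T : measurableType d} {R : realType}.
Variable m : {measure set T -> \bar R}.
Implicit Types (f g : T -> R[i]) (h : T -> R).

Definition cintegrable f :=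
  rintegrable m (fun x => complex.Re (f x)) /\
  rintegrable m (fun x => complex.Im (f x)).

Definition cintegral f : R[i] :=
  (\int[m]_x complex.Re (f x)) +i* (\int[m]_x complex.Im (f x)).

Lemma cintegrable_measurable f : cintegrable f -> cmeasurable f.
Proof. by move=> [/rintegrable_measurable f1 /rintegrable_measurable f2]. Qed.

Lemma cintegrable_le f h : cmeasurable f -> rintegrable m h ->
  (forall x, Normc.normc (f x) <= h x) -> cintegrable f.
Proof.
move=> [f1 f2] ih fh; split; apply: (rintegrable_le _ ih) => // x.
  exact: le_trans (normc_Re _) (fh x).
exact: le_trans (normc_Im _) (fh x).
Qed.

Lemma cintegrable_normc f : cintegrable f ->
  rintegrable m (fun x => Normc.normc (f x)).
Proof.
move=> fi; have mf := cintegrable_measurable fi; case: fi => f1 f2.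
apply: (rintegrable_le (cmeasurable_normc mf)
  (rintegrableD (rintegrable_norm f1) (rintegrable_norm f2))) => x.
by rewrite ger0_norm ?normc_ge0//; exact: normc_le_ReIm.
Qed.

Lemma cintegralD f g : cintegrable f -> cintegrable g ->
  cintegral (fun x => f x + g x) = cintegral f + cintegral g.
Proof.
move=> [f1 f2] [g1 g2]; apply/eqP; rewrite eq_complex /=; apply/andP; split; apply/eqP.
  by rewrite -RintegralD//; apply: eq_Rintegral => x _; rewrite cReD.
by rewrite -RintegralD//; apply: eq_Rintegral => x _; rewrite cImD.
Qed.

Lemma cintegralZ (c : R[i]) f : cintegrable f ->
  cintegral (fun x => c * f x) = c * cintegral f.
Proof.
move=> [f1 f2]; apply/eqP; rewrite eq_complex cReM cImM /=; apply/andP; split; apply/eqP.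
  rewrite -!RintegralZl// -RintegralB//.
  - by apply: eq_Rintegral => x _; rewrite cReM.
  - exact: rintegrableZ.
  - exact: rintegrableZ.
rewrite -!RintegralZl// -RintegralD//.
- by apply: eq_Rintegral => x _; rewrite cImM.
- exact: rintegrableZ.
- exact: rintegrableZ.
Qed.

Lemma eq_cintegral f g : (forall x, f x = g x) -> cintegral f = cintegral g.
Proof. by move=> fg; congr cintegral; exact/funext. Qed.

(* The constant 2 saves a rotation of the integral and is harmless. *)
Lemma normc_cintegral f h : cmeasurable f -> rintegrable m h ->
  (forall x, Normc.normc (f x) <= h x) ->
  Normc.normc (cintegral f) <= 2 * \int[m]_x h x.
Proof.
move=> mf ih fh; have [f1 f2] := cintegrable_le mf ih fh.
apply: le_trans (normc_le_ReIm _) _.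
rewrite mulrDl mul1r lerD//= (le_trans (le_normr_Rintegral _ _))//.
  apply: le_Rintegral => //; first exact: rintegrable_norm.
  by move=> x _; exact: le_trans (normc_Re _) (fh x).
apply: le_Rintegral => //; first exact: rintegrable_norm.
by move=> x _; exact: le_trans (normc_Im _) (fh x).
Qed.

Lemma cintegralJ f : cintegrable f -> cintegral (fun x => (f x)^*%R) = (cintegral f)^*%R.
Proof.
move=> [f1 f2]; apply/eqP; rewrite eq_complex /=; apply/andP; split; apply/eqP.
  by apply: eq_Rintegral => x _; case: (f x).
rewrite -mulN1r -RintegralZl//; apply: eq_Rintegral => x _.
by rewrite mulN1r; case: (f x).
Qed.

Lemma cintegrableD f g : cintegrable f -> cintegrable g ->
  cintegrable (fun x => f x + g x).
Proof.
move=> [f1 f2] [g1 g2]; split.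
  by under eq_fun do rewrite cReD; exact: rintegrableD.
by under eq_fun do rewrite cImD; exact: rintegrableD.
Qed.

Lemma cintegrableZ (c : R[i]) f : cintegrable f -> cintegrable (fun x => c * f x).
Proof.
move=> fi; apply: (@cintegrable_le _ (fun x => Normc.normc c * Normc.normc (f x))).
- by apply: cmeasurableM; [exact: cmeasurable_cst|exact: cintegrable_measurable].
- by apply: rintegrableZ; exact: cintegrable_normc.
- by move=> x; rewrite Normc.normcM.
Qed.

Lemma cintegral0 : cintegral (fun=> 0) = 0.
Proof. by rewrite /cintegral /Rintegral /= integral0. Qed.

Lemma cintegral_sum n (F : 'I_n -> T -> R[i]) : (forall i, cintegrable (F i)) ->
  cintegrable (fun x => \sum_(i < n) F i x) /\
  cintegral (fun x => \sum_(i < n) F i x) = \sum_(i < n) cintegral (F i).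
Proof.
elim: n F => [|n IH] F iF.
  rewrite big_ord0; under eq_fun do rewrite big_ord0; split; last exact: cintegral0.
  by split; exact: rintegrable0.
have [I1 I2] := IH (fun i => F (widen_ord (leqnSn n) i)) (fun i => iF _).
rewrite big_ord_recr/= -I2; under eq_fun do rewrite big_ord_recr/=; split.
  exact: cintegrableD.
exact: cintegralD.
Qed.

End cintegral.

(** * Fubini for complex-valued integrals *)

Section cfubini.
Context {d1 d2} {T1 : measurableType d1} {T2 : measurableType d2} {R : realType}.
Variable m1 : {sigma_finite_measure set T1 -> \bar R}.
Variable m2 : {sigma_finite_measure set T2 -> \bar R}.
Implicit Types F : T1 * T2 -> R[i].

Lemma cmeasurable_cintegral F : cmeasurable F ->
  cmeasurable (fun x => cintegral m2 (fun y => F (x, y))).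
Proof.
move=> [F1 F2]; split.
  exact: (measurable_Rintegral m2 F1).
exact: (measurable_Rintegral m2 F2).
Qed.

Lemma cintegral_fubini F : cintegrable (m1 \x m2)%E F ->
  cintegral m1 (fun x => cintegral m2 (fun y => F (x, y))) =
  cintegral m2 (fun y => cintegral m1 (fun x => F (x, y))).
Proof.
move=> [F1 F2]; apply/eqP; rewrite eq_complex /=; apply/andP; split; apply/eqP.
  exact: (Rintegral_fubini F1).
exact: (Rintegral_fubini F2).
Qed.

Lemma cintegral_fubini_prod F (a : T1 -> R) (b : T2 -> R) : cmeasurable F ->
  rintegrable m1 a -> rintegrable m2 b ->
  (forall x y, Normc.normc (F (x, y)) <= a x * b y) ->
  cintegral m1 (fun x => cintegral m2 (fun y => F (x, y))) =
  cintegral m2 (fun y => cintegral m1 (fun x => F (x, y))).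
Proof.
move=> mF ia ib Fab; apply: cintegral_fubini.
by apply: (cintegrable_le mF (rintegrable_prod ia ib)) => -[x y]; exact: Fab.
Qed.

End cfubini.

(** * Lebesgue measure on row vectors *)

Section measurable_rV.
Context {disp} {T : measurableType disp} {R : realType} {d : nat}.
Implicit Types f g : T -> 'rV[R]_d.

Lemma measurable_rV_coord f i : measurable_fun setT f ->
  measurable_fun setT (fun t => f t ord0 i).
Proof. by move=> mf; exact: (measurableT_comp (measurable_coord i) mf). Qed.

Lemma measurable_rVD f g : measurable_fun setT f -> measurable_fun setT g ->
  measurable_fun setT (fun t => f t + g t).
Proof.
move=> mf mg; apply: measurable_fun_rV => i; under eq_fun do rewrite mxE.
by apply: measurable_funD; exact: measurable_rV_coord.
Qed.

Lemma measurable_rVZ (s : R) f : measurable_fun setT f ->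
  measurable_fun setT (fun t => s *: f t).
Proof.
move=> mf; apply: measurable_fun_rV => i; under eq_fun do rewrite mxE.
by apply: measurable_funM; [exact: measurable_cst|exact: measurable_rV_coord].
Qed.

Lemma measurable_dotp f g : measurable_fun setT f -> measurable_fun setT g ->
  measurable_fun setT (fun t => dotp (f t) (g t)).
Proof.
move=> mf mg; rewrite /dotp; apply: measurable_sum => i.
by apply: measurable_funM; exact: measurable_rV_coord.
Qed.

End measurable_rV.

(** * Measurability of open sets and of continuous functions *)

Section open_measurable_rV.
Context {R : realType} {d : nat}.
Implicit Types U : set 'rV[R]_d.

Lemma measurable_coord_set (A : 'I_d -> set R) : (forall i, measurable (A i)) ->
  measurable [set x : 'rV[R]_d | forall i, A i (x ord0 i)].
Proof.
move=> mA; rewrite (_ : mkset _ =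
    \bigcap_(i in setT) ((fun x : 'rV[R]_d => x ord0 i) @^-1` A i)).
  apply: fin_bigcap_measurable; first exact: finite_finset.
  move=> i _; rewrite -[X in measurable X]setTI.
  exact: (measurable_coord i measurableT (mA i)).
by apply/seteqP; split => [x Bx i _|x Bx i]; [exact: Bx|exact: Bx].
Qed.

Lemma measurable_ball_rV (x : 'rV[R]_d) e : 0 < e -> measurable (ball x e).
Proof.
move=> e0.
rewrite (_ : ball x e = [set y : 'rV[R]_d | forall i, ball (x ord0 i) e (y ord0 i)]).
  by apply: (@measurable_coord_set (fun i => ball (x ord0 i) e)) => i; exact: measurable_ball.
apply/seteqP; split => [y [_ xy] i|y xy]; first exact: xy.
by split => // i j; rewrite (ord1 i); exact: xy.
Qed.

(** The sigma-algebra is generated by the coordinates, so second countability enters: $U$ is the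
    union of the countably many balls with rational centre and radius $1/(n+1)$ that it contains,
    and balls of the sup norm are boxes. *)
Lemma open_measurable_rV U : open U -> measurable U.
Proof.
move=> oU.
pose Q (p : 'rV[rat]_d * nat) : 'rV[R]_d := map_mx ratr p.1.
pose F (p : 'rV[rat]_d * nat) : set 'rV[R]_d :=
  if `[< ball (Q p) p.2.+1%:R^-1 `<=` U >] then ball (Q p) p.2.+1%:R^-1 else set0.
pose G n := if unpickle n is Some p then F p else set0.
have mF p : measurable (F p).
  by rewrite /F; case: ifP => // _; apply: measurable_ball_rV; rewrite invr_gt0.
rewrite (_ : U = \bigcup_n G n).
  by apply: bigcupT_measurable => n; rewrite /G; case: unpickle.
apply/seteqP; split => [x Ux|x [n _]]; last first.
  rewrite /G; case: unpickle => // p; rewrite /F; case: ifPn => // /asboolP pU.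
  exact: pU.
have /nbhs_ballP[e /= e0 xeU] : nbhs x U by exact: open_nbhs_nbhs.
(* Half of [e], because a ball of radius $r$ that contains $x$ lies in the ball of radius $2r$
   around $x$. *)
have [n ne] : exists n, n.+1%:R^-1 < e / 2.
  have e2 : 0 < e / 2 by rewrite divr_gt0.
  by have [n _ /(_ n (leqnn n))] := near_infty_natSinv_lt (PosNum e2); exists n.
have n0 : 0 < n.+1%:R^-1 :> R by rewrite invr_gt0.
have qP i : {q : rat | `|x ord0 i - ratr q| < n.+1%:R^-1}.
  apply: cid; have [q] := @rat_in_itvoo R (x ord0 i) (x ord0 i + n.+1%:R^-1) (ltac:(by rewrite ltrDl)).
  by rewrite in_itv/= => /andP[q1 q2]; exists q; rewrite ltr0_norm ?subr_lt0// opprB ltrBlDl.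
pose q : 'rV[rat]_d := \row_i sval (qP i).
have xq : ball (Q (q, n)) n.+1%:R^-1 x.
  split=> // i j; rewrite (ord1 i) /ball/= !mxE distrC.
  by case: (qP j).
exists (pickle (q, n)) => //; rewrite /G pickleK /F /= ifT//.
apply/asboolP => y qy; apply: xeU.
apply: (@le_ball _ _ x (n.+1%:R^-1 + n.+1%:R^-1)).
  by rewrite [leRHS]splitr lerD// ltW.
by apply: ball_triangle qy; exact: ball_sym.
Qed.

Lemma continuous_measurable_rV (f : 'rV[R]_d -> R) : continuous f ->
  measurable_fun setT f.
Proof.
move=> /continuousP cf; apply: (measurability _ (RGenOpens.measurableE R)) => _ [_ [a [b ->]] <-].
by rewrite setTI; apply: open_measurable_rV; apply: cf; exact: interval_open.
Qed.

Lemma measurable_norm_rV : measurable_fun setT (fun x : 'rV[R]_d => `|x|).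
Proof. by apply: continuous_measurable_rV => x; exact: norm_continuous. Qed.

End open_measurable_rV.

(** * Affine changes of variables *)

Section lebesgue_rV_theory.
Context {R : realType}.
Notation mu d := (@borel_lebesgue R d).

Lemma ge0_integral_row_cons d (g : 'rV[R]_d.+1 -> \bar R) :
  measurable_fun setT g -> (forall x, 0 <= g x)%E ->
  (\int[mu d.+1]_x g x = \int[@lebesgue_measure R]_t \int[mu d]_x g (row_cons (t, x)))%E.
Proof.
move=> mg g0.
rewrite -(fubini_tonelli1 (m1 := @lebesgue_measure R) (m2 := mu d) (g \o @row_cons R d)) //.
- rewrite -(@ge0_integral_pushforward _ _ _ _ _ _ (@measurable_row_cons R d) _ setT)//.
- by apply: measurableT_comp => //; exact: measurable_row_cons.
- by move=> x; exact: g0.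
Qed.

(** By uniqueness of Lebesgue measure: $|s|$ times its image under $t \mapsto a + st$ has the right
    value on half-open intervals. For $s < 0$ the preimage of such an interval is closed at the
    other end, which does not change its length. *)
Lemma ge0_integral_lebesgue_affine (a s : R) (g : measurableTypeR R -> \bar R) : s != 0 ->
  measurable_fun setT g -> (forall x, 0 <= g x)%E ->
  (\int[@lebesgue_measure R]_t g (a + s * t)%R = (`|s|^-1)%:E * \int[@lebesgue_measure R]_t g t)%E.
Proof.
move=> s0 mg g0.
pose phi (t : measurableTypeR R) : measurableTypeR R := a + s * t.
have mphi : measurable_fun setT phi.
  by apply: measurable_funD; [exact: measurable_cst|exact: measurable_funM].
have sn : (0 <= `|s|^-1)%R by rewrite invr_ge0.
pose nu := mscale (NngNum sn) (@lebesgue_measure R).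
rewrite -(@ge0_integral_pushforward _ _ _ _ _ phi mphi (@lebesgue_measure R) setT)//.
rewrite -(ge0_integral_mscale (@lebesgue_measure R) measurableT (NngNum sn))//.
apply: eq_measure_integral => A mA _.
pose psi : {measure set (measurableTypeR R) -> \bar R} :=
  measure_function_pushforward__canonical__measure_function_Measure (@lebesgue_measure R) mphi.
pose nu' : {measure set (measurableTypeR R) -> \bar R} := mscale (NngNum (normr_ge0 s)) psi.
have H : lebesgue_measure A = nu' A.
  apply: lebesgue_measure_unique => // _ [[u v] _ <-].
  rewrite /nu' /= /mscale /= /psi /pushforward.
  have [sp|sneg|/eqP] := ltgtP s 0; last by rewrite (negbTE s0).
  - rewrite (_ : phi @^-1` _ = `[(v - a) / s, (u - a) / s[%classic); last first.
      apply/seteqP; split => t; rewrite /phi /= !in_itv/= => /andP[h1 h2].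
        by apply/andP; split; [rewrite ler_ndivrMr// mulrC; lra|rewrite ltr_ndivlMr// mulrC; lra].
      move: h1 h2; rewrite ler_ndivrMr// ltr_ndivlMr// ![t * s]mulrC => h1 h2.
      by apply/andP; split; lra.
    rewrite !lebesgue_measure_itv/= !lte_fin ltr_ndivrMr// divfK// ltrBlDr subrK.
    case: ifP => _; last by rewrite mule0.
    by rewrite -EFinB -EFinM -mulrBl ltr0_norm//; congr EFin; field.
  - rewrite (_ : phi @^-1` _ = `](u - a) / s, (v - a) / s]%classic); last first.
      apply/seteqP; split => t; rewrite /phi /= !in_itv/= => /andP[h1 h2].
        by apply/andP; split; [rewrite ltr_pdivrMr// mulrC; lra|rewrite ler_pdivlMr// mulrC; lra].
      move: h1 h2; rewrite ltr_pdivrMr// ler_pdivlMr// ![t * s]mulrC => h1 h2.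
      by apply/andP; split; lra.
    rewrite !lebesgue_measure_itv/= !lte_fin ltr_pdivrMr// divfK// ltrBlDr subrK.
    case: ifP => _; last by rewrite mule0.
    by rewrite -EFinB -EFinM -mulrBl gtr0_norm//; congr EFin; field.
rewrite /nu /= /mscale /= H /nu' /= /mscale /= muleA -EFinM mulVf ?normr_eq0//.
by rewrite mul1e.
Qed.

Lemma ge0_integral_affine d (a : 'rV[R]_d) (s : R) (g : 'rV[R]_d -> \bar R) :
  s != 0 -> measurable_fun setT g -> (forall x, 0 <= g x)%E ->
  (\int[mu d]_x g (a + s *: x)%R = (`|s| ^- d)%:E * \int[mu d]_x g x)%E.
Proof.
move=> s0; elim: d a g => [|d IH] a g mg g0.
  rewrite expr0 invr1 mul1e; apply: eq_integral => x _.
  by congr g; rewrite [LHS]thinmx0 [RHS]thinmx0.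
have maff : measurable_fun setT (fun x : 'rV[R]_d.+1 => a + s *: x).
  by apply: measurable_rVD; [exact: measurable_cst|apply: measurable_rVZ; exact: measurable_id].
rewrite ge0_integral_row_cons//; last exact: measurableT_comp.
pose a' : 'rV[R]_d := \row_i a ord0 (lift ord0 i).
have E t x : a + s *: row_cons (t, x) = row_cons (a ord0 ord0 + s * t, a' + s *: x).
  apply/rowP => i; rewrite [LHS]mxE [X in _ + X]mxE.
  case: (unliftP ord0 i) => [j ->|->]; last by rewrite !row_cons0.
  by rewrite !row_consS/= [RHS]mxE mxE; congr (_ + _); rewrite mxE.
have mg' t : measurable_fun setT (fun x => g (row_cons (t, x))).
  apply: measurableT_comp => //; apply: measurableT_comp; first exact: measurable_row_cons.
  exact: measurable_fun_pair.
under eq_integral do under eq_integral do rewrite E.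
transitivity (\int[@lebesgue_measure R]_t ((`|s| ^- d)%:E *
    \int[mu d]_x g (row_cons (a ord0 ord0 + s * t, x)%R))%E)%E.
  by apply: eq_integral => t _; rewrite (IH a' (fun x => g (row_cons (_, x)))).
have mG : measurable_fun setT (fun t => \int[mu d]_x g (row_cons (t, x)))%E.
  apply: (measurable_fun_fubini_tonelli_F (g \o @row_cons R d)) => //.
    by apply: measurableT_comp => //; exact: measurable_row_cons.
  by move=> x; exact: g0.
have G0 t : (0 <= \int[mu d]_x g (row_cons (t, x)))%E by exact: integral_ge0.
have mGa : measurable_fun setT (fun t : measurableTypeR R =>
    \int[mu d]_x g (row_cons (a ord0 ord0 + s * t, x)%R))%E.
  apply: (measurableT_comp mG).
  by apply: measurable_funD; [exact: measurable_cst|exact: measurable_funM].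
rewrite ge0_integralZl//.
rewrite (@ge0_integral_lebesgue_affine _ _ (fun t => \int[mu d]_x g (row_cons (t, x)))%E)//.
by rewrite muleA -EFinM -invfM -exprSr -ge0_integral_row_cons.
Qed.

Lemma rintegrable_affine d (a : 'rV[R]_d) (s : R) (g : 'rV[R]_d -> R) :
  s != 0 -> rintegrable (mu d) g -> rintegrable (mu d) (fun x => g (a + s *: x)).
Proof.
move=> s0 /integrableP[/measurable_EFinP mg ig].
have maff : measurable_fun setT (fun x : 'rV[R]_d => a + s *: x).
  by apply: measurable_rVD; [exact: measurable_cst|apply: measurable_rVZ; exact: measurable_id].
apply/integrableP; split.
  by apply/measurable_EFinP; exact: (measurableT_comp mg maff).
rewrite (@ge0_integral_affine _ _ _ (fun x => `|(g x)%:E|)%E)//.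
  by rewrite lte_mul_pinfty// ?lee_fin ?invr_ge0 ?exprn_ge0.
by apply: measurableT_comp => //; exact/measurable_EFinP.
Qed.

Lemma Rintegral_affine d (a : 'rV[R]_d) (s : R) (g : 'rV[R]_d -> R) :
  s != 0 -> rintegrable (mu d) g ->
  \int[mu d]_x g (a + s *: x) = `|s| ^- d * \int[mu d]_x g x.
Proof.
move=> s0 ig; have iga := rintegrable_affine a s0 ig.
have mg : measurable_fun setT (EFin \o g) by case/integrableP: ig.
rewrite /Rintegral (integralE _ _ (fun x => (g x)%:E)) [in LHS]integralE.
rewrite (_ : (fun x => (g (a + s *: x))%:E)  = (EFin \o g) \o (fun x => a + s *: x))//.
rewrite funepos_comp funeneg_comp.
rewrite (@ge0_integral_affine _ _ _ ((EFin \o g)^\+)%E)//; last exact: measurable_funepos.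
rewrite (@ge0_integral_affine _ _ _ ((EFin \o g)^\-)%E)//; last exact: measurable_funeneg.
have /fineK <- := integrable_pos_fin_num measurableT ig.
have /fineK <- := integrable_neg_fin_num measurableT ig.
by rewrite -!EFinM -!EFinB /= mulrBr.
Qed.

End lebesgue_rV_theory.

(** * The sup norm and the scalar product *)

Section rV_norm.
Context {R : realType} {d : nat}.
Implicit Types x y : 'rV[R]_d.

Lemma normr_coord x i : `|x ord0 i| <= `|x|.
Proof.
rewrite [leRHS]/Num.norm /= mx_normrE; apply/bigmax_geP; right => /=.
by exists (ord0, i).
Qed.

Lemma normr_coord_max x : x != 0 -> exists i, `|x| = `|x ord0 i|.
Proof.
move=> x0; have [|[j i] /= xE] := @mx_norm_neq0 _ _ _ x.
  by apply: contra_neq x0 => /mx_norm_eq0.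
by exists i; rewrite (ord1 j) in xE.
Qed.

Lemma normr_rV_le x (r : R) : 0 <= r -> (forall i, `|x ord0 i| <= r) -> `|x| <= r.
Proof.
move=> r0 xr; have [->|/normr_coord_max[i ->]] := eqVneq x 0; last exact: xr.
by rewrite normr0.
Qed.

Lemma dotpDr x y (z : 'rV[R]_d) : dotp z (x + y) = dotp z x + dotp z y.
Proof.
by rewrite /dotp -big_split/=; apply: eq_bigr => i _; rewrite mxE mulrDr.
Qed.

Lemma dotpZr (s : R) x y : dotp x (s *: y) = s * dotp x y.
Proof.
by rewrite /dotp mulr_sumr; apply: eq_bigr => i _; rewrite mxE mulrCA.
Qed.

Lemma dotpC x y : dotp x y = dotp y x.
Proof. by apply: eq_bigr => i _; rewrite mulrC. Qed.

Lemma dotpDl x y (z : 'rV[R]_d) : dotp (x + y) z = dotp x z + dotp y z.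
Proof. by rewrite dotpC dotpDr !(dotpC z). Qed.

Lemma dotpZl (s : R) x y : dotp (s *: x) y = s * dotp x y.
Proof. by rewrite dotpC dotpZr dotpC. Qed.

Lemma dotpNl x y : dotp (- x) y = - dotp x y.
Proof. by rewrite -scaleN1r dotpZl mulN1r. Qed.

Lemma dotp_delta x i : dotp x (delta_mx ord0 i) = x ord0 i.
Proof.
rewrite /dotp (bigD1 i)//= mxE !eqxx mulr1 big1 ?addr0// => j ji.
by rewrite mxE eqxx (negbTE ji) mulr0.
Qed.

Lemma normr_dotp x y : `|dotp x y| <= d%:R * (`|x| * `|y|).
Proof.
apply: le_trans (ler_norm_sum _ _ _) _.
apply: (@le_trans _ _ (\sum_(i < d) `|x| * `|y|)).
  by apply: ler_sum => i _; rewrite normrM ler_pM// normr_coord.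
by rewrite sumr_const card_ord mulr_natl.
Qed.

End rV_norm.

(** * An integrable power weight *)

Section weight.
Context {R : realType}.
Notation mu d := (@borel_lebesgue R d).

Lemma rintegrable_oneDsqrV :
  rintegrable (@lebesgue_measure R) (fun t : measurableTypeR R => (oneDsqr t)^-1).
Proof.
have mf : measurable_fun setT (fun t : R => (oneDsqr t)^-1).
  by apply: continuous_measurable_fun; exact: continuous_oneDsqrV.
have f0 (t : R) : (0 <= ((oneDsqr t)^-1)%:E)%E.
  by rewrite ?lee_fin invr_ge0 (le_trans ler01)// oneDsqr_ge1.
apply/integrableP; split; first exact/measurable_EFinP.
under eq_integral do rewrite /= ger0_norm -?lee_fin ?f0//.
have mE : measurable_fun setT (fun t : R => ((oneDsqr t)^-1)%:E).
  exact/measurable_EFinP.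
have hT : [set: measurableTypeR R] = `]-oo, 0%R]%classic `|` `]0%R, +oo[%classic.
  exact/esym/(itv_setU_setT false (0:R)).
rewrite hT ge0_integral_setU//=; last first.
  apply/disj_setPS => t; rewrite /= !in_itv/= andbT => -[h1 h2].
  by move: (le_lt_trans h1 h2); rewrite ltxx.
  by rewrite -hT.
have H : (\int[@lebesgue_measure R]_(x in `[0%R, +oo[) ((oneDsqr x)^-1)%:E < +oo)%E.
  by rewrite integral0y_oneDsqr ltry.
rewrite lte_add_pinfty//.
  rewrite (ge0_integration_by_substitution0 (f := fun x => ((oneDsqr x)^-1)%:E))// in H.
  apply: le_lt_trans H; rewrite le_eqVlt; apply/orP; left; apply/eqP.
  by apply: eq_integral => x _; rewrite /oneDsqr sqrrN.
apply: le_lt_trans H; apply: ge0_subset_integral => //.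
  exact: measurable_funTS.
by move=> t; rewrite /= !in_itv/= !andbT => /ltW.
Qed.

Lemma integral_prod_oneDsqrV d :
  (\int[mu d]_x (\prod_(i < d) (oneDsqr (x ord0 i))^-1)%:E < +oo)%E.
Proof.
elim: d => [|d IH].
  under eq_integral do rewrite big_ord0.
  by rewrite integral_cst//= diracT mul1e ltry.
have p0 n (x : 'rV[R]_n) : 0 <= \prod_(i < n) (oneDsqr (x ord0 i))^-1.
  by apply: prodr_ge0 => i _; rewrite invr_ge0 (le_trans ler01)// oneDsqr_ge1.
have mp n : measurable_fun setT (fun x : 'rV[R]_n => \prod_(i < n) (oneDsqr (x ord0 i))^-1).
  apply: measurable_prod => i _.
  have m1 : measurable_fun setT (fun t : R => (oneDsqr t)^-1).
    by apply: continuous_measurable_fun; exact: continuous_oneDsqrV.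
  exact: (measurableT_comp m1 (measurable_coord i)).
rewrite ge0_integral_row_cons; last 2 first.
- by apply/measurable_EFinP; exact: (mp d.+1).
- by move=> x; rewrite lee_fin.
set c := (\int[mu d]_x _)%E in IH.
have c0 : (0 <= c)%E by apply: integral_ge0 => x _; rewrite lee_fin.
rewrite (_ : (fun t => _) = fun t : measurableTypeR R => (c * ((oneDsqr t)^-1)%:E)%E); last first.
  apply/funext => t; rewrite muleC /c -ge0_integralZl//.
  - apply: eq_integral => x _; rewrite -EFinM big_ord_recl row_cons0/=.
    by congr (_ * _)%:E; apply: eq_bigr => i _; rewrite row_consS.
  - by apply/measurable_EFinP; exact: (mp d).
  - by move=> x _; rewrite lee_fin.
have [m1 i1] := integrableP _ _ _ rintegrable_oneDsqrV.
rewrite ge0_integralZl//.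
apply: lte_mul_pinfty => //; first by rewrite ge0_fin_numE.
apply: le_lt_trans i1; apply: ge0_le_integral => //.
- exact: measurableT_comp.
- by move=> t _ /=; rewrite lee_fin ler_norm.
Qed.

(** Since $1 + x_i^2 \le (1+|x|)^2$ for each of the $d$ coordinates, the weight is dominated by the
    product of the integrable functions $1/(1+x_i^2)$. Every [2 * d] below originates here. *)
Lemma rintegrable_weight d : rintegrable (mu d) (fun x => (1 + `|x|) ^- (2 * d)).
Proof.
have p0 n (x : 'rV[R]_n) : 0 <= \prod_(i < n) (oneDsqr (x ord0 i))^-1.
  by apply: prodr_ge0 => i _; rewrite invr_ge0 (le_trans ler01)// oneDsqr_ge1.
apply: (@rintegrable_le _ _ _ _ _ (fun x : 'rV[R]_d => \prod_(i < d) (oneDsqr (x ord0 i))^-1)).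
- have mD : measurable_fun setT (fun x : 'rV[R]_d => 1 + `|x|).
    by apply: measurable_funD; [exact: measurable_cst|exact: measurable_norm_rV].
  have mX := @measurable_funX _ _ _ _ _ (2 * d)%N mD.
  apply: continuous_measurable_rV => x.
  have D0 : (1 + `|x|) ^+ (2 * d) != 0 by rewrite gt_eqF// exprn_gt0// ltr_wpDr.
  suff c : {for x, continuous (fun y : 'rV[R]_d => (1 + `|y|) ^+ (2 * d))}.
    exact: (cvgV D0 c).
  apply: (@continuous_comp _ _ _ (fun y : 'rV[R]_d => 1 + `|y|) (fun t => t ^+ (2 * d))).
    exact: (cvgD (cvg_cst (1 : R)) (@norm_continuous R _ x)).
  exact: exprn_continuous.
- apply/integrableP; split.
    apply/measurable_EFinP; apply: measurable_prod => i _.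
    have m1 : measurable_fun setT (fun t : R => (oneDsqr t)^-1).
      by apply: continuous_measurable_fun; exact: continuous_oneDsqrV.
    exact: (measurableT_comp m1 (measurable_coord i)).
  under eq_integral do rewrite /= ger0_norm ?p0//.
  exact: integral_prod_oneDsqrV.
- move=> x; rewrite ger0_norm ?invr_ge0 ?exprn_ge0 ?addr_ge0//.
  rewrite prodfV lef_pV2 ?posrE.
  + have -> : (1 + `|x|) ^+ (2 * d) = \prod_(i < d) (1 + `|x|) ^+ 2.
      by rewrite prodr_const card_ord exprM.
    apply: ler_prod => i _; rewrite (le_trans ler01) ?oneDsqr_ge1//=.
    have := normr_coord x i; have := normr_ge0 (x ord0 i).
    rewrite /oneDsqr -(real_normK (num_real (x ord0 i))) => h1 h2.
    apply: (@le_trans _ _ ((1 + `|x ord0 i|) ^+ 2)); first by rewrite sqrrD; nra.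
    by rewrite lerXn2r ?nnegrE ?addr_ge0// lerD2l.
  + by rewrite exprn_gt0// ltr_wpDr.
  + by apply: prodr_gt0 => i _; rewrite (lt_le_trans ltr01)// oneDsqr_ge1.
Qed.

End weight.

Section cintegral_affine.
Context {R : realType} {d : nat}.
Notation mu := (@borel_lebesgue R d).

Lemma cintegrable_affine (a : 'rV[R]_d) (s : R) (g : 'rV[R]_d -> R[i]) :
  s != 0 -> cintegrable mu g -> cintegrable mu (fun x => g (a + s *: x)).
Proof.
move=> s0 [g1 g2]; split.
  exact: (rintegrable_affine a s0 g1).
exact: (rintegrable_affine a s0 g2).
Qed.

Lemma cintegral_affine (a : 'rV[R]_d) (s : R) (g : 'rV[R]_d -> R[i]) :
  s != 0 -> cintegrable mu g ->
  cintegral mu (fun x => g (a + s *: x)) = (`|s| ^- d)%:C * cintegral mu g.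
Proof.
move=> s0 [g1 g2]; rewrite /cintegral.
rewrite (Rintegral_affine a s0 g1) (Rintegral_affine a s0 g2).
by apply/eqP; rewrite eq_complex /= !mul0r subr0 addr0 !eqxx.
Qed.

End cintegral_affine.

(** * Directional smoothness *)

Section directional_derivative.
Context {R : realType} {d : nat}.
Implicit Types (f g h q : 'rV[R]_d -> R) (x v : 'rV[R]_d) (U V : set 'rV[R]_d).

(** Brings directional derivatives back to one-variable calculus on the line $t \mapsto x + tv$. *)
Lemma is_derive_lineP f x v (l : R) :
  is_derive x v f l <-> is_derive (0 : R) 1 (fun t : R => f (t *: v + x)) l.
Proof.
have E : (fun t : R => t^-1 *: ((f \o shift x) (t *: v) - f x)) =
    (fun t : R => t^-1 *: (((fun t : R => f (t *: v + x)) \o shift 0) (t *: 1) -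
      f (0 *: v + x))).
  by apply/funext => t /=; rewrite addr0 scale0r add0r [t *: 1]mulr1.
have E2 : derive f x v = derive (fun t : R => f (t *: v + x)) 0 1.
  by rewrite /derive E.
split=> -[df fl]; split.
- by move: df; rewrite /derivable E.
- by rewrite -E2.
- by rewrite /derivable E.
- by rewrite E2.
Qed.

Lemma is_derive_line f (f' : 'rV[R]_d -> R) x v (t : R) :
  is_derive (t *: v + x) v f (f' (t *: v + x)) ->
  is_derive t (1 : R) (fun t : R => f (t *: v + x)) (f' (t *: v + x)).
Proof.
move=> /is_derive_lineP H; pose g (u : R) := f (u *: v + (t *: v + x)).
have : is_derive (t - t) (1:R) g (f' (t *: v + x)) by rewrite subrr.
have D : is_derive t (1:R) (fun u : R => u - t) 1.
  by apply: is_derive_eq (subr0 _).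
move=> H2; have := @is_derive1_comp _ g (fun u => u - t) t _ _ H2 D.
rewrite mulr1; congr is_derive; apply/funext => u.
by rewrite /g /= addrA -scalerDl subrK.
Qed.

Lemma is_derive_chain f x v (l : R) (g : R -> R) (b : R) :
  is_derive x v f l -> is_derive (f x) (1 : R) g b ->
  is_derive x v (fun y => g (f y)) (b * l).
Proof.
move=> /is_derive_lineP fl gb; apply/is_derive_lineP.
apply: (@is_derive1_comp _ g (fun t => f (t *: v + x))) => //.
by rewrite scale0r add0r.
Qed.

Lemma is_derive_scale f x v (s l : R) :
  is_derive (s *: x) v f l -> is_derive x v (fun y => f (s *: y)) (s * l).
Proof.
move=> /is_derive_lineP fl; apply/is_derive_lineP.
have D : is_derive (0 : R) (1 : R) ( *%R^~ s) s.
  by apply: is_derive_eq; rewrite scaler0 add0r [s *: 1]mulr1.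
have fl' : is_derive (0 * s) (1:R) (fun t : R => f (t *: v + s *: x)) l by rewrite mul0r.
have := @is_derive1_comp _ (fun t : R => f (t *: v + s *: x)) ( *%R^~ s) 0 _ _ fl' D.
rewrite mulrC; congr is_derive; apply/funext => t /=.
by rewrite scalerDr scalerA mulrC.
Qed.

(* Directional smoothness along a single [v], with the derivative as a witness
   rather than ['D_v h], so that the product and chain rules apply verbatim. *)
Fixpoint smooth_along (n : nat) (v : 'rV[R]_d) (U : set 'rV[R]_d)
    (h : 'rV[R]_d -> R) : Prop :=
  (forall x, U x -> {for x, continuous h}) /\
  match n with
  | 0 => True
  | m.+1 => exists2 h', (forall x, U x -> is_derive x v h (h' x)) &
      smooth_along m v U h'
  end.

Lemma smooth_along_continuous n v U h : smooth_along n v U h ->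
  forall x, U x -> {for x, continuous h}.
Proof. by case: n => [|n] []. Qed.

Lemma smooth_alongW n v U h : smooth_along n.+1 v U h -> smooth_along n v U h.
Proof.
elim: n h => [|n IH] h [ch [h' dh sh]]; first by split.
by split => //; exists h' => //; exact: IH.
Qed.

Lemma smooth_along_sub n v U V h : V `<=` U -> smooth_along n v U h ->
  smooth_along n v V h.
Proof.
move=> VU; elim: n h => [|n IH] h [ch sh].
  by split => // x /VU; exact: ch.
split; first by move=> x /VU; exact: ch.
case: sh => h' dh sh; exists h'; last exact: IH.
by move=> x /VU; exact: dh.
Qed.

Lemma smooth_along_eq n v U h q : open U -> (forall x, U x -> h x = q x) ->
  smooth_along n v U h -> smooth_along n v U q.
Proof.
move=> oU hq.
have near_hq x : U x -> \near x, h x = q x.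
  by move=> Ux; near=> y; apply: hq; near: y; exact: open_nbhs_nbhs.
have cq : (forall x, U x -> {for x, continuous h}) ->
    forall x, U x -> {for x, continuous q}.
  move=> ch x Ux; suff : q y @[y --> x] --> h x by rewrite (hq x Ux).
  apply: cvg_trans (ch x Ux); apply: (@near_eq_cvg _ _ (nbhs x) _ h q).
  exact: near_hq.
case: n => [|n] [ch sh]; split => //; try exact: cq.
case: sh => h' dh sh; exists h' => // x Ux.
by apply: near_eq_is_derive (dh x Ux); exact: near_hq.
Unshelve. all: by end_near. Qed.

Lemma smooth_along_derive n v U h : open U -> smooth_along n.+1 v U h ->
  smooth_along n v U (fun x => 'D_v h x).
Proof.
move=> oU [_ [h' dh sh]]; apply: smooth_along_eq sh => // x Ux.
by have [_ ->] := dh x Ux.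
Qed.

(** The derivative witnesses on $U$ and on $V$ may be different functions; both are first exchanged
    for ['D_v h], which serves on the union. *)
Lemma smooth_alongU n v U V h : open U -> open V ->
  smooth_along n v U h -> smooth_along n v V h -> smooth_along n v (U `|` V) h.
Proof.
move=> oU oV; elim: n h => [|n IH] h sU sV.
  by case: sU sV => cU _ [cV _]; split => // x [/cU|/cV].
have [sU' sV'] := (smooth_along_derive oU sU, smooth_along_derive oV sV).
split; first by move=> x [/(smooth_along_continuous sU)|/(smooth_along_continuous sV)].
exists (fun x => 'D_v h x); last exact: IH.
move=> x [Ux|Vx].
  by case: sU => _ [h' /(_ x Ux)[dh _] _]; split.
by case: sV => _ [h' /(_ x Vx)[dh _] _]; split.
Qed.

Lemma smooth_along_cst n v U (c : R) : smooth_along n v U (fun=> c).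
Proof.
elim: n c => [|n IH] c; split=> //; try by move=> x _; exact: cst_continuous.
by exists (fun=> 0) => // x _; exact: is_derive_cst.
Qed.

Lemma smooth_alongD n v U f g : smooth_along n v U f -> smooth_along n v U g ->
  smooth_along n v U (fun x => f x + g x).
Proof.
elim: n f g => [|n IH] f g [cf sf] [cg sg]; split=> //.
- by move=> x Ux; exact: (cvgD (cf x Ux) (cg x Ux)).
- by move=> x Ux; exact: (cvgD (cf x Ux) (cg x Ux)).
- case: sf sg => f' df sf [g' dg sg].
  exists (fun x => f' x + g' x); last exact: IH.
  by move=> x Ux; have := df x Ux; have := dg x Ux => ? ?; exact: is_deriveD.
Qed.

Lemma smooth_alongM n v U f g : smooth_along n v U f -> smooth_along n v U g ->
  smooth_along n v U (fun x => f x * g x).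
Proof.
elim: n f g => [|n IH] f g sf sg; split=> //.
- by move=> x Ux; exact: (cvgM (smooth_along_continuous sf Ux) (smooth_along_continuous sg Ux)).
- by move=> x Ux; exact: (cvgM (smooth_along_continuous sf Ux) (smooth_along_continuous sg Ux)).
- have [sf' sg'] := (smooth_alongW sf, smooth_alongW sg).
  case: sf sg => _ [f' df sf] [_ [g' dg sg]].
  exists (fun x => f x * g' x + g x * f' x).
    by move=> x Ux; have := df x Ux; have := dg x Ux => ? ?; exact: is_deriveM.
  by apply: smooth_alongD; exact: IH.
Qed.

Lemma smooth_alongZ n v U (c : R) f : smooth_along n v U f ->
  smooth_along n v U (fun x => c * f x).
Proof. by move=> sf; apply: smooth_alongM sf; exact: smooth_along_cst. Qed.

Lemma smooth_alongN n v U f : smooth_along n v U f ->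
  smooth_along n v U (fun x => - f x).
Proof.
move=> /(smooth_alongZ (-1)).
by rewrite (_ : (fun x => -1 * f x) = fun x => - f x)//; apply/funext => x; rewrite mulN1r.
Qed.

Lemma smooth_alongX n m v U f : smooth_along n v U f ->
  smooth_along n v U (fun x => f x ^+ m).
Proof.
move=> sf; elim: m => [|m IH].
  by under eq_fun do rewrite expr0; exact: smooth_along_cst.
by under eq_fun do rewrite exprS; exact: smooth_alongM.
Qed.

Lemma smooth_along_sum n m v U (F : 'I_m -> 'rV[R]_d -> R) :
  (forall i, smooth_along n v U (F i)) ->
  smooth_along n v U (fun x => \sum_(i < m) F i x).
Proof.
elim: m F => [|m IH] F sF.
  by under eq_fun do rewrite big_ord0; exact: smooth_along_cst.
under eq_fun do rewrite big_ord_recr; apply: smooth_alongD => //.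
exact: (IH (fun i => F (widen_ord (leqnSn m) i))).
Qed.

Lemma smooth_alongV n v U f : (forall x, U x -> f x != 0) ->
  smooth_along n v U f -> smooth_along n v U (fun x => (f x)^-1).
Proof.
move=> f0; elim: n => [|n IH] sf.
  by split=> // x Ux; exact: (cvgV (f0 x Ux) (smooth_along_continuous sf Ux)).
have sf' := smooth_alongW sf; case: sf => cf [f' df sf]; split=> [x Ux|].
  exact: (cvgV (f0 x Ux) (cf x Ux)).
exists (fun x => - ((f x)^-1 ^+ 2) * f' x).
  move=> x Ux; have [df1 df2] := df x Ux; split; first exact: derivableV (f0 x Ux) df1.
  by rewrite deriveV ?f0// df2 exprVn.
by apply: smooth_alongM => //; apply: smooth_alongN; apply: smooth_alongX; exact: IH.
Qed.

Lemma smooth_along_scale n v U (s : R) f : smooth_along n v U f ->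
  smooth_along n v [set x | U (s *: x)] (fun x => f (s *: x)).
Proof.
elim: n f => [|n IH] f [cf sf].
  split=> // x Ux; apply: (@continuous_comp _ _ _ (fun x => s *: x) f); last exact: cf.
  exact: scaler_continuous.
split=> [x Ux|].
  apply: (@continuous_comp _ _ _ (fun x => s *: x) f); last exact: cf.
  exact: scaler_continuous.
case: sf => f' df sf; exists (fun x => s * f' (s *: x)).
  by move=> x Ux; apply: is_derive_scale; exact: df.
by apply: smooth_alongZ; exact: IH.
Qed.

Lemma smooth_along_dotp n v U (a : 'rV[R]_d) : smooth_along n v U (dotp a).
Proof.
have c (b : 'rV[R]_d) : continuous (dotp b).
  move=> x; suff [/(_ x I)] : smooth_along 0 0 setT (dotp b) by [].
  apply: smooth_along_sum => i; split=> // y _.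
  exact: (cvgM (@cst_continuous _ _ (b ord0 i) _) (@coord_continuous _ _ _ ord0 i y)).
case: n => [|n]; split=> //; try by move=> x _; exact: c.
exists (fun=> dotp a v); last exact: smooth_along_cst.
move=> x _; apply/is_derive_lineP.
rewrite (_ : (fun _ => _) = fun t : R => dotp a v * t + dotp a x); last first.
  by apply/funext => t; rewrite dotpDr dotpZr mulrC.
by apply: is_derive_eq; rewrite addr0 [_ *: 1]mulr1.
Qed.

(** The only delicate point is $t = 0$, where the difference quotient of $t_+^{n+2}$ is exactly
    $h_+^{n+1}$, which tends to $0$. *)
Lemma is_derive_pospow n (t : R) :
  is_derive t (1 : R) (fun t => Num.max t 0 ^+ n.+2) (n.+2%:R * Num.max t 0 ^+ n.+1).
Proof.
have [t0|t0|->] := ltgtP t 0.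
- rewrite ?(max_r (ltW t0)) expr0n/= mulr0.
  apply: (@near_eq_is_derive _ _ _ (fun=> 0)).
    have N : \forall u \near t, u <= 0 by have /cvgr_le/(_ _ t0) := @cvg_id _ (nbhs t).
    by near=> u; rewrite max_r ?expr0n//; near: u.
- apply: (@near_eq_is_derive R R R (fun u : R => u ^+ n.+2)).
    have N : \forall u \near t, 0 <= u by have /cvgr_ge/(_ _ t0) := @cvg_id _ (nbhs t).
    by near=> u; rewrite max_l//; near: u.
  by split; [exact: exprn_derivable|rewrite exp_derive /GRing.scale /= mulr1].
rewrite ?maxxx expr0n/= mulr0.
pose p (t : R) : R := Num.max t 0 ^+ n.+2.
have H : (fun h : R => h^-1 *: ((p \o shift 0) (h *: (1 : R)) - p 0)) @ 0^' --> (0 : R).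
  have -> : (fun h : R => h^-1 *: ((p \o shift 0) (h *: (1 : R)) - p 0)) =
      fun h : R => Num.max h 0 ^+ n.+1.
    apply/funext => h /=; rewrite addr0 /p /GRing.scale/= mulr1 maxxx expr0n subr0.
    have [h0|h0] := leP h 0; first by rewrite !expr0n mulr0.
    by rewrite exprS mulrA mulVf ?mul1r// gt_eqF.
  suff cc : {for (0 : R), continuous (fun h : R => Num.max h 0 ^+ n.+1)}.
    by move/continuous_withinNx : cc; rewrite maxxx expr0n.
  apply: (@continuous_comp R R R (fun u => Num.max u 0) (fun u => u ^+ n.+1)).
    apply: (@continuous_max R R id (fun=> 0)); first exact: cvg_id.
    exact: cst_continuous.
  exact: exprn_continuous.
by split; [apply/cvg_ex; exists 0|exact: cvg_lim H].
Unshelve. all: by end_near. Qed.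

(** The truncated power $t_+^{n+1}$ is of class $C^n$, with derivative a multiple of $t_+^n$. It is
    the building block of the cut-offs, for which finitely many derivatives suffice. *)
Lemma smooth_along_pospow n v U q : smooth_along n v U q ->
  smooth_along n v U (fun x => Num.max (q x) 0 ^+ n.+1).
Proof.
elim: n => [|n IH] sq.
  split=> // x Ux.
  apply: (@continuous_max _ _ q (fun=> 0)); last exact: cst_continuous.
  exact: (smooth_along_continuous sq Ux).
split=> [x Ux|].
  apply: (@continuous_comp _ _ _ (fun x => Num.max (q x) 0) (fun u => u ^+ n.+2)).
    apply: (@continuous_max _ _ q (fun=> 0)); last exact: cst_continuous.
    exact: (smooth_along_continuous sq Ux).
  exact: exprn_continuous.
have sq' := smooth_alongW sq.
case: sq => cq [q' dq sq]; exists (fun x => n.+2%:R * Num.max (q x) 0 ^+ n.+1 * q' x).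
  by move=> x Ux; exact: (is_derive_chain (dq x Ux) (is_derive_pospow n (q x))).
by apply: smooth_alongM => //; apply: smooth_alongZ; exact: IH.
Qed.

Lemma Cn_on_smooth_along n i U h : Cn_on n U h ->
  smooth_along n (delta_mx ord0 i) U h.
Proof.
elim: n h => [|n IH] h [ch Ch]; split=> //.
have [dh Ch'] := Ch i; exists (fun x => 'D_(delta_mx ord0 i) h x); last exact: IH.
by move=> x Ux; apply: derivableP; exact: dh.
Qed.

End directional_derivative.

(** * Inverse Fourier transforms of test functions *)

(** The values lie in an arbitrary [zmodType] because the operator is applied to complex functions
    and to their real and imaginary parts. *)
Definition fdiff (R : realType) (d : nat) (V : zmodType) (b : 'rV[R]_d)
  (g : 'rV[R]_d -> V) : 'rV[R]_d -> V := fun x => g (x + b) - g x.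

Lemma mean_value_le (R : realType) (p p' : R -> R) (t A : R) :
  (forall s, is_derive s (1 : R) p (p' s)) ->
  (forall s, `|s| <= `|t| -> `|p' s| <= A) -> `|p t - p 0| <= `|t| * A.
Proof.
move=> dp pA; have cp : continuous p.
  move=> s; apply: differentiable_continuous; apply/derivable1_diffP.
  by have [] := dp s.
have [t0|t0] := leP 0 t.
  have [s] := @MVT_segment _ p p' 0 t t0 (fun s _ => dp s) (continuous_subspaceT cp).
  rewrite in_itv/= subr0 => /andP[s0 st] ->.
  by rewrite normrM mulrC ler_wpM2l// pA// !ger0_norm// (le_trans s0).
have [s] := @MVT_segment _ p p' t 0 (ltW t0) (fun s _ => dp s) (continuous_subspaceT cp).
rewrite in_itv/= sub0r => /andP[s0 st]; rewrite distrC => ->.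
by rewrite normrM normrN mulrC ler_wpM2l// pA// !ler0_norm ?lerN2// ltW.
Qed.

(** * Finite differences of functions with a bounded derivative *)

Section finite_differences.
Context {R : realType} {d : nat}.
Implicit Types (g h : 'rV[R]_d -> R) (x v : 'rV[R]_d).

(** The constant [A] bounds the derivative of order [n] only; those of lower order merely exist. *)
Fixpoint bounded_along (n : nat) (v : 'rV[R]_d) (A : R) (h : 'rV[R]_d -> R) : Prop :=
  match n with
  | 0 => forall x, `|h x| <= A
  | m.+1 => exists2 h', (forall x, is_derive x v h (h' x)) & bounded_along m v A h'
  end.

Lemma line_mean_value g g' v x (t A : R) :
  (forall x, is_derive x v g (g' x)) ->
  (forall s, `|s| <= `|t| -> `|g' (s *: v + x)| <= A) ->
  `|g (t *: v + x) - g x| <= `|t| * A.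
Proof.
move=> dg gA; have := @mean_value_le R (fun s => g (s *: v + x)) (fun s => g' (s *: v + x)) t A.
by rewrite scale0r add0r; apply => // s; exact: is_derive_line.
Qed.

Lemma is_derive_fdiff g g' v b : (forall x, is_derive x v g (g' x)) ->
  forall x, is_derive x v (fdiff b g) (fdiff b g' x).
Proof.
move=> dg x; have d1 : is_derive x v (fun y => g (y + b)) (g' (x + b)).
  apply/is_derive_lineP; have /is_derive_lineP := dg (x + b).
  by congr is_derive; apply/funext => t; rewrite addrA.
by have d2 := dg x; exact: is_deriveB.
Qed.

Lemma bounded_along_fdiff n v (A t : R) g : bounded_along n.+1 v A g ->
  bounded_along n v (`|t| * A) (fdiff (t *: v) g).
Proof.
elim: n g => [|n IH] g [g' dg Ag].
  move=> x; rewrite /fdiff [x + _]addrC; apply: (line_mean_value dg) => s _.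
  exact: Ag.
by exists (fdiff (t *: v) g'); [exact: is_derive_fdiff|exact: IH].
Qed.

(** By the mean value theorem each difference with step $tv$ consumes one derivative and gains a
    factor $|t|$. *)
Lemma normr_iter_fdiff n v (A t : R) g x : bounded_along n v A g ->
  `|iter n (fdiff (t *: v)) g x| <= `|t| ^+ n * A.
Proof.
elim: n A g => [|n IH] A g Ag; first by rewrite expr0 mul1r; exact: Ag.
rewrite iterSr exprSr -mulrA; apply: IH; exact: bounded_along_fdiff.
Qed.

Lemma continuous_bounded_support g (r : R) : continuous g ->
  (forall x, r < `|x| -> g x = 0) -> exists2 A, 0 <= A & forall x, `|g x| <= A.
Proof.
move=> cg g0; have [r0|r0] := ltP r 0.
  exists 0 => // x; rewrite g0 ?normr0//; exact: lt_le_trans r0 _.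
pose K := [set x : 'rV[R]_d | `|x| <= r].
have cK : compact K.
  apply: bounded_closed_compact.
    by exists r; split; [exact: num_real|move=> M rM x /= /le_trans; apply; exact: ltW].
  rewrite (_ : K = (fun x : 'rV[R]_d => `|x|) @^-1` [set t | t <= r])//.
  by apply: closed_comp; [move=> x _; exact: norm_continuous|exact: closed_le].
have := @EVT_max_rV R d (fun x => `|g x|) K.
case=> //.
- by exists 0; rewrite /K/= normr0.
- apply: continuous_subspaceT => x.
  by apply: (@continuous_comp _ _ _ g (fun t : R => `|t|)); [exact: cg|exact: norm_continuous].
move=> c _ H; exists `|g c| => // x; have [xr|xr] := leP `|x| r.
  by apply: H; rewrite inE.
by rewrite g0// normr0.
Qed.

Lemma smooth_along_bounded n v g (r : R) : smooth_along n v setT g ->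
  (forall x, r < `|x| -> g x = 0) -> exists2 A, 0 <= A & bounded_along n v A g.
Proof.
elim: n g => [|n IH] g [cg sg] g0.
  have [A A0 gA] := continuous_bounded_support (fun x => cg x I) g0.
  by exists A.
case: sg => g' dg sg; have [|A A0 gA] := IH g' sg; last first.
  by exists A => //; exists g' => // x; exact: dg.
move=> x rx.
(* The region $|x| > r$ is open, so the derivative vanishes there too and the induction keeps the
   same radius. *)
have N : \near x, g x = 0.
  near=> y; apply: g0; near: y.
  have /cvgr_gt/(_ _ rx) : (fun y : 'rV[R]_d => `|y|) y @[y --> x] --> `|x|.
    exact: norm_continuous.
  by apply.
have D0 : is_derive x v (cst 0 : 'rV[R]_d -> R) 0 by exact: is_derive_cst.
have D1 : is_derive x v g 0.
  by apply: near_eq_is_derive D0; near=> y; apply/esym; near: y.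
have [_ <-] := dg x I; by have [] := D1.
Unshelve. all: by end_near. Qed.

End finite_differences.

(** * Decay of inverse Fourier transforms *)

Section test_functions.
Context {R : realType} {d : nat}.
Notation mu := (@borel_lebesgue R d).
Implicit Types (g : 'rV[R]_d -> R[i]) (x b : 'rV[R]_d).

Definition inverse_fourier g x : R[i] :=
  cintegral mu (fun w => g w * expi (2 * pi * dotp x w)).

Definition csmooth (N : nat) (U : set 'rV[R]_d) g : Prop :=
  forall i, smooth_along N (delta_mx ord0 i) U (fun x => complex.Re (g x)) /\
            smooth_along N (delta_mx ord0 i) U (fun x => complex.Im (g x)).

(** Continuity is stated apart because [csmooth] quantifies over coordinates and says nothing when
    $d = 0$. *)
Definition test_function (N : nat) g : Prop :=
  [/\ exists r : R, forall x, r < `|x| -> g x = 0,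
      continuous (fun x => complex.Re (g x)) /\ continuous (fun x => complex.Im (g x)) &
      csmooth N setT g].

Definition bounded_support g : Prop :=
  [/\ cmeasurable g, exists A : R, forall x, Normc.normc (g x) <= A &
      exists r : R, forall x, r < `|x| -> g x = 0].

Lemma test_function_bounded_support N g : test_function N g -> bounded_support g.
Proof.
move=> [[r gr] [cR cI] _]; split.
- by split; exact: continuous_measurable_rV.
- have [x rx|A A0 RA] := continuous_bounded_support cR (r := r); first by rewrite gr.
  have [x rx|B B0 IB] := continuous_bounded_support cI (r := r); first by rewrite gr.
  by exists (A + B) => x; rewrite (le_trans (normc_le_ReIm _))// lerD.
- by exists r.
Qed.

Lemma bounded_support_le g (A r : R) : cmeasurable g ->
  (forall x, Normc.normc (g x) <= A) -> (forall x, r < `|x| -> g x = 0) ->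
  forall x, Normc.normc (g x) <= A * (1 + `|r|) ^+ (2 * d) * (1 + `|x|) ^- (2 * d).
Proof.
move=> mg gA gr x; have A0 : 0 <= A := le_trans (normc_ge0 _) (gA x).
have [xr|/gr ->] := leP `|x| r; last first.
  by rewrite Normc.normc0 !mulr_ge0// ?invr_ge0 exprn_ge0 ?addr_ge0.
apply: le_trans (gA x) _; rewrite -mulrA ler_peMr//.
rewrite -exprVn -exprMn exprn_ege1// ler_pdivlMr ?ltr_wpDr// mul1r lerD2l.
exact: le_trans xr (ler_norm _).
Qed.

Lemma bounded_support_integrable g : bounded_support g -> cintegrable mu g.
Proof.
move=> [mg [A gA] [r gr]].
apply: (@cintegrable_le _ _ _ mu _
  (fun x => A * (1 + `|r|) ^+ (2 * d) * (1 + `|x|) ^- (2 * d))) => //.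
  by apply: rintegrableZ; exact: rintegrable_weight.
exact: bounded_support_le.
Qed.

Lemma measurable_phase : measurable_fun setT
  (fun z : 'rV[R]_d * 'rV[R]_d => 2 * pi * dotp z.1 z.2).
Proof.
apply: measurable_funM; first exact: measurable_cst.
by apply: measurable_dotp; [exact: measurable_fst|exact: measurable_snd].
Qed.

Lemma cmeasurable_phase x : cmeasurable (fun w => expi (2 * pi * dotp x w)).
Proof.
apply: cmeasurable_expi; apply: measurable_funM; first exact: measurable_cst.
by apply: measurable_dotp; [exact: measurable_cst|exact: measurable_id].
Qed.

Lemma cintegrable_phase g x : cintegrable mu g ->
  cintegrable mu (fun w => g w * expi (2 * pi * dotp x w)).
Proof.
move=> ig; apply: (cintegrable_le _ (cintegrable_normc ig)).
  by apply: cmeasurableM; [exact: cintegrable_measurable ig|exact: cmeasurable_phase].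
by move=> w; rewrite Normc.normcM normc_expi mulr1.
Qed.

Lemma cmeasurable_inverse_fourier g : cmeasurable g -> cmeasurable (inverse_fourier g).
Proof.
move=> mg; apply: (@cmeasurable_cintegral _ _ _ _ _ mu
  (fun z => g z.2 * expi (2 * pi * dotp z.1 z.2))).
apply: cmeasurableM; first exact: (cmeasurable_comp mg measurable_snd).
by apply: cmeasurable_expi; exact: measurable_phase.
Qed.

Lemma inverse_fourier_shift g x b : cintegrable mu g ->
  inverse_fourier (fun w => g (w + b)) x =
  expi (- (2 * pi * dotp x b)) * inverse_fourier g x.
Proof.
move=> ig; rewrite /inverse_fourier -cintegralZ; last exact: cintegrable_phase.
have := @cintegral_affine R d b 1
  (fun w => expi (- (2 * pi * dotp x b)) * (g w * expi (2 * pi * dotp x w))) (oner_neq0 _).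
rewrite normr1 expr1n invr1 mul1r => <-; last first.
  by apply: cintegrableZ; exact: cintegrable_phase.
apply: eq_cintegral => w; rewrite scale1r addrC mulrCA -expiD dotpDr.
by congr (_ * expi _); ring.
Qed.

(** The step [b] is tuned so that translation multiplies the transform by $e^{-i\pi} = -1$;
    subtracting the original gives $-2$. *)
Lemma inverse_fourier_fdiff g x b : cintegrable mu g -> dotp x b = 2^-1 ->
  inverse_fourier (fdiff b g) x = - 2 * inverse_fourier g x.
Proof.
move=> ig xb; have igb := cintegrable_affine b (oner_neq0 _) ig.
have e : (fun w => g (w + b)) = (fun w => g (b + 1 *: w)).
  by apply/funext => w; rewrite scale1r addrC.
transitivity (inverse_fourier (fun w => g (w + b)) x + (-1) * inverse_fourier g x).
  rewrite /inverse_fourier -cintegralZ; last exact: cintegrable_phase.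
  rewrite -cintegralD.
  - by apply: eq_cintegral => w; rewrite /fdiff mulrBl mulN1r.
  - by apply: (@cintegrable_phase (fun w => g (w + b))); rewrite e.
  - by apply: cintegrableZ; exact: cintegrable_phase.
rewrite inverse_fourier_shift// xb mulrAC divff ?pnatr_eq0// mul1r expiN expi_pi.
by rewrite rmorphN rmorph1 -mulrDl -opprD.
Qed.

Lemma bounded_support_fdiff g b : bounded_support g -> bounded_support (fdiff b g).
Proof.
move=> [mg [A gA] [r gr]]; split.
- have -> : fdiff b g = fun x => g (x + b) + (-1) * g x.
    by apply/funext => x; rewrite mulN1r.
  apply: cmeasurableD.
    apply: (cmeasurable_comp mg); apply: measurable_rVD; first exact: measurable_id.
    exact: measurable_cst.
  by apply: cmeasurableM => //; exact: cmeasurable_cst.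
- by exists (A + A) => x; rewrite (le_trans (normcB _ _))// lerD.
- exists (r + `|b|) => x rx; rewrite /fdiff !gr ?subrr//.
    by rewrite (le_lt_trans _ rx)// lerDl.
  rewrite -(ltrD2r `|b|) (lt_le_trans rx)//.
  by rewrite -[in leLHS](addrK b x) (le_trans (ler_normB _ _)).
Qed.

Lemma inverse_fourier_iter_fdiff n g x b : bounded_support g -> dotp x b = 2^-1 ->
  bounded_support (iter n (fdiff b) g) /\
  inverse_fourier (iter n (fdiff b) g) x = (- 2) ^+ n * inverse_fourier g x.
Proof.
move=> bg xb; elim: n => [|n [IH1 IH2]]; first by rewrite expr0 mul1r.
split; first exact: bounded_support_fdiff.
rewrite iterS inverse_fourier_fdiff// ?IH2; last exact: bounded_support_integrable.
by rewrite exprS mulrA.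
Qed.

Lemma iter_fdiff_support n (V : zmodType) (g : 'rV[R]_d -> V) (r : R) b : `|b| <= 1 ->
  (forall x, r < `|x| -> g x = 0) ->
  forall x, r + n%:R < `|x| -> iter n (fdiff b) g x = 0.
Proof.
move=> b1 gr; elim: n => [|n IH] x; first by rewrite addr0; exact: gr.
rewrite -natr1 addrA => rx; rewrite iterS /fdiff !IH ?subrr//.
  by rewrite (le_lt_trans _ rx)// lerDl.
rewrite -(ltrD2r 1) (lt_le_trans rx)// -[in leLHS](addrK b x).
by rewrite (le_trans (ler_normB _ _))// lerD2l.
Qed.

Lemma Re_iter_fdiff n g b x :
  complex.Re (iter n (fdiff b) g x) = iter n (fdiff b) (fun x => complex.Re (g x)) x.
Proof.
elim: n x => [|n IH] x //; rewrite !iterS {1 3}/fdiff -!IH cReD.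
by congr (_ + _); case: (iter n _ _ x).
Qed.

Lemma Im_iter_fdiff n g b x :
  complex.Im (iter n (fdiff b) g x) = iter n (fdiff b) (fun x => complex.Im (g x)) x.
Proof.
elim: n x => [|n IH] x //; rewrite !iterS {1 3}/fdiff -!IH cImD.
by congr (_ + _); case: (iter n _ _ x).
Qed.

Lemma test_function_bounded_along N g : test_function N g ->
  exists2 A, 0 <= A & forall i,
    bounded_along N (delta_mx ord0 i) A (fun x => complex.Re (g x)) /\
    bounded_along N (delta_mx ord0 i) A (fun x => complex.Im (g x)).
Proof.
move=> [[r gr] _ sg].
have mono n v (A B : R) h : A <= B -> bounded_along n v A h -> bounded_along n v B h.
  move=> AB; elim: n h => [|n IH] h; first by move=> hA x; exact: le_trans (hA x) AB.
  by move=> [h' dh sh]; exists h' => //; exact: IH.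
have H i : {A | 0 <= A & bounded_along N (delta_mx ord0 i) A (fun x => complex.Re (g x)) /\
    bounded_along N (delta_mx ord0 i) A (fun x => complex.Im (g x))}.
  apply: cid2; have [sR sI] := sg i.
  have [x rx|A A0 RA] := smooth_along_bounded sR (r := r); first by rewrite gr.
  have [x rx|B B0 IB] := smooth_along_bounded sI (r := r); first by rewrite gr.
  exists (A + B); first exact: addr_ge0.
  by split; [apply: mono RA; rewrite lerDl|apply: mono IB; rewrite lerDr].
exists (\sum_i s2val (H i)).
  by apply: sumr_ge0 => i _; case: (H i).
move=> i; have [HR HI] := s2valP' (H i).
have le : s2val (H i) <= \sum_i s2val (H i).
  rewrite (bigD1 i)//= lerDl; apply: sumr_ge0 => j _; exact: (s2valP (H j)).
by split; [exact: mono le HR|exact: mono le HI].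
Qed.

(* Integrating by parts [N] times is replaced by [N] translations of step
   [e_i / (2 x_i)], each of which multiplies the phase by [-1]. *)
Lemma inverse_fourier_decay N g : test_function N g ->
  exists2 C, 0 <= C & forall x, Normc.normc (inverse_fourier g x) <= C * (1 + `|x|) ^- N.
Proof.
move=> tg; have bg := test_function_bounded_support tg.
have [A A0 HA] := test_function_bounded_along tg.
have ig := bounded_support_integrable bg.
case: (bg) => mg [M gM] [r gr].
pose I0 := 2 * \int[mu]_x Normc.normc (g x).
have I00 : 0 <= I0 by rewrite mulr_ge0// Rintegral_ge0// => x _; exact: normc_ge0.
pose W := \int[mu]_x (1 + `|x|) ^- (2 * d).
have W0 : 0 <= W.
  by rewrite Rintegral_ge0// => x _; rewrite invr_ge0 exprn_ge0// addr_ge0.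
pose r' := r + N%:R.
pose C1 := 2 * (2 * A * (1 + `|r'|) ^+ (2 * d) * W).
have C10 : 0 <= C1 by rewrite !mulr_ge0// exprn_ge0 ?addr_ge0.
exists ((I0 + C1) * 2 ^+ N); first by rewrite mulr_ge0 ?addr_ge0// exprn_ge0.
(* For $|x| \le 1$ the trivial bound by the integral of $|g|$ is enough, as $(1+|x|)^N \le 2^N$. *)
move=> x; have [x1|x1] := leP `|x| 1.
  apply: (@le_trans _ _ I0).
    apply: normc_cintegral.
    - by apply: cmeasurableM => //; exact: cmeasurable_phase.
    - exact: cintegrable_normc.
    - by move=> w; rewrite Normc.normcM normc_expi mulr1.
  rewrite -mulrA -exprVn -exprMn (@le_trans _ _ (I0 + C1)) ?lerDl//.
  rewrite ler_peMr ?addr_ge0// exprn_ege1// ler_pdivlMr ?ltr_wpDr//.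
  by rewrite mul1r -[leRHS]/(1 + 1) lerD2l.
have x0 : x != 0 by rewrite -normr_gt0 (lt_trans _ x1).
(* The coordinate of largest modulus realizes the sup norm, so the step has length $1/(2|x|)$. *)
have [i xi] := normr_coord_max x0.
have xi0 : x ord0 i != 0 by rewrite -normr_gt0 -xi normr_gt0.
pose t := (2 * x ord0 i)^-1; pose b : 'rV[R]_d := t *: delta_mx ord0 i.
have xb : dotp x b = 2^-1.
  by rewrite dotpZr dotp_delta /t invfM mulfVK.
have tE : `|t| = (2 * `|x|)^-1 by rewrite normfV normrM xi ger0_norm.
(* This uses $|x| > 1$, and keeps the support of the iterated difference within radius $r + N$,
   independently of $x$. *)
have b1 : `|b| <= 1.
  apply: normr_rV_le => // j; rewrite !mxE eqxx/=.
  rewrite normrM tE (@le_trans _ _ ((2 * `|x|)^-1)) ?ler_piMr ?invr_ge0 ?mulr_ge0//.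
    by case: (j == i); rewrite ?normr1 ?normr0.
  by rewrite invf_le1 ?mulr_gt0 ?normr_gt0//; lra.
have [bN FN] := inverse_fourier_iter_fdiff N bg xb.
have sN := iter_fdiff_support (n := N) b1 gr; rewrite -/r' in sN.
have BN w : Normc.normc (iter N (fdiff b) g w) <= 2 * A * `|t| ^+ N.
  rewrite (le_trans (normc_le_ReIm _))// Re_iter_fdiff Im_iter_fdiff.
  have [HR HI] := HA i.
  rewrite (_ : 2 * A * `|t| ^+ N = `|t| ^+ N * A + `|t| ^+ N * A); last by ring.
  by rewrite lerD// normr_iter_fdiff.
have E : Normc.normc (inverse_fourier (iter N (fdiff b) g) x) <= C1 * `|t| ^+ N.
  pose h (w : 'rV[R]_d) := 2 * A * `|t| ^+ N * (1 + `|r'|) ^+ (2 * d) * (1 + `|w|) ^- (2 * d).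
  apply: (@le_trans _ _ (2 * \int[mu]_w h w)).
    apply: normc_cintegral.
    - by case: bN => mN _ _; apply: cmeasurableM => //; exact: cmeasurable_phase.
    - by apply: rintegrableZ; exact: rintegrable_weight.
    - move=> w; rewrite Normc.normcM normc_expi mulr1.
      by case: bN => mN _ _; exact: bounded_support_le.
  rewrite /h RintegralZl//; last exact: rintegrable_weight.
  by rewrite -/W /C1 le_eqVlt; apply/orP; left; apply/eqP; ring.
move: E; rewrite FN Normc.normcM normcX normcN.
have -> : Normc.normc (2 : R[i]) = 2.
  have -> : (2 : R[i]) = (2 : R)%:C by rewrite rmorph_nat.
  by rewrite normc_real ger0_norm.
move=> E; have {}E : Normc.normc (inverse_fourier g x) <= C1 * (`|t| / 2) ^+ N.
  by rewrite exprMn exprVn mulrA ler_pdivlMr ?exprn_gt0// mulrC.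
rewrite (le_trans E)// -(mulrA (I0 + C1)); apply: ler_pM => //.
  by rewrite lerDr.
rewrite -exprVn -exprMn lerXn2r ?nnegrE ?mulr_ge0 ?invr_ge0 ?addr_ge0//.
rewrite tE -invfM ler_pdivlMr ?ltr_wpDr// mulrC.
rewrite ler_pdivrMr ?mulr_gt0 ?(lt_trans _ x1)//.
by move: x1; set y := `|x| => x1; lra.
Qed.

End test_functions.

(** * Orthogonality to wavelets *)

Section growth.
Context {R : realType} {d : nat}.
Notation mu := (@borel_lebesgue R d).
Implicit Types (f h psi : 'rV[R]_d -> R[i]) (x a : 'rV[R]_d).

Lemma onenorm_gt0 x : 0 < 1 + `|x|.
Proof. by rewrite ltr_wpDr. Qed.

Lemma onenormD x y : 1 + `|x + y| <= (1 + `|x|) * (1 + `|y|).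
Proof.
have := ler_normD x y; have := normr_ge0 x; have := normr_ge0 y.
by nra.
Qed.

Lemma onenormZ (s : R) x : 1 + `|s *: x| <= (1 + `|s|) * (1 + `|x|).
Proof. by rewrite normrZ; have := normr_ge0 x; have := normr_ge0 s; nra. Qed.

Definition growth (k : nat) f : Prop := cmeasurable f /\
  exists2 C : R, 0 <= C & forall x, Normc.normc (f x) <= C * (1 + `|x|) ^+ k.

(** The exponent is chosen so that the product with a function of [growth k] is dominated by the
    weight $(1+|x|)^{-2d}$. *)
Definition decay (k : nat) h : Prop := cmeasurable h /\
  exists2 C : R, 0 <= C & forall x, Normc.normc (h x) <= C * (1 + `|x|) ^- (k + 2 * d).

Lemma measurable_affine a (s : R) :
  measurable_fun setT (fun x : 'rV[R]_d => a + s *: x).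
Proof.
apply: measurable_rVD; first exact: measurable_cst.
by apply: measurable_rVZ; exact: measurable_id.
Qed.

Lemma growth_affine_bound k (C : R) f a (s : R) x : 0 <= C ->
  (forall x, Normc.normc (f x) <= C * (1 + `|x|) ^+ k) ->
  Normc.normc (f (a + s *: x)) <=
    C * ((1 + `|a|) * (1 + `|s|)) ^+ k * (1 + `|x|) ^+ k.
Proof.
move=> C0 fC; rewrite (le_trans (fC _))// -mulrA ler_wpM2l// -exprMn.
rewrite lerXn2r ?nnegrE ?mulr_ge0 ?addr_ge0//.
by rewrite (le_trans (onenormD _ _))// -mulrA ler_wpM2l ?addr_ge0// onenormZ.
Qed.

Lemma growth_affine k f a (s : R) : growth k f -> growth k (fun x => f (a + s *: x)).
Proof.
move=> [mf [C C0 fC]]; split.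
  exact: (cmeasurable_comp mf (measurable_affine a s)).
exists (C * ((1 + `|a|) * (1 + `|s|)) ^+ k).
  by rewrite mulr_ge0// exprn_ge0// mulr_ge0// addr_ge0.
by move=> x; exact: growth_affine_bound.
Qed.

Lemma measurable_onenorm k : measurable_fun setT (fun x : 'rV[R]_d => (1 + `|x|) ^+ k).
Proof.
apply: measurable_funX; apply: measurable_funD; first exact: measurable_cst.
exact: measurable_norm_rV.
Qed.

Lemma onenorm_weight k x :
  (1 + `|x|) ^+ k * (1 + `|x|) ^- (k + 2 * d) = (1 + `|x|) ^- (2 * d).
Proof.
rewrite exprD invfM mulrA divff ?mul1r// expf_neq0// gt_eqF//; exact: onenorm_gt0.
Qed.

Lemma growth_decay_le k f h (C D : R) : 0 <= C -> 0 <= D ->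
  (forall x, Normc.normc (f x) <= C * (1 + `|x|) ^+ k) ->
  (forall x, Normc.normc (h x) <= D * (1 + `|x|) ^- (k + 2 * d)) ->
  forall x, Normc.normc (f x * h x) <= C * D * (1 + `|x|) ^- (2 * d).
Proof.
move=> C0 D0 fC hD x; rewrite Normc.normcM -(onenorm_weight k).
rewrite mulrACA ler_pM ?normc_ge0//.
Qed.

Lemma growth_decay_integrable k f h : growth k f -> decay k h ->
  cintegrable mu (fun x => f x * h x).
Proof.
move=> [mf [C C0 fC]] [mh [D D0 hD]].
apply: (@cintegrable_le _ _ _ mu _ (fun x => C * D * (1 + `|x|) ^- (2 * d))).
- exact: cmeasurableM.
- by apply: rintegrableZ; exact: rintegrable_weight.
- exact: growth_decay_le.
Qed.

Lemma growth_decay_integrable_shift k f h a : growth k f -> decay k h ->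
  cintegrable mu (fun x => f x * h (x - a)).
Proof.
move=> gf dh; have := growth_decay_integrable (growth_affine a 1 gf) dh.
move=> /(cintegrable_affine (- a) (oner_neq0 _)).
rewrite (_ : (fun x => _) = fun x => f x * h (x - a))//.
by apply/funext => x; rewrite !scale1r addNKr [- a + x]addrC.
Qed.

Lemma test_function_decay k g : test_function (k + 2 * d) g ->
  decay k (inverse_fourier g).
Proof.
move=> tg; split; last exact: inverse_fourier_decay.
by apply: cmeasurable_inverse_fourier; case: (test_function_bounded_support tg).
Qed.

Definition moment (k : nat) psi : Prop := cmeasurable psi /\
  rintegrable mu (fun x => Normc.normc (psi x) * (1 + `|x|) ^+ k).

Lemma moment_integrable k psi : moment k psi -> cintegrable mu psi.
Proof.
move=> [mpsi ipsi]; apply: (cintegrable_le mpsi ipsi) => x.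
by rewrite ler_peMr ?normc_ge0// exprn_ege1// lerDl.
Qed.

(** Counterpart of [fourier] for the Borel product measure, which is the setting of Fubini. *)
Definition fourier_borel psi (w : 'rV[R]_d) : R[i] :=
  cintegral mu (fun x => psi x * expi (- (2 * pi * dotp w x))).

Lemma measurable_pair_affine a (s : R) :
  measurable_fun setT (fun z : 'rV[R]_d * 'rV[R]_d => z.1 + (a + s *: z.2)).
Proof.
apply: measurable_rVD; first exact: measurable_fst.
by apply: measurable_rVD; [exact: measurable_cst|apply: measurable_rVZ; exact: measurable_snd].
Qed.

Lemma cmeasurable_phaseN w : cmeasurable (fun x => expi (- (2 * pi * dotp w x))).
Proof.
under eq_fun do rewrite expiN; apply: cmeasurableJ; exact: cmeasurable_phase.
Qed.

(** The convolution theorem: the conjugate of $\widehat\psi(-sw)$ brings in the phase $e^{-2\pi i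
    s\, w\cdot y}$, which turns $z$ into $z - sy$ in the transform of $g$. Everything is absolutely
    integrable, so Fubini applies. *)
Lemma inverse_fourier_conv k g psi (s : R) z : bounded_support g -> moment k psi ->
  inverse_fourier (fun w => g w * (fourier_borel psi (- s *: w))^*) z =
  cintegral mu (fun y => (psi y)^* * inverse_fourier g (z - s *: y)).
Proof.
move=> bg mpsi; have ipsi := moment_integrable mpsi.
have ig := bounded_support_integrable bg; case: bg => mg _ _.
have mpsi' := cintegrable_measurable ipsi.
pose F (p : 'rV[R]_d * 'rV[R]_d) : R[i] :=
  g p.1 * (psi p.2)^* * expi (2 * pi * dotp (z - s *: p.2) p.1).
have mF : cmeasurable F.
  apply: cmeasurableM; first apply: cmeasurableM.
  - exact: (cmeasurable_comp mg measurable_fst).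
  - by apply: cmeasurableJ; exact: (cmeasurable_comp mpsi' measurable_snd).
  - apply: cmeasurable_expi; apply: measurable_funM; first exact: measurable_cst.
    apply: measurable_dotp; last exact: measurable_fst.
    under eq_fun do rewrite -scaleNr.
    apply: measurable_rVD; first exact: measurable_cst.
    by apply: measurable_rVZ; exact: measurable_snd.
transitivity (cintegral mu (fun w => cintegral mu (fun y => F (w, y)))).
  apply: eq_cintegral => w; rewrite /F /=.
  rewrite mulrAC /fourier_borel -cintegralJ; last first.
    apply: (cintegrable_le _ (cintegrable_normc ipsi)).
      by apply: cmeasurableM => //; exact: cmeasurable_phaseN.
    by move=> x; rewrite Normc.normcM normc_expi mulr1.
  rewrite -cintegralZ; last first.
    apply: (cintegrable_le _ (cintegrable_normc ipsi)).
      by apply: cmeasurableJ; apply: cmeasurableM => //; exact: cmeasurable_phaseN.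
    by move=> x; rewrite normcJ Normc.normcM normc_expi mulr1.
  apply: eq_cintegral => y; rewrite rmorphM /= -expiN opprK.
  rewrite -!mulrA; congr (_ * _); rewrite mulrCA; congr (_ * _).
  rewrite -expiD; congr expi.
  by rewrite dotpDl dotpNl !dotpZl (dotpC w y); ring.
rewrite (@cintegral_fubini_prod _ _ _ _ _ mu mu F (fun w => Normc.normc (g w))
  (fun y => Normc.normc (psi y)))//.
- apply: eq_cintegral => y; rewrite -cintegralZ; last exact: cintegrable_phase.
  by apply: eq_cintegral => w; rewrite /F /= mulrCA mulrA.
- exact: cintegrable_normc.
- exact: cintegrable_normc.
- by move=> w y; rewrite /F /= !Normc.normcM normc_expi normcJ mulr1.
Qed.

(** With $h$ the inverse transform of $g$, the left side is the double integral of
    $f(x)\,\overline{\psi(y)}\,h(x-a-sy)$. Translating $x$ by $a + sy$ and exchanging the integrals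
    again leaves the integral of $h(t)$ against wavelet coefficients of $f$, all zero. *)
Lemma wavelet_orthogonal k f g psi (s : R) a : 0 < s ->
  growth k f -> test_function (k + 2 * d) g -> moment k psi ->
  (forall t, cintegral mu (fun y => f (t + s *: y) * (psi y)^*) = 0) ->
  cintegral mu (fun x => f x *
    inverse_fourier (fun w => g w * (fourier_borel psi (- s *: w))^*) (x - a)) = 0.
Proof.
move=> s0 gf tg mpsi fpsi0; pose h := inverse_fourier g.
have [mh [D D0 hD]] : decay k h by exact: test_function_decay.
case: (gf) => mf [C C0 fC]; case: (mpsi) => mpsi' ipsi.
have dh : decay k h by split => //; exists D.
have bg := test_function_bounded_support tg.
pose c := C * ((1 + `|a|) * (1 + `|s|)) ^+ k.
have c0 : 0 <= c by rewrite mulr_ge0// exprn_ge0// mulr_ge0// addr_ge0.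
(* Submultiplicativity of $1+|\cdot|$ separates the variables: one power goes to the decay of [h],
   the other to the moment of [psi]. *)
have sepE t y : Normc.normc (f (t + (a + s *: y))) <=
    c * (1 + `|t|) ^+ k * (1 + `|y|) ^+ k.
  rewrite -[t]scale1r addrC -[s *: y]addr0.
  apply: (@le_trans _ _ (C * ((1 + `|t|) * ((1 + `|a|) * ((1 + `|s|) * (1 + `|y|)))) ^+ k)).
    rewrite (le_trans (fC _))// ler_wpM2l// lerXn2r ?nnegrE ?mulr_ge0 ?addr_ge0//.
    rewrite scale1r addr0 addrC (le_trans (onenormD _ _))// ler_wpM2l ?addr_ge0//.
    by rewrite (le_trans (onenormD _ _))// ler_wpM2l ?addr_ge0// onenormZ.
  by rewrite le_eqVlt; apply/orP; left; apply/eqP; rewrite scale1r /c !exprMn; ring.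
pose w0 (t : 'rV[R]_d) : R := (1 + `|t|) ^- (2 * d).
have iw0 : rintegrable mu w0 by exact: rintegrable_weight.
pose psik (y : 'rV[R]_d) : R := Normc.normc (psi y) * (1 + `|y|) ^+ k.
pose F (p : 'rV[R]_d * 'rV[R]_d) : R[i] :=
  f p.1 * ((psi p.2)^* * h (p.1 + (- a + (- s) *: p.2))).
have mF : cmeasurable F.
  apply: cmeasurableM; first exact: (cmeasurable_comp mf measurable_fst).
  apply: cmeasurableM.
    by apply: cmeasurableJ; exact: (cmeasurable_comp mpsi' measurable_snd).
  exact: (cmeasurable_comp mh (measurable_pair_affine _ _)).
have shiftE y t : (a + s *: y) + 1 *: t + (- a + (- s) *: y) = t.
  by rewrite scale1r scaleNr -opprD addrAC subrr add0r.
have ff y : growth k (fun t => f (t + (a + s *: y))).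
  rewrite (_ : (fun t => _) = fun t => f ((a + s *: y) + 1 *: t)).
    exact: growth_affine.
  by apply/funext => t; rewrite scale1r addrC.
have ifh y : cintegrable mu (fun x => f x * h (x + (- a + (- s) *: y))).
  rewrite (_ : (fun x => _) = fun x => f ((- (a + s *: y) + 1 *: x) + (a + s *: y)) *
      h (- (a + s *: y) + 1 *: x)).
    exact: (cintegrable_affine (- (a + s *: y)) (oner_neq0 _)
      (growth_decay_integrable (ff y) dh)).
  by apply/funext => x; rewrite scale1r scaleNr -opprD [- _ + x]addrC subrK.
have shift_int y : cintegral mu (fun x => f x * h (x + (- a + (- s) *: y))) =
    cintegral mu (fun t => f (t + (a + s *: y)) * h t).
  have := cintegral_affine (a + s *: y) (oner_neq0 _) (ifh y).
  rewrite normr1 expr1n invr1 mul1r => <-; apply: eq_cintegral => t.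
  by rewrite shiftE scale1r addrC.
(* Before the translation [h] still couples $x$ and $y$, so integrability comes from Tonelli: the
   integral in $x$ is translated for each fixed $y$ and then estimated by [sepE]. *)
have iF : cintegrable (mu \x mu)%E F.
  apply: (@cintegrable_le _ _ _ _ _ (fun p => Normc.normc (F p))) => //.
  apply: (@rintegrable_tonelli _ _ _ _ _ mu mu _ (fun y => c * D * (\int[mu]_t w0 t) * psik y)).
  - exact: cmeasurable_normc.
  - by move=> p; exact: normc_ge0.
  - move=> y.
    have -> : (fun x => Normc.normc (F (x, y))) = fun x =>
        Normc.normc (psi y) * Normc.normc (f x * h (x + (- a + (- s) *: y))).
      by apply/funext => x; rewrite /F /= mulrCA Normc.normcM normcJ.
    by apply: rintegrableZ; exact: cintegrable_normc.
  - by apply: rintegrableZ.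
  - move=> y.
    have -> : \int[mu]_x Normc.normc (F (x, y)) = Normc.normc (psi y) *
        \int[mu]_t Normc.normc (f (t + (a + s *: y)) * h t).
      have E2 : \int[mu]_x Normc.normc (f x * h (x + (- a + (- s) *: y))) =
          \int[mu]_t Normc.normc (f (t + (a + s *: y)) * h t).
        have := @Rintegral_affine R d (a + s *: y) 1 _ (oner_neq0 _) (cintegrable_normc (ifh y)).
        rewrite normr1 expr1n invr1 mul1r => <-; apply: eq_Rintegral => t _.
        by rewrite shiftE scale1r addrC.
      rewrite -E2 -(RintegralZl (Normc.normc (psi y)) measurableT (cintegrable_normc (ifh y))).
      by apply: eq_Rintegral => x _; rewrite /F /= mulrCA Normc.normcM normcJ.
    have H : \int[mu]_t Normc.normc (f (t + (a + s *: y)) * h t) <=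
        \int[mu]_t (c * (1 + `|y|) ^+ k * D * w0 t).
      apply: le_Rintegral => //.
      - apply: cintegrable_normc; exact: (growth_decay_integrable (ff y) dh).
      - exact: rintegrableZ.
      - move=> t _; apply: (@growth_decay_le k (fun t => f (t + (a + s *: y)))) => //.
          by rewrite mulr_ge0// exprn_ge0// addr_ge0.
        by move=> x; rewrite (le_trans (sepE _ _))// mulrAC.
    rewrite RintegralZl// in H.
    apply: (le_trans (ler_wpM2l (normc_ge0 _) H)).
    by rewrite le_eqVlt; apply/orP; left; apply/eqP; rewrite /psik; ring.
transitivity (cintegral mu (fun x => cintegral mu (fun y => F (x, y)))).
  apply: eq_cintegral => x; rewrite (@inverse_fourier_conv k)// -cintegralZ.
    by apply: eq_cintegral => y; rewrite /F /= addrA scaleNr.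
  apply: (@cintegrable_le _ _ _ _ _ (fun y => D * Normc.normc (psi y))).
  - apply: cmeasurableM; first exact: cmeasurableJ.
    apply: (cmeasurable_comp mh); under eq_fun do rewrite -scaleNr.
    exact: measurable_affine.
  - by apply: rintegrableZ; exact/cintegrable_normc/(moment_integrable mpsi).
  - move=> y; rewrite Normc.normcM normcJ mulrC ler_wpM2r ?normc_ge0//.
    rewrite (le_trans (hD _))// ler_piMr// invf_le1 ?exprn_gt0 ?onenorm_gt0//.
    by rewrite exprn_ege1// lerDl.
rewrite cintegral_fubini//.
transitivity (cintegral mu (fun y => cintegral mu (fun t =>
    (psi y)^* * (f (t + (a + s *: y)) * h t)))).
  apply: eq_cintegral => y.
  rewrite cintegralZ; last exact: (growth_decay_integrable (ff y) dh).
  rewrite -shift_int -cintegralZ; last exact: ifh.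
  by apply: eq_cintegral => x; rewrite /F /= mulrCA.
(* After the translation [h] depends on one variable alone and a product bound holds. *)
pose F2 (p : 'rV[R]_d * 'rV[R]_d) : R[i] :=
  (psi p.1)^* * (f (p.2 + (a + s *: p.1)) * h p.2).
have mF2 : cmeasurable F2.
  apply: cmeasurableM.
    by apply: cmeasurableJ; exact: (cmeasurable_comp mpsi' measurable_fst).
  apply: cmeasurableM; last exact: (cmeasurable_comp mh measurable_snd).
  apply: (cmeasurable_comp mf); apply: measurable_rVD; first exact: measurable_snd.
  by apply: measurable_rVD; [exact: measurable_cst|apply: measurable_rVZ; exact: measurable_fst].
rewrite (@cintegral_fubini_prod _ _ _ _ _ mu mu F2 psik (fun t => c * D * w0 t))//.
- rewrite -[RHS](@cintegral0 _ _ R mu); apply: eq_cintegral => t.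
  rewrite -[RHS](mulr0 (h t)) -(fpsi0 (t + a)) -cintegralZ.
    by apply: eq_cintegral => y; rewrite /F2 /= addrA; ring.
  apply: (@cintegrable_le _ _ _ _ _ (fun y => c * (1 + `|t|) ^+ k * psik y)).
  - apply: cmeasurableM; last exact: cmeasurableJ.
    exact: (cmeasurable_comp mf (measurable_affine _ _)).
  - exact: rintegrableZ.
  - move=> y; rewrite Normc.normcM normcJ -addrA /psik [X in _ <= _ * X]mulrC mulrA.
    by rewrite ler_wpM2r ?normc_ge0.
- exact: rintegrableZ.
- move=> y t; rewrite /F2 /= Normc.normcM normcJ.
  have H := @growth_decay_le k (fun t => f (t + (a + s *: y))) h (c * (1 + `|y|) ^+ k) D.
  have {}H : Normc.normc (f (t + (a + s *: y)) * h t) <= c * (1 + `|y|) ^+ k * D * w0 t.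
    apply: H => //; first by rewrite mulr_ge0// exprn_ge0// addr_ge0.
    by move=> x; rewrite (le_trans (sepE _ _))// mulrAC.
  apply: (le_trans (ler_wpM2l (normc_ge0 _) H)).
  by rewrite le_eqVlt; apply/orP; left; apply/eqP; rewrite /psik; ring.
Qed.

End growth.

(** * Functions with frequencies in an annulus *)

Section annulus.
Context {R : realType} {d : nat}.
Notation mu := (@borel_lebesgue R d).
Implicit Types (f g psi : 'rV[R]_d -> R[i]) (x a w : 'rV[R]_d).

Lemma open_neq0 (U : set 'rV[R]_d) (q : 'rV[R]_d -> R) : open U ->
  (forall x, U x -> {for x, continuous q}) -> open [set x | U x /\ q x != 0].
Proof.
move=> oU cq; rewrite openE => x [Ux qx].
have N1 : \near x, U x by exact: open_nbhs_nbhs.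
have N2 : \near x, q x != 0 by have /cvgr_neq0/(_ qx) := cq x Ux.
by near=> y; split; near: y.
Unshelve. all: by end_near. Qed.

Lemma open_nonzero : open (~` [set (0 : 'rV[R]_d)]).
Proof.
rewrite (_ : ~` _ = [set x : 'rV[R]_d | setT x /\ `|x| != 0]).
  by apply: open_neq0; [exact: openT|move=> x _; exact: norm_continuous].
apply/seteqP; split => [x /eqP x0|x [_]]; first by split => //; rewrite normr_eq0.
by rewrite normr_eq0 => /eqP.
Qed.

Lemma compact_annulus (r1 r2 : R) :
  compact [set w : 'rV[R]_d | r1 <= `|w| /\ `|w| <= r2].
Proof.
apply: bounded_closed_compact.
  by exists r2; split; [exact: num_real|move=> M rM x [_ /= xr]; exact: le_trans xr (ltW rM)].
rewrite (_ : mkset _ = (fun x : 'rV[R]_d => `|x|) @^-1` [set t | r1 <= t] `&`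
    (fun x : 'rV[R]_d => `|x|) @^-1` [set t | t <= r2])//.
apply: closedI; apply: closed_comp; try by move=> x _; exact: norm_continuous.
  exact: closed_ge.
exact: closed_le.
Qed.

(** On the open set $V$ the product is identically $0$ whatever values [q] takes there, so
    smoothness of [q] on $U$ extends to the whole space. It gives sense to the division by [Den]
    below. *)
Lemma smooth_along_cutoff n v (U V : set 'rV[R]_d) (chi q : 'rV[R]_d -> R) :
  open U -> open V -> U `|` V = setT -> (forall x, V x -> chi x = 0) ->
  smooth_along n v setT chi -> smooth_along n v U q ->
  smooth_along n v setT (fun x => chi x * q x).
Proof.
move=> oU oV UV chi0 schi sq; rewrite -UV; apply: smooth_alongU => //.
  by apply: smooth_alongM => //; exact: smooth_along_sub schi.
apply: (@smooth_along_eq _ _ _ _ _ (fun=> 0)) => //; last exact: smooth_along_cst.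
by move=> x /chi0 ->; rewrite mul0r.
Qed.

(** The squared modulus, real-valued and polynomial in the two parts, hence as smooth as they
    are. *)
Definition normsq (z : R[i]) : R := complex.Re z ^+ 2 + complex.Im z ^+ 2.

Lemma normsq_ge0 z : 0 <= normsq z.
Proof. by rewrite addr_ge0 ?sqr_ge0. Qed.

Lemma normsq_eq0 z : (normsq z == 0) = (z == 0).
Proof.
by case: z => u v; rewrite /normsq paddr_eq0 ?sqr_ge0// !sqrf_eq0 eq_complex.
Qed.

Lemma normsqE z : z * z^*%R = (normsq z)%:C.
Proof.
case: z => u v; apply/eqP; rewrite eq_complex /= /normsq; apply/andP.
by split; apply/eqP; rewrite /=; ring.
Qed.

Lemma inverse_fourier_sum n (G : 'I_n -> 'rV[R]_d -> R[i]) x :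
  (forall i, cintegrable mu (G i)) ->
  inverse_fourier (fun w => \sum_(i < n) G i w) x = \sum_(i < n) inverse_fourier (G i) x.
Proof.
move=> iG; rewrite /inverse_fourier.
have [_ <-] := @cintegral_sum _ _ R mu n (fun i w => G i w * expi (2 * pi * dotp x w))
  (fun i => cintegrable_phase x (iG i)).
by apply: eq_cintegral => w; rewrite mulr_suml.
Qed.

(** Writes [chi] as the sum over $j$ of $g_j\,\overline{\Psi_j}$, where $\Psi_j(w) =
    \widehat\psi(-s_j w)$ and $g_j = \chi\,\Psi_j / \sum_i |\Psi_i|^2$; each term falls under
    [wavelet_orthogonal]. *)
Theorem annulus_orthogonal k f psi (chi : 'rV[R]_d -> R) (r1 r2 : R) a : (0 < d)%N ->
  growth k f -> moment k psi ->
  csmooth (k + 2 * d) (~` [set 0]) (fourier_borel psi) ->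
  (forall w, w != 0 -> exists2 s : R, 0 < s & fourier_borel psi (- s *: w) != 0) ->
  (forall (s : R) t, 0 < s -> cintegral mu (fun y => f (t + s *: y) * (psi y)^*%R) = 0) ->
  (forall i, smooth_along (k + 2 * d) (delta_mx ord0 i) setT chi) ->
  0 < r1 -> (forall w, `|w| < r1 -> chi w = 0) -> (forall w, r2 < `|w| -> chi w = 0) ->
  cintegral mu (fun x => f x * inverse_fourier (fun w => (chi w)%:C) (x - a)) = 0.
Proof.
move=> d0 gf mpsi spsi ntriv fpsi0 schi r10 chi1 chi2.
set N := (k + 2 * d)%N in spsi schi.
(* Some coordinate is needed to read continuity off smoothness along coordinates. *)
pose i0 : 'I_d := Ordinal d0.
pose Psi (s : R) w := fourier_borel psi (- s *: w).
pose Z : set 'rV[R]_d := ~` [set 0].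
have oZ : open Z := open_nonzero.
have sPsi s i : 0 < s -> smooth_along N (delta_mx ord0 i) Z (fun w => complex.Re (Psi s w)) /\
    smooth_along N (delta_mx ord0 i) Z (fun w => complex.Im (Psi s w)).
  move=> s0; have [sR sI] := spsi i.
  have ZZ : Z `<=` [set x | Z (- s *: x)].
    move=> x x0 /eqP; rewrite scaler_eq0 oppr_eq0 gt_eqF//= => /eqP; exact: x0.
  by split; apply: (smooth_along_sub ZZ); [exact: (smooth_along_scale (- s) sR)|
    exact: (smooth_along_scale (- s) sI)].
have snormsq s i : 0 < s ->
    smooth_along N (delta_mx ord0 i) Z (fun w => normsq (Psi s w)).
  move=> s0; have [sR sI] := sPsi s i s0.
  by apply: smooth_alongD; exact: smooth_alongX.
pose K := [set w : 'rV[R]_d | r1 <= `|w| /\ `|w| <= r2].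
(* The sets where $\widehat\psi(-s w) \ne 0$ are open and cover the annulus as $s$ varies. *)
have := @compact_annulus r1 r2; rewrite compact_cover -/K.
move=> /(_ _ [set s : R | 0 < s] (fun s => [set w | Z w /\ normsq (Psi s w) != 0])).
case=> [s s0| w [w1 _]|D Dpos KD].
- by apply: open_neq0 => // x; exact: (smooth_along_continuous (snormsq s i0 s0)).
- have w0 : w != 0 by rewrite -normr_gt0 (lt_le_trans r10).
  have [s s0 ws] := ntriv w w0; exists s => //; split; first exact/eqP.
  by rewrite normsq_eq0.
pose n := size (finmap.enum_fset D); pose S (j : 'I_n) : R := nth 0 (finmap.enum_fset D) j.
have S0 j : 0 < S j.
  have : S j \in D by rewrite /S; apply: mem_nth.
  by move=> /Dpos /set_mem.
pose Den w := \sum_(j < n) normsq (Psi (S j) w).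
have sDen i : smooth_along N (delta_mx ord0 i) Z Den.
  by apply: smooth_along_sum => j; exact: snormsq.
have KDen w : K w -> Den w != 0.
  move=> /KD[s /= sD [_ ws]].
  have sn : (index s (finmap.enum_fset D) < n)%N by rewrite index_mem.
  rewrite gt_eqF// /Den (bigD1 (Ordinal sn))//= ltr_pwDl//.
    by rewrite lt_neqAle normsq_ge0 andbT eq_sym /S /= nth_index.
  by apply: sumr_ge0 => j _; exact: normsq_ge0.
pose U := [set w | Z w /\ Den w != 0].
have oU : open U.
  by apply: open_neq0 => // x; exact: (smooth_along_continuous (sDen i0)).
have UZ : U `<=` Z by move=> w [].
(* The complement of the closed annulus: [chi] vanishes here, and [Den] is nonzero on the rest. *)
pose V := [set w : 'rV[R]_d | `|w| < r1] `|` [set w : 'rV[R]_d | r2 < `|w|].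
have oV : open V.
  apply: openU.
    rewrite (_ : mkset _ = (fun x : 'rV[R]_d => `|x|) @^-1` [set t | t < r1])//.
    by apply: open_comp; [move=> x _; exact: norm_continuous|exact: open_lt].
  rewrite (_ : mkset _ = (fun x : 'rV[R]_d => `|x|) @^-1` [set t | r2 < t])//.
  by apply: open_comp; [move=> x _; exact: norm_continuous|exact: open_gt].
have UV : U `|` V = setT.
  rewrite -subTset => w _.
  have [w1|w1] := ltP `|w| r1; first by right; left.
  have [w2|w2] := ltP r2 `|w|; first by right; right.
  left; split; last exact: KDen.
  by move=> w0; move: w1; rewrite w0 normr0 leNgt r10.
have chiV x : V x -> chi x = 0 by move=> [/chi1|/chi2].
have sDenV i : smooth_along N (delta_mx ord0 i) U (fun w => (Den w)^-1).
  by apply: smooth_alongV => [x []//|]; exact: smooth_along_sub UZ (sDen i).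
have cut q : (forall i, smooth_along N (delta_mx ord0 i) U q) ->
    forall i, smooth_along N (delta_mx ord0 i) setT (fun w => chi w * q w).
  by move=> sq i; exact: (smooth_along_cutoff oU oV UV chiV).
have testC (p q : 'rV[R]_d -> R) :
    (forall i, smooth_along N (delta_mx ord0 i) U p) ->
    (forall i, smooth_along N (delta_mx ord0 i) U q) ->
    test_function N (fun w => (chi w * p w) +i* (chi w * q w)).
  move=> sp sq; have sp' := cut _ sp; have sq' := cut _ sq; split.
  - by exists r2 => x /chi2 ->; rewrite !mul0r.
  - split=> x /=; first exact: (smooth_along_continuous (sp' i0)).
    exact: (smooth_along_continuous (sq' i0)).
  - by move=> i; split => /=; [exact: sp'|exact: sq'].
pose g j w : R[i] := (chi w * (complex.Re (Psi (S j) w) * (Den w)^-1)) +i*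
  (chi w * (complex.Im (Psi (S j) w) * (Den w)^-1)).
have gE j w : g j w = (chi w * (Den w)^-1)%:C * Psi (S j) w.
  rewrite /g; case: (Psi (S j) w) => u v /=; apply/eqP; rewrite eq_complex /=.
  by apply/andP; split; apply/eqP; ring.
have tg j : test_function N (g j).
  apply: testC => i; have [sR sI] := sPsi (S j) i (S0 j); apply: smooth_alongM => //.
    exact: smooth_along_sub UZ sR.
  exact: smooth_along_sub UZ sI.
pose G j w := g j w * (Psi (S j) w)^*%R.
(* The imaginary part is kept as a multiple of [chi] to fit [testC]. *)
have GE j : G j = fun w => (chi w * (normsq (Psi (S j) w) * (Den w)^-1)) +i* (chi w * 0).
  apply/funext => w; rewrite /G gE -mulrA normsqE -rmorphM.
  by apply/eqP; rewrite eq_complex /= mulr0 eqxx andbT; apply/eqP; ring.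
have tG j : test_function N (G j).
  rewrite GE; apply: testC => i; last exact: smooth_along_cst.
  by apply: smooth_alongM => //; exact: smooth_along_sub UZ (snormsq _ _ (S0 j)).
have chiE : (fun w => (chi w)%:C) = fun w => \sum_(j < n) G j w.
  apply/funext => w; transitivity ((chi w * (Den w)^-1 * Den w)%:C).
    have [/chiV ->|wV] := pselect (V w); first by rewrite !mul0r.
    have : (U `|` V) w by rewrite UV.
    by case=> // -[_ Dw]; rewrite mulfVK.
  rewrite mulr_sumr rmorph_sum; apply: eq_bigr => j _ /=.
  by rewrite /G gE -[RHS]mulrA normsqE -rmorphM.
have bG j := test_function_bounded_support (tG j).
have iG j := bounded_support_integrable (bG j).
have ifG j : cintegrable mu (fun x => f x * inverse_fourier (G j) (x - a)).
  exact: (growth_decay_integrable_shift a gf (test_function_decay (tG j))).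
rewrite chiE; under eq_cintegral => x do rewrite inverse_fourier_sum// mulr_sumr.
have [_ ->] := cintegral_sum ifG; apply: big1 => j _.
exact: (wavelet_orthogonal a (S0 j) gf (tg j) mpsi (fun t => fpsi0 (S j) t (S0 j))).
Qed.

End annulus.

(** * Low-pass filters and dilation invariance *)

Section lowpass.
Context {R : realType} {d : nat} (N : nat).
Notation mu := (@borel_lebesgue R d).
Implicit Types (f psi : 'rV[R]_d -> R[i]) (x a w v : 'rV[R]_d).

Lemma dotpxx_ge0 w : 0 <= dotp w w.
Proof. by apply: sumr_ge0 => i _; rewrite -expr2 sqr_ge0. Qed.

Lemma sqr_normr_dotp w : `|w| ^+ 2 <= dotp w w.
Proof.
have [->|/normr_coord_max[i ->]] := eqVneq w 0.
  by rewrite normr0 expr0n dotpxx_ge0.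
rewrite real_normK ?num_real// /dotp (bigD1 i)//= -expr2 lerDl.
by apply: sumr_ge0 => j _; rewrite -expr2 sqr_ge0.
Qed.

(** The argument is the Euclidean square, a polynomial, because the sup norm is not differentiable.
    The two bumps never vanish together, since $1 < 2$. *)
Definition bump_in w : R := Num.max (2 - dotp w w) 0 ^+ N.+1.
Definition bump_out w : R := Num.max (dotp w w - 1) 0 ^+ N.+1.
Definition lowpass w : R := bump_in w / (bump_in w + bump_out w).

Lemma bump_in_ge0 w : 0 <= bump_in w.
Proof. by rewrite exprn_ge0// le_max lexx orbT. Qed.

Lemma bump_out_ge0 w : 0 <= bump_out w.
Proof. by rewrite exprn_ge0// le_max lexx orbT. Qed.

Lemma bump_gt0 w : 0 < bump_in w + bump_out w.
Proof.
have [w2|w2] := ltP (dotp w w) 2.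
  by rewrite ltr_pwDl ?bump_out_ge0// exprn_gt0// lt_max subr_gt0 w2.
rewrite ltr_wpDl ?bump_in_ge0// exprn_gt0// lt_max subr_gt0.
by rewrite (lt_le_trans _ w2)// ltr1n.
Qed.

Lemma lowpass_ge0 w : 0 <= lowpass w.
Proof. by rewrite divr_ge0 ?bump_in_ge0// ltW// bump_gt0. Qed.

Lemma lowpass1 w : dotp w w <= 1 -> lowpass w = 1.
Proof.
move=> w1; have o0 : bump_out w = 0.
  by rewrite /bump_out max_r ?subr_le0// expr0n.
by rewrite /lowpass o0 addr0 divff// gt_eqF//; have := bump_gt0 w; rewrite o0 addr0.
Qed.

Lemma lowpass0 w : 2 <= dotp w w -> lowpass w = 0.
Proof. by move=> w2; rewrite /lowpass /bump_in max_r ?subr_le0// expr0n mul0r. Qed.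

(** From $w \cdot w \le d\,|w|^2 \le 1$; taking $d + 1$ instead of $d$ avoids a division by zero. *)
Lemma lowpass_near0 w : `|w| <= d.+1%:R^-1 -> lowpass w = 1.
Proof.
move=> w1; apply: lowpass1; apply: le_trans (ler_norm _) _.
apply: le_trans (normr_dotp _ _) _.
have d1 : 0 < d.+1%:R :> R by [].
have w2 : `|w| <= 1 by rewrite (le_trans w1)// invf_le1// ler1n.
rewrite (@le_trans _ _ (d.+1%:R * (d.+1%:R^-1 * 1)))//; last by rewrite mulr1 divff// gt_eqF.
by rewrite ler_pM ?mulr_ge0// ?ler_nat// ler_pM.
Qed.

Lemma lowpass_far w : 2 < `|w| -> lowpass w = 0.
Proof.
move=> w2; apply: lowpass0; apply: le_trans (sqr_normr_dotp w).
by rewrite expr2; nra.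
Qed.

Lemma smooth_along_dotpxx n v : smooth_along n v setT (fun w => dotp w w).
Proof.
have -> : (fun w => dotp w w) = fun w : 'rV[R]_d =>
    \sum_(i < d) dotp (delta_mx ord0 i) w * dotp (delta_mx ord0 i) w.
  apply/funext => w; apply: eq_bigr => i _.
  by rewrite dotpC dotp_delta.
by apply: smooth_along_sum => i; apply: smooth_alongM; exact: smooth_along_dotp.
Qed.

Lemma smooth_along_lowpass v : smooth_along N v setT lowpass.
Proof.
have sin : smooth_along N v setT bump_in.
  apply: smooth_along_pospow; apply: smooth_alongD; first exact: smooth_along_cst.
  by apply: smooth_alongN; exact: smooth_along_dotpxx.
have sout : smooth_along N v setT bump_out.
  apply: smooth_along_pospow; apply: smooth_alongD; last exact: smooth_along_cst.
  exact: smooth_along_dotpxx.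
apply: smooth_alongM => //; apply: smooth_alongV; last exact: smooth_alongD.
by move=> x _; rewrite gt_eqF// bump_gt0.
Qed.

Lemma smooth_along_lowpass_scale v (s : R) :
  smooth_along N v setT (fun w => lowpass (s *: w)).
Proof. exact: (smooth_along_scale s (smooth_along_lowpass v)). Qed.

Lemma test_function_real (chi : 'rV[R]_d -> R) (r : R) :
  (forall v, smooth_along N v setT chi) -> (forall w, r < `|w| -> chi w = 0) ->
  test_function N (fun w => (chi w)%:C).
Proof.
move=> schi chi0; split.
- by exists r => x /chi0 ->.
(* Smoothness along any vector includes continuity, and the vector $0$ is available in every
   dimension. *)
- split => x /=; first exact: (smooth_along_continuous (schi 0)).
  exact: cst_continuous.
- by move=> i; split => /=; [exact: schi|exact: smooth_along_cst].
Qed.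

Lemma test_function_lowpass (s : R) : 0 < s ->
  test_function N (fun w => (lowpass (s *: w))%:C).
Proof.
move=> s0; apply: (@test_function_real _ (2 / s)).
  by move=> v; exact: smooth_along_lowpass_scale.
move=> w; rewrite ltr_pdivrMr// => ws; apply: lowpass_far.
by rewrite normrZ gtr0_norm// mulrC.
Qed.

Definition lowpass_kernel x : R[i] := inverse_fourier (fun w => (lowpass w)%:C) x.

Lemma lowpass_kernel_scale (s : R) x : 0 < s ->
  inverse_fourier (fun w => (lowpass (s *: w))%:C) x =
  (s ^- d)%:C * lowpass_kernel (s^-1 *: x).
Proof.
move=> s0; rewrite /lowpass_kernel /inverse_fourier.
have t1 := @test_function_lowpass 1 ltr01.
have ig : cintegrable mu (fun w => (lowpass w)%:C).
  have := bounded_support_integrable (test_function_bounded_support t1).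
  by under eq_fun do rewrite scale1r.
have := @cintegral_affine R d 0 s _ (lt0r_neq0 s0) (cintegrable_phase (s^-1 *: x) ig).
rewrite gtr0_norm// => <-; apply: eq_cintegral => w; rewrite add0r.
by rewrite dotpZr dotpZl mulVKf ?gt_eqF.
Qed.

End lowpass.

(** * Invariance under dilation of the kernel *)

Section lowpass_dilation.
Context {R : realType} {d : nat} (k : nat).
Notation mu := (@borel_lebesgue R d).
Notation N := (k + 2 * d)%N.
Notation Phi := (@lowpass_kernel R d N).
Implicit Types (f psi : 'rV[R]_d -> R[i]) (x a w v : 'rV[R]_d).

Lemma decay_lowpass_kernel : decay k Phi.
Proof.
have := test_function_decay (@test_function_lowpass R d N 1 ltr01).
by under [X in inverse_fourier X]eq_fun do rewrite scale1r.
Qed.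

Lemma lowpass_integrable f a (r : R) : growth k f -> 0 < r -> cintegrable mu (fun x => f x *
  inverse_fourier (fun w => (lowpass N (r *: w))%:C) (x - a)).
Proof.
move=> gf r0; apply: (@growth_decay_integrable_shift _ _ k) => //.
exact: test_function_decay (test_function_lowpass N r0).
Qed.

(** Substitution $x = a + rz$; its Jacobian $r^d$ cancels the factor $r^{-d}$ of the dilated
    kernel. *)
Lemma lowpass_kernel_dilate f a (r : R) : growth k f -> 0 < r ->
  cintegral mu (fun x => f x *
    inverse_fourier (fun w => (lowpass N (r *: w))%:C) (x - a)) =
  cintegral mu (fun z => f (a + r *: z) * Phi z).
Proof.
move=> gf; move=> r0; have rN0 : r^-1 != 0 by rewrite invr_eq0 gt_eqF.
have ifP := growth_decay_integrable (growth_affine a r gf) decay_lowpass_kernel.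
have rE : `|r^-1| ^- d = r ^+ d by rewrite gtr0_norm ?invr_gt0// exprVn invrK.
have E := cintegral_affine (- (r^-1 *: a)) rN0 ifP; rewrite rE in E.
have rd0 : (r ^+ d)%:C != 0 :> R[i].
  by rewrite eq_complex /= eqxx andbT expf_neq0// gt_eqF.
have cc : (r ^+ d)%:C * (r ^- d)%:C = 1 :> R[i].
  by rewrite -(rmorphM (real_complex R)) divff ?expf_neq0 ?gt_eqF.
apply: (mulfI rd0); apply: (etrans (esym (cintegralZ _ (lowpass_integrable a gf r0)))).
apply: (etrans _ E).
apply: eq_cintegral => x; rewrite lowpass_kernel_scale// [f x * _]mulrCA [LHS]mulrA cc mul1r.
have -> : a + r *: (- (r^-1 *: a) + r^-1 *: x) = x.
  by rewrite scalerDr scalerN !scalerA divff ?gt_eqF// !scale1r addNKr.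
by rewrite scalerBr [r^-1 *: x - _]addrC.
Qed.

Lemma lowpass_dilation f psi a (s : R) : (0 < d)%N ->
  growth k f -> moment k psi ->
  csmooth N (~` [set 0]) (fourier_borel psi) ->
  (forall w, w != 0 -> exists2 s : R, 0 < s & fourier_borel psi (- s *: w) != 0) ->
  (forall (s : R) t, 0 < s -> cintegral mu (fun y => f (t + s *: y) * (psi y)^*%R) = 0) ->
  0 < s ->
  cintegral mu (fun z => f (a + s *: z) * Phi z) = cintegral mu (fun z => f (a + z) * Phi z).
Proof.
move=> d0 gf mpsi spsi ntriv fpsi0.
have e1 : cintegral mu (fun z => f (a + z) * Phi z) =
    cintegral mu (fun z => f (a + 1 *: z) * Phi z).
  by apply: eq_cintegral => z; rewrite scale1r.
move=> s0; apply: (etrans (esym (lowpass_kernel_dilate a gf s0))).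
apply: (etrans _ (etrans (lowpass_kernel_dilate a gf ltr01) (esym e1))).
pose chi w := lowpass N (s *: w) - lowpass N (1 *: w).
(* Below [r1] both filters equal $1$, and beyond [r2] both are $0$; the two entries of each extremum
   belong to the scales $1$ and $s$. *)
pose r1 := Num.min (d.+1%:R^-1) (d.+1%:R^-1 / s).
have d1 : 0 < d.+1%:R^-1 :> R by rewrite invr_gt0.
have r10 : 0 < r1 by rewrite lt_min d1 divr_gt0.
pose r2 := Num.max 2 (2 / s).
have chi1 w : `|w| < r1 -> chi w = 0.
  rewrite lt_min ltr_pdivlMr// => /andP[w1 w2].
  by rewrite /chi !lowpass_near0 ?subrr// ?scale1r ?ltW// normrZ gtr0_norm// mulrC.
have chi2 w : r2 < `|w| -> chi w = 0.
  rewrite gt_max ltr_pdivrMr// => /andP[w1 w2].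
  by rewrite /chi !lowpass_far ?subrr// ?scale1r// normrZ gtr0_norm// mulrC.
have schi i : smooth_along N (delta_mx ord0 i) setT chi.
  apply: smooth_alongD; first exact: smooth_along_lowpass_scale.
  by apply: smooth_alongN; exact: smooth_along_lowpass_scale.
have H := annulus_orthogonal a d0 gf mpsi spsi ntriv fpsi0 schi r10 chi1 chi2.
have E1 := cintegralZ (-1) (lowpass_integrable a gf ltr01).
have E2 := cintegralD (lowpass_integrable a gf s0) (cintegrableZ (-1) (lowpass_integrable a gf ltr01)).
apply: subr0_eq; rewrite -mulN1r -E1 -E2.
apply: (etrans _ H); apply: eq_cintegral => x.
rewrite mulN1r -mulrBr; congr (_ * _).
have ilow (r : R) : 0 < r -> cintegrable mu (fun w => (lowpass N (r *: w))%:C).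
  by move=> r0; apply: bounded_support_integrable;
    exact: test_function_bounded_support (test_function_lowpass N r0).
have E3 := cintegralZ (-1) (cintegrable_phase (x - a) (ilow _ ltr01)).
have E4 := cintegralD (cintegrable_phase (x - a) (ilow _ s0))
  (cintegrableZ (-1) (cintegrable_phase (x - a) (ilow _ ltr01))).
rewrite -mulN1r -[inverse_fourier _ _ in X in _ + X]/(cintegral mu _) -E3.
apply: (etrans (esym E4)); apply: eq_cintegral => w.
by rewrite mulN1r -mulrBl -rmorphB.
Qed.

End lowpass_dilation.

(** * Large scales: polynomials along lines *)

Section taylor.
Context {R : realType}.
Implicit Types (t A : R).

Lemma sin_le t : `|sin t| <= `|t|.
Proof.
have := @mean_value_le R sin cos t 1; rewrite sin0 subr0 mulr1; apply => // s _.
exact: cos_max.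
Qed.

Lemma cosB1_le t : `|cos t - 1| <= `|t| * `|t|.
Proof.
have := @mean_value_le R cos (fun s => - sin s) t `|t|; rewrite cos0; apply => s ts.
by rewrite normrN (le_trans (sin_le _)).
Qed.

Lemma sinB_le t : `|sin t - t| <= `|t| * `|t|.
Proof.
have := @mean_value_le R (fun s => sin s - s) (fun s => cos s - 1) t `|t|.
rewrite sin0 subrr subr0; apply => s ts.
have := @mean_value_le R cos (fun s => - sin s) s 1; rewrite cos0 mulr1 => H.
by apply: (le_trans (H _ _)) => // u _; rewrite normrN sin_max.
Qed.

Lemma expi_taylor1 t : Normc.normc (expi t - 1 - (0 +i* t)) <= 2 * t ^+ 2.
Proof.
apply: le_trans (normc_le_ReIm _) _; rewrite /= !subr0.
by rewrite -real_normK ?num_real// expr2 mulr2n mulrDl mul1r lerD ?cosB1_le ?sinB_le.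
Qed.

(** This is how [Phi] is differentiated: the quadratic remainder of the phase is integrated, and the
    derivative is read off the resulting bound. *)
Lemma is_derive_quadratic (p : R -> R) t l A :
  (forall h, `|p (h + t) - p t - h * l| <= A * h ^+ 2) -> is_derive t (1 : R) p l.
Proof.
move=> pA.
have A0 : 0 <= A by have := pA 1; rewrite expr1n mulr1; exact: le_trans.
have H : (fun h : R => h^-1 *: ((p \o shift t) (h *: (1 : R)) - p t)) @ 0^' --> l.
  apply/cvgrPdist_le => e e0.
  have A1 : 0 < e / (A + 1) by rewrite divr_gt0// ltr_wpDl.
  near=> h.
  have h0 : h != 0 by near: h; exact: nbhs_dnbhs_neq.
  rewrite /= /GRing.scale /= mulr1.
  have -> : l - h^-1 * (p (h + t) - p t) = - (h^-1 * (p (h + t) - p t - h * l)).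
    by field.
  rewrite normrN normrM normfV ler_pdivrMl ?normr_gt0// (le_trans (pA h))//.
  have hx : `|h| * (A + 1) <= e.
    by rewrite -ler_pdivlMr ?ltr_wpDl//; near: h; exact: dnbhs0_le.
  rewrite -real_normK ?num_real// expr2 mulrCA ler_wpM2l// (le_trans _ hx)//.
  by rewrite mulrC ler_wpM2l// lerDl.
by split; [apply/cvg_ex; exists l|exact: cvg_lim H].
Unshelve. all: by end_near. Qed.

(** The remainder vanishes at $0$ and its derivative is the remainder of the next lower order for
    the shifted sequence, so the mean value inequality gives one more factor $|t|$. The bound is
    cruder than the sharp one by $m!$, which is harmless. *)
Lemma taylor_le m (u : nat -> R -> R) t A :
  (forall n s, is_derive s (1 : R) (u n) (u n.+1 s)) ->
  (forall s, `|s| <= `|t| -> `|u m s| <= A) ->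
  `|u 0%N t - \sum_(n < m) t ^+ n / n`!%:R * u n 0| <= A * `|t| ^+ m.
Proof.
elim: m u t => [|m IH] u t du uA.
  by rewrite big_ord0 subr0 expr0 mulr1 uA.
pose r s := u 0%N s - \sum_(n < m.+1) s ^+ n / n`!%:R * u n 0.
pose r' s := u 1%N s - \sum_(n < m) s ^+ n / n`!%:R * u n.+1 0.
have A0 : 0 <= A by apply: le_trans (uA 0 _); rewrite ?normr0.
have dr s : is_derive s (1 : R) r (r' s).
  have d1 n : is_derive s (1 : R) (fun s => s ^+ n.+1 / n.+1`!%:R * u n.+1 0)
      (s ^+ n / n`!%:R * u n.+1 0).
    have H : is_derive s (1:R) (fun s : R => s ^+ n.+1) (n.+1%:R * s ^+ n).
      by split; [exact: exprn_derivable|rewrite exp_derive /GRing.scale /= mulr1].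
    have := is_deriveZ (n.+1`!%:R^-1 * u n.+1 0) H.
    rewrite (_ : _ \*: _ = fun s => s ^+ n.+1 / n.+1`!%:R * u n.+1 0); last first.
      by apply/funext => x; rewrite [LHS]mulrC mulrA.
    congr is_derive; rewrite -[LHS]/(n.+1`!%:R^-1 * u n.+1 0 * (n.+1%:R * s ^+ n)) factS natrM.
    have c0 : n.+1%:R != 0 :> R by rewrite pnatr_eq0.
    have f0 : n`!%:R != 0 :> R by rewrite pnatr_eq0 -lt0n fact_gt0.
    by move: (n.+1%:R : R) (n`!%:R : R) c0 f0 => c e c0 e0; field; rewrite c0 e0.
  have -> : r = fun s => u 0%N s - (u 0%N 0 + \sum_(n < m) s ^+ n.+1 / n.+1`!%:R * u n.+1 0).
    apply/funext => x; rewrite /r big_ord_recl /= expr0 fact0 divr1 mul1r.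
    by congr (_ - (_ + _)); apply: eq_bigr.
  have d2 : is_derive s (1:R) (fun s => u 0%N 0 + \sum_(n < m) s ^+ n.+1 / n.+1`!%:R * u n.+1 0)
      (0 + \sum_(n < m) s ^+ n / n`!%:R * u n.+1 0).
    apply: is_deriveD; rewrite (_ : (fun _ => _) = \sum_(n < m) (fun s => s ^+ n.+1 / n.+1`!%:R * u n.+1 0)).
      exact: is_derive_sum.
    by rewrite fct_sumE.
  rewrite add0r in d2; have d0 := du 0%N s; exact: is_deriveB.
have := @mean_value_le R r r' t (A * `|t| ^+ m) dr.
rewrite {2}/r big_ord_recl /= expr0 fact0 divr1 mul1r big1 ?addr0 ?subrr ?subr0; last first.
  by move=> i _; rewrite /= expr0n mul0r mul0r.
rewrite exprS mulrCA; apply => s ts.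
apply: le_trans (IH (fun n => u n.+1) s (fun n x => du n.+1 x) _) _.
  by move=> x xs; apply: uA; exact: le_trans ts.
by rewrite ler_wpM2l// lerXn2r ?nnegrE.
Qed.

Lemma ctaylor_le m (u : nat -> R -> R[i]) t A :
  (forall n s, is_derive s (1 : R) (fun s => complex.Re (u n s)) (complex.Re (u n.+1 s))) ->
  (forall n s, is_derive s (1 : R) (fun s => complex.Im (u n s)) (complex.Im (u n.+1 s))) ->
  (forall s, `|s| <= `|t| -> Normc.normc (u m s) <= A) ->
  Normc.normc (u 0%N t - \sum_(n < m) (t ^+ n / n`!%:R)%:C * u n 0) <= 2 * A * `|t| ^+ m.
Proof.
move=> dR dI uA; apply: le_trans (normc_le_ReIm _) _.
rewrite -mulrA mulr2n mulrDl mul1r; apply: lerD.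
  have := @taylor_le m (fun n s => complex.Re (u n s)) t A dR.
  have -> : complex.Re (u 0%N t - \sum_(n < m) (t ^+ n / n`!%:R)%:C * u n 0) =
      complex.Re (u 0%N t) - \sum_(n < m) t ^+ n / n`!%:R * complex.Re (u n 0).
    rewrite cReD; congr (_ + _).
    have ReN (z : R[i]) : complex.Re (- z) = - complex.Re z by case: z.
    rewrite ReN; congr (- _); elim/big_ind2 : _ => [//|x1 x2 y1 y2 e1 e2|i _].
      by rewrite cReD e1 e2.
    by rewrite cReM /= mul0r subr0.
  by apply => s ts; rewrite (le_trans (normc_Re _))// uA.
have := @taylor_le m (fun n s => complex.Im (u n s)) t A dI.
have -> : complex.Im (u 0%N t - \sum_(n < m) (t ^+ n / n`!%:R)%:C * u n 0) =
    complex.Im (u 0%N t) - \sum_(n < m) t ^+ n / n`!%:R * complex.Im (u n 0).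
  rewrite cImD; congr (_ + _).
  have ImN (z : R[i]) : complex.Im (- z) = - complex.Im z by case: z.
  rewrite ImN; congr (- _); elim/big_ind2 : _ => [//|x1 x2 y1 y2 e1 e2|i _].
    by rewrite cImD e1 e2.
  by rewrite cImM /= mul0r addr0.
by apply => s ts; rewrite (le_trans (normc_Im _))// uA.
Qed.

End taylor.

(** * Derivatives of the kernel and approximation on lines *)

Section line_polynomial.
Context {R : realType} {d : nat} (k : nat).
Notation mu := (@borel_lebesgue R d).
Notation N := (k + 2 * d)%N.
Notation Phi := (@lowpass_kernel R d N).
Implicit Types (f : 'rV[R]_d -> R[i]) (x y z a w v : 'rV[R]_d).

Definition phase v w : R := 2 * pi * dotp v w.

(** The factor $2\pi i\, v\cdot w$ is what one derivative along $v$ produces on the Fourier side. *)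
Definition phase_lowpass n v w : R[i] := (0 +i* phase v w) ^+ n * (lowpass N w)%:C.

(* [kernel_deriv n v] is the [n]-th derivative of [Phi] along [v]. *)
Definition kernel_deriv n v z : R[i] := inverse_fourier (phase_lowpass n v) z.

Lemma kernel_deriv0 v : kernel_deriv 0 v = Phi.
Proof.
apply/funext => z; congr (inverse_fourier _ z).
by apply/funext => w; rewrite /phase_lowpass expr0 mul1r.
Qed.

Lemma csmooth_mul n v U (p q : 'rV[R]_d -> R[i]) :
  smooth_along n v U (fun x => complex.Re (p x)) /\
  smooth_along n v U (fun x => complex.Im (p x)) ->
  smooth_along n v U (fun x => complex.Re (q x)) /\
  smooth_along n v U (fun x => complex.Im (q x)) ->
  smooth_along n v U (fun x => complex.Re (p x * q x)) /\
  smooth_along n v U (fun x => complex.Im (p x * q x)).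
Proof.
move=> [pR pI] [qR qI]; split.
  under eq_fun do rewrite cReM; apply: smooth_alongD; first exact: smooth_alongM.
  by apply: smooth_alongN; exact: smooth_alongM.
by under eq_fun do rewrite cImM; apply: smooth_alongD; exact: smooth_alongM.
Qed.

Lemma test_function_phase_lowpass n v : test_function N (phase_lowpass n v).
Proof.
have sp (u : 'rV[R]_d) : smooth_along N u setT (fun w => complex.Re (phase_lowpass n v w)) /\
    smooth_along N u setT (fun w => complex.Im (phase_lowpass n v w)).
  apply: csmooth_mul; last first.
    by split => /=; [exact: smooth_along_lowpass|exact: smooth_along_cst].
  elim: n => [|n IH].
    by under eq_fun do rewrite expr0; under [X in _ /\ _ _ _ _ X]eq_fun do rewrite expr0;
       split; exact: smooth_along_cst.
  under eq_fun do rewrite exprS; under [X in _ /\ smooth_along _ _ _ X]eq_fun do rewrite exprS.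
  apply: csmooth_mul => //; split => /=; first exact: smooth_along_cst.
  by apply: smooth_alongZ; exact: smooth_along_dotp.
split.
- by exists 2 => x x2; rewrite /phase_lowpass lowpass_far// mulr0.
- by split => x; have [sR sI] := sp 0; [exact: (smooth_along_continuous sR)|
    exact: (smooth_along_continuous sI)].
- by move=> i; exact: sp.
Qed.

Lemma phase_lowpass_integrable n v : cintegrable mu (phase_lowpass n v).
Proof.
apply: bounded_support_integrable.
exact: test_function_bounded_support (test_function_phase_lowpass n v).
Qed.

Lemma decay_kernel_deriv n v : decay k (kernel_deriv n v).
Proof. exact: test_function_decay (test_function_phase_lowpass n v). Qed.

(** Integrates the second-order estimate [expi_taylor1] of the phase; the square of the phase raises
    the order to $n+2$. The constant $4$ collects a factor $2$ from there and another from
    [normc_cintegral]. *)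
Lemma kernel_deriv_quadratic n v y (h : R) :
  Normc.normc (kernel_deriv n v (y + h *: v) - kernel_deriv n v y -
    h%:C * kernel_deriv n.+1 v y) <=
  4 * (\int[mu]_w Normc.normc (phase_lowpass n.+2 v w)) * h ^+ 2.
Proof.
pose D w := phase_lowpass n v w * expi (2 * pi * dotp y w) *
  (expi (h * phase v w) - 1 - (0 +i* (h * phase v w))).
have i1 := cintegrable_phase (y + h *: v) (phase_lowpass_integrable n v).
have i2 := cintegrable_phase y (phase_lowpass_integrable n v).
have i3 := cintegrable_phase y (phase_lowpass_integrable n.+1 v).
have E : kernel_deriv n v (y + h *: v) - kernel_deriv n v y -
    h%:C * kernel_deriv n.+1 v y = cintegral mu D.
  have e2 := cintegralZ (-1) i2; have e3 := cintegralZ (- h%:C) i3.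
  have e4 := cintegralD i1 (cintegrableZ (-1) i2).
  have e5 := cintegralD (cintegrableD i1 (cintegrableZ (-1) i2)) (cintegrableZ (- h%:C) i3).
  rewrite -mulNr -[- kernel_deriv n v y]mulN1r.
  rewrite /kernel_deriv /inverse_fourier -e2 -e3 -e4 -e5.
  apply: eq_cintegral => w; rewrite /D.
  have -> : expi (2 * pi * dotp (y + h *: v) w) =
      expi (2 * pi * dotp y w) * expi (h * phase v w).
    by rewrite -expiD dotpDl dotpZl /phase; congr expi; ring.
  have -> : phase_lowpass n.+1 v w = (0 +i* phase v w) * phase_lowpass n v w.
    by rewrite /phase_lowpass exprS mulrA.
  have -> : (0 +i* (h * phase v w)) = h%:C * (0 +i* phase v w).
    by apply/eqP; rewrite eq_complex /= !mulr0 mul0r subr0 addr0 !eqxx.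
  by ring.
have th0 : rintegrable mu (fun w => 2 * h ^+ 2 * Normc.normc (phase_lowpass n.+2 v w)).
  by apply: rintegrableZ; exact/cintegrable_normc/phase_lowpass_integrable.
rewrite E; apply: (@le_trans _ _ (2 * \int[mu]_w (2 * h ^+ 2 * Normc.normc (phase_lowpass n.+2 v w)))).
  apply: normc_cintegral; [|exact: th0|].
    have mph : measurable_fun setT (fun w => h * phase v w).
      do 2 (apply: measurable_funM; first exact: measurable_cst).
      by apply: measurable_dotp; [exact: measurable_cst|exact: measurable_id].
    apply: cmeasurableM; first exact: (cintegrable_measurable i2).
    have -> : (fun w => expi (h * phase v w) - 1 - (0 +i* (h * phase v w))) =
        fun w => expi (h * phase v w) + ((-1) + (0 +i* (-1)) * (h * phase v w)%:C).
      apply/funext => w; rewrite addrA; congr (_ + _).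
      by apply/eqP; rewrite eq_complex /=; apply/andP; split; apply/eqP; ring.
    apply: cmeasurableD; first exact: cmeasurable_expi.
    apply: cmeasurableD; first exact: cmeasurable_cst.
    by apply: cmeasurableM; [exact: cmeasurable_cst|exact: cmeasurable_real].
  move=> w; have e := expi_taylor1 (h * phase v w).
  have ni : Normc.normc (0 +i* phase v w) = `|phase v w|.
    by rewrite /= expr0n add0r sqrtr_sqr.
  have p2 : Normc.normc (phase_lowpass n.+2 v w) =
      phase v w ^+ 2 * Normc.normc (phase_lowpass n v w).
    have -> : phase_lowpass n.+2 v w =
        (0 +i* phase v w) * ((0 +i* phase v w) * phase_lowpass n v w).
      by rewrite /phase_lowpass -addn2 exprD expr2; ring.
    by rewrite 2!Normc.normcM ni mulrA -expr2 real_normK ?num_real.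
  rewrite /D Normc.normcM Normc.normcM normc_expi mulr1 p2.
  apply: (le_trans (ler_wpM2l (normc_ge0 _) e)).
  by rewrite le_eqVlt; apply/orP; left; apply/eqP; ring.
rewrite (RintegralZl (2 * h ^+ 2) measurableT
  (cintegrable_normc (phase_lowpass_integrable n.+2 v))).
by rewrite le_eqVlt; apply/orP; left; apply/eqP; ring.
Qed.

Lemma is_derive_kernel_deriv n v z (s : R) :
  is_derive s (1 : R) (fun s => complex.Re (kernel_deriv n v (z + s *: v)))
    (complex.Re (kernel_deriv n.+1 v (z + s *: v))) /\
  is_derive s (1 : R) (fun s => complex.Im (kernel_deriv n v (z + s *: v)))
    (complex.Im (kernel_deriv n.+1 v (z + s *: v))).
Proof.
pose M := 4 * (\int[mu]_w Normc.normc (phase_lowpass n.+2 v w)).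
have key h : Normc.normc (kernel_deriv n v (z + (h + s) *: v) -
    kernel_deriv n v (z + s *: v) - h%:C * kernel_deriv n.+1 v (z + s *: v)) <= M * h ^+ 2.
  have -> : z + (h + s) *: v = (z + s *: v) + h *: v by rewrite scalerDl addrCA addrC addrAC.
  exact: kernel_deriv_quadratic.
have reN (u : R[i]) : complex.Re (- u) = - complex.Re u by case: u.
have imN (u : R[i]) : complex.Im (- u) = - complex.Im u by case: u.
split; apply: (@is_derive_quadratic _ _ _ _ M) => h.
  apply: le_trans (key h); apply: le_trans (normc_Re _).
  by rewrite !cReD !reN cReM /= mul0r subr0.
apply: le_trans (key h); apply: le_trans (normc_Im _).
by rewrite !cImD !imN cImM /= mul0r addr0.
Qed.

Lemma onenorm_shift n x y :
  (1 + `|x + y|) ^- n <= (1 + `|y|) ^+ n * (1 + `|x|) ^- n.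
Proof.
rewrite -!exprVn -exprMn lerXn2r ?nnegrE ?mulr_ge0 ?invr_ge0 ?addr_ge0//.
rewrite ler_pdivlMr ?onenorm_gt0// ler_pdivrMl ?onenorm_gt0//.
rewrite -{1}(addrK y x) (le_trans (onenormD _ _))//.
by rewrite normrN.
Qed.

Lemma kernel_bound_shift n (C r : R) v z : 0 <= C -> `|r| <= 1 ->
  C * (1 + `|z + r *: (- v)|) ^- n <= C * (1 + `|v|) ^+ n * (1 + `|z|) ^- n.
Proof.
move=> C0 r1; rewrite -mulrA; apply: ler_wpM2l => //.
apply: le_trans (onenorm_shift _ _ _) _; apply: ler_wpM2r.
  by rewrite invr_ge0 exprn_ge0// addr_ge0.
by rewrite lerXn2r ?nnegrE ?addr_ge0// lerD2l normrZ normrN ler_piMl.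
Qed.

(** The count of powers of $s$: growth contributes $(1+s)^k \le (2s)^k$ and the remainder
    $|\tau|^{k+1} \le (T/s)^{k+1}$. *)
Lemma line_bound (C A W T s tau b : R) : 0 <= C -> 0 <= A -> 0 <= W -> 0 < T -> 0 <= b ->
  1 <= s -> `|tau| <= T / s ->
  2 * (C * ((1 + b) * (1 + `|s|)) ^+ k * (2 * A * `|tau| ^+ k.+1) * W) <=
  4 * (C * ((1 + b) * 2) ^+ k * A * T ^+ k.+1 * W) / s.
Proof.
move=> C0 A0 W0 T0 b0 s1 tau1; have s0 : 0 < s by exact: lt_le_trans s1.
have b1 : 0 <= 1 + b by exact: addr_ge0.
have tk : `|tau| ^+ k.+1 <= T ^+ k.+1 * s ^- k.+1.
  by rewrite -exprVn -exprMn lerXn2r ?nnegrE// divr_ge0// ltW.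
have Ck : C * ((1 + b) * (1 + `|s|)) ^+ k <= C * ((1 + b) * 2) ^+ k * s ^+ k.
  rewrite -mulrA -exprMn gtr0_norm//; apply: ler_wpM2l => //; apply: lerXn2r.
  - by rewrite nnegrE mulr_ge0// addr_ge0// ltW.
  - by rewrite nnegrE mulr_ge0// ?mulr_ge0// ltW.
  - by rewrite -mulrA; apply: ler_wpM2l => //; lra.
have c0 : 0 <= C * ((1 + b) * (1 + `|s|)) ^+ k.
  by rewrite mulr_ge0// exprn_ge0// mulr_ge0// addr_ge0.
apply: (@le_trans _ _ (2 * (C * ((1 + b) * 2) ^+ k * s ^+ k *
    (2 * A * (T ^+ k.+1 * s ^- k.+1)) * W))).
  rewrite ler_wpM2l// ler_wpM2r//; apply: ler_pM => //.
    by rewrite mulr_ge0 ?exprn_ge0// mulr_ge0.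
  by rewrite ler_wpM2l// mulr_ge0.
rewrite le_eqVlt; apply/orP; left; apply/eqP; rewrite [s ^+ k.+1]exprS.
have sk : s ^+ k != 0 by rewrite expf_neq0// gt_eqF.
by field; rewrite sk gt_eqF.
Qed.

(** At scale $s$ a displacement $tv$ of the centre becomes a displacement $-(t/s)v$ of the kernel,
    and the Taylor polynomial of the kernel in $t/s$ is a polynomial in $t$. It varies with $s$, but
    [B] does not. *)
Lemma lowpass_line_approx f a v (T : R) : growth k f -> 0 < T ->
  (forall a (s : R), 0 < s -> cintegral mu (fun z => f (a + s *: z) * Phi z) =
    cintegral mu (fun z => f (a + z) * Phi z)) ->
  exists2 B, 0 <= B & forall s, 1 <= s -> T <= s ->
    exists2 q : {poly R[i]}, (size q <= k.+1)%N &
      forall t, `|t| <= T ->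
        Normc.normc (cintegral mu (fun z => f (a + t *: v + z) * Phi z) - q.[t%:C])
          <= B / s.
Proof.
move=> gf T0 dil; case: (gf) => mf [C C0 fC].
(* The derivative of order $k+1$ controls the remainder; the direction is $-v$ because the
   displacement passes from $f$ to the kernel. *)
have [mD [Cm Cm0 DC]] := decay_kernel_deriv k.+1 (- v).
pose W := \int[mu]_x (1 + `|x|) ^- (2 * d).
have W0 : 0 <= W.
  by rewrite Rintegral_ge0// => x _; rewrite invr_ge0 exprn_ge0// addr_ge0.
pose A0 := Cm * (1 + `|v|) ^+ N.
have A00 : 0 <= A0 by rewrite mulr_ge0// exprn_ge0// addr_ge0.
pose B := 4 * (C * ((1 + `|a|) * 2) ^+ k * A0 * T ^+ k.+1 * W).
have B0 : 0 <= B.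
  by rewrite !mulr_ge0// ?exprn_ge0 ?mulr_ge0 ?addr_ge0// ltW.
exists B => // s s1 Ts; have s0 : 0 < s by exact: lt_le_trans s1.
have gfs := growth_affine a s gf.
pose c n : R[i] := cintegral mu (fun z => f (a + s *: z) * kernel_deriv n (- v) z).
exists (\poly_(n < k.+1) ((s ^- n / n`!%:R)%:C * c n)); first exact: size_poly.
move=> t tT; pose tau := t / s.
have tau1 : `|tau| <= T / s by rewrite normrM normfV (gtr0_norm s0) ler_wpM2r// invr_ge0 ltW.
(* Here $T \le s$ enters: the kernel is displaced by at most $|v|$, so its decay bound changes by a
   fixed factor. *)
have tau2 : `|tau| <= 1 by rewrite (le_trans tau1)// ler_pdivrMr// mul1r.
pose rem z := kernel_deriv 0 (- v) (z + tau *: (- v)) -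
  \sum_(n < k.+1) (tau ^+ n / n`!%:R)%:C * kernel_deriv n (- v) z.
have i0 : cintegrable mu (fun z => f (a + s *: z) * kernel_deriv 0 (- v) (z + tau *: (- v))).
  rewrite scalerN.
  exact: growth_decay_integrable_shift (tau *: v) gfs (decay_kernel_deriv 0 (- v)).
have iN n : cintegrable mu (fun z => f (a + s *: z) * kernel_deriv n (- v) z).
  exact: growth_decay_integrable gfs (decay_kernel_deriv n (- v)).
(* Pass to scale $s$ by dilation invariance, then substitute $z - \tau v$ for $z$, where $s\tau =
   t$. *)
have E0 : cintegral mu (fun z => f (a + t *: v + z) * Phi z) =
    cintegral mu (fun z => f (a + s *: z) * kernel_deriv 0 (- v) (z + tau *: (- v))).
  apply: (etrans (esym (dil (a + t *: v) s s0))).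
  have ig := growth_decay_integrable (growth_affine (a + t *: v) s gf) (@decay_lowpass_kernel R d k).
  have := cintegral_affine (tau *: (- v)) (oner_neq0 _) ig.
  rewrite normr1 expr1n invr1 mul1r => <-; apply: eq_cintegral => z.
  rewrite kernel_deriv0 scale1r [z + _]addrC; congr (f _ * _).
  rewrite scalerDr scalerA /tau mulrCA divff ?gt_eqF// mulr1 scalerN addrA.
  by rewrite addrK.
have E1 : cintegral mu (fun z => f (a + t *: v + z) * Phi z) -
    (\poly_(n < k.+1) ((s ^- n / n`!%:R)%:C * c n)).[t%:C] =
    cintegral mu (fun z => f (a + s *: z) * rem z).
  rewrite E0 horner_poly.
  have iS n : cintegrable mu (fun z => (- (tau ^+ n / n`!%:R)%:C) *
      (f (a + s *: z) * kernel_deriv n (- v) z)) by exact: cintegrableZ.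
  have [iS' sE] := cintegral_sum (fun n : 'I_k.+1 => iS n).
  have -> : - (\sum_(i < k.+1) (s ^- i / i`!%:R)%:C * c i * t%:C ^+ i) =
      \sum_(i < k.+1) cintegral mu (fun z => (- (tau ^+ i / i`!%:R)%:C) *
        (f (a + s *: z) * kernel_deriv i (- v) z)).
    rewrite -sumrN; apply: eq_bigr => i _.
    rewrite (cintegralZ _ (iN i)) mulNr; congr (- _).
    rewrite mulrAC; congr (_ * _); rewrite -(rmorphXn (real_complex R)) -(rmorphM (real_complex R)).
    by rewrite /tau exprMn exprVn; congr (_%:C); ring.
  rewrite -sE; apply: (etrans (esym (cintegralD i0 iS'))).
  apply: eq_cintegral => z; rewrite /rem mulrBr; congr (_ + _).
  rewrite mulr_sumr -sumrN; apply: eq_bigr => i _.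
  by rewrite mulNr mulrCA.
rewrite E1.
pose C1 := C * ((1 + `|a|) * (1 + `|s|)) ^+ k.
have C10 : 0 <= C1 by rewrite mulr_ge0// exprn_ge0// mulr_ge0// addr_ge0.
have remB z : Normc.normc (rem z) <= 2 * A0 * `|tau| ^+ k.+1 * (1 + `|z|) ^- N.
  pose u n (r : R) := kernel_deriv n (- v) (z + r *: (- v)).
  have -> : rem z = u 0%N tau - \sum_(n < k.+1) (tau ^+ n / n`!%:R)%:C * u n 0.
    rewrite /rem /u; congr (_ - _); apply: eq_bigr => i _.
    by rewrite scale0r addr0.
  have uA r : `|r| <= `|tau| -> Normc.normc (u k.+1 r) <= A0 * (1 + `|z|) ^- N.
    move=> rt; apply: (le_trans (DC (z + r *: (- v)))).
    exact: kernel_bound_shift Cm0 (le_trans rt tau2).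
  apply: (le_trans (@ctaylor_le R k.+1 u tau _
    (fun n r => (is_derive_kernel_deriv n (- v) z r).1)
    (fun n r => (is_derive_kernel_deriv n (- v) z r).2) uA)).
  by rewrite le_eqVlt; apply/orP; left; apply/eqP; ring.
pose hB z := C1 * (2 * A0 * `|tau| ^+ k.+1) * (1 + `|z|) ^- (2 * d).
have cA0 : 0 <= 2 * A0 * `|tau| ^+ k.+1 by rewrite !mulr_ge0// exprn_ge0.
apply: (@le_trans _ _ (2 * \int[mu]_z hB z)).
  apply: normc_cintegral.
  - have -> : (fun z => f (a + s *: z) * rem z) = fun z =>
        f (a + s *: z) * kernel_deriv 0 (- v) (z + tau *: (- v)) +
        \sum_(n < k.+1) (- (tau ^+ n / n`!%:R)%:C) * (f (a + s *: z) * kernel_deriv n (- v) z).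
      apply/funext => z; rewrite /rem mulrBr; congr (_ + _).
      rewrite mulr_sumr -sumrN; apply: eq_bigr => i _.
      by rewrite mulNr mulrCA.
    apply: cmeasurableD; first exact: cintegrable_measurable i0.
    apply: (@cintegrable_measurable _ _ _ mu).
    by have [] := @cintegral_sum _ _ R mu k.+1 (fun n z => (- (tau ^+ n / n`!%:R)%:C) *
      (f (a + s *: z) * kernel_deriv n (- v) z)) (fun n => cintegrableZ _ (iN n)).
  - by apply: rintegrableZ; exact: rintegrable_weight.
  - exact: (@growth_decay_le R d k (fun z => f (a + s *: z)) rem C1 _ C10 cA0
      (fun z => @growth_affine_bound R d k C f a s z C0 fC) remB).
rewrite /hB (RintegralZl _ measurableT (rintegrable_weight d)) -/W.
exact: line_bound.
Qed.

End line_polynomial.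

(** * Small scales: approximate identity *)

Section complex_convergence.
Context {R : realType}.
Implicit Types (u v : nat -> R[i]) (l z : R[i]).

Definition ccvg u l :=
  (fun n => complex.Re (u n)) @ \oo --> complex.Re l /\
  (fun n => complex.Im (u n)) @ \oo --> complex.Im l.

Lemma ccvg_cst l : ccvg (fun=> l) l.
Proof. by split; exact: cvg_cst. Qed.

Lemma ccvgM u v l z : ccvg u l -> ccvg v z -> ccvg (fun n => u n * v n) (l * z).
Proof.
move=> [uR uI] [vR vI]; split.
  by under eq_fun do rewrite cReM; rewrite cReM; apply: cvgB; exact: cvgM.
by under eq_fun do rewrite cImM; rewrite cImM; apply: cvgD; exact: cvgM.
Qed.

Lemma ccvg_unique u l z : ccvg u l -> ccvg u z -> l = z.
Proof.
move=> [uR uI] [vR vI]; apply/eqP; rewrite eq_complex; apply/andP; split; apply/eqP.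
  exact: (cvg_unique (@Rhausdorff R) uR vR).
exact: (cvg_unique (@Rhausdorff R) uI vI).
Qed.

Lemma cintegral_dct {disp} {T : measurableType disp} (m : {measure set T -> \bar R})
    (f_ : nat -> T -> R[i]) (f : T -> R[i]) (g : T -> R) :
  (forall n, cmeasurable (f_ n)) -> cmeasurable f -> rintegrable m g ->
  (forall n x, Normc.normc (f_ n x) <= g x) ->
  {ae m, forall x, ccvg (f_ ^~ x) (f x)} ->
  ccvg (fun n => cintegral m (f_ n)) (cintegral m f).
Proof.
move=> mf_ [mR mI] ig fg cf; split => /=.
  apply: (@Rintegral_dct _ _ _ m (fun n x => complex.Re (f_ n x)) _ g) => //.
  - by move=> n; have [] := mf_ n.
  - by move=> n x; exact: le_trans (normc_Re _) (fg n x).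
  - by apply: filterS cf => x [].
apply: (@Rintegral_dct _ _ _ m (fun n x => complex.Im (f_ n x)) _ g) => //.
- by move=> n; have [] := mf_ n.
- by move=> n x; exact: le_trans (normc_Im _) (fg n x).
- by apply: filterS cf => x [].
Qed.

End complex_convergence.

(** * Open boxes and their indicators *)

Section boxes.
Context {R : realType} {d : nat}.
Notation mu := (@borel_lebesgue R d).
Implicit Types (lo hi x : 'rV[R]_d).

Definition box lo hi : set 'rV[R]_d :=
  [set x | forall i, x ord0 i \in `]lo ord0 i, hi ord0 i[].

Lemma borel_lebesgue_box (A : 'I_d -> set (measurableTypeR R)) :
  (forall i, measurable (A i)) ->
  mu [set x : 'rV[R]_d | forall i, A i (x ord0 i)] =
  (\prod_(i < d) lebesgue_measure (A i))%E.
Proof.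
move=> mA; rewrite -(lebesgue_rV_box mA) /lebesgue_rV /= /completed_measure_extension.
by rewrite measurable_mu_extE//; exact: measurable_coord_set.
Qed.

Lemma measurable_box lo hi : measurable (box lo hi).
Proof.
exact: (@measurable_coord_set R d (fun i => `]lo ord0 i, hi ord0 i[%classic)).
Qed.

Lemma box_face_null (c : R) i : mu [set x : 'rV[R]_d | x ord0 i = c] = 0%E.
Proof.
pose A (j : 'I_d) : set (measurableTypeR R) := if j == i then [set c] else setT.
rewrite (_ : [set x | _] = [set x : 'rV[R]_d | forall j, A j (x ord0 j)]).
  rewrite borel_lebesgue_box; last by move=> j; rewrite /A; case: ifP.
  by rewrite (bigD1 i)//= /A eqxx lebesgue_measure_set1 mul0e.
apply/seteqP; split => x /= H; last by have := H i; rewrite /A eqxx.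
by move=> j; rewrite /A; case: eqP => // ->.
Qed.

Definition box_ind lo hi x : R := \1_(box lo hi) x.

Lemma box_ind_ge0 lo hi x : 0 <= box_ind lo hi x.
Proof. by rewrite /box_ind indicE. Qed.

Lemma box_ind_le1 lo hi x : box_ind lo hi x <= 1.
Proof. by rewrite /box_ind indicE lern1 leq_b1. Qed.

Lemma measurable_box_ind lo hi : measurable_fun setT (box_ind lo hi).
Proof. by apply: measurable_indic; exact: measurable_box. Qed.

Lemma box_bounded lo hi x : box lo hi x -> `|x| <= `|lo| + `|hi|.
Proof.
move=> xB; apply: normr_rV_le => [|i]; first exact: addr_ge0.
have := xB i; rewrite in_itv/= => /andP[/ltW lx /ltW xh].
rewrite ler_norml; apply/andP; split.
  rewrite (le_trans _ lx)// lerNl (le_trans (ler_norm _))// normrN.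
  by rewrite (le_trans (normr_coord _ _))// lerDl.
rewrite (le_trans xh)// (le_trans (ler_norm _))//.
by rewrite (le_trans (normr_coord _ _))// lerDr.
Qed.

(** The indicator is locally constant off the faces, which lie in finitely many null hyperplanes.
    The exceptional set does not depend on the sequence [w]. *)
Lemma box_ind_cvg lo hi :
  {ae mu, forall x, forall w : nat -> 'rV[R]_d, (fun n => `|w n|) @ \oo --> (0 : R) ->
    (fun n => box_ind lo hi (x + w n)) @ \oo --> box_ind lo hi x}.
Proof.
have face (c : R) (i : 'I_d) : \forall x \ae mu, (x : 'rV[R]_d) ord0 i != c.
  exists [set x : 'rV[R]_d | x ord0 i = c]; split.
  - have := measurable_coord i measurableT (measurable_set1 (c : R)).
    by rewrite setTI.
  - exact: box_face_null.
  - by move=> x /= /negP; rewrite negbK => /eqP.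
(* Coordinates are numbered by naturals to use countable additivity; numbers that are no index carry
   the condition [True]. *)
have faces : \forall x \ae mu, forall n : nat,
    if insub n is Some i then (x : 'rV[R]_d) ord0 (i : 'I_d) != lo ord0 i /\ x ord0 i != hi ord0 i else True.
  apply: ae_foralln => n; case: insubP => [i _ _|_]; last exact: nearW.
  by apply: filterS2 (face (lo ord0 i) i) (face (hi ord0 i) i).
apply: filterS faces => x nx w w0.
have nxi i : x ord0 i != lo ord0 i /\ x ord0 i != hi ord0 i.
  by have := nx i; rewrite valK.
have cw i : (fun n => (x + w n) ord0 i) @ \oo --> x ord0 i.
  have wi : (fun n => w n ord0 i) @ \oo --> (0 : R).
    apply/norm_cvg0P.
    apply: (@squeeze_cvgr _ _ _ _ (fun=> 0) (fun n => `|w n|)) w0 => //.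
      by apply: nearW => n; rewrite normr_ge0 normr_coord.
    exact: cvg_cst.
  have H := cvgD (cvg_cst (x ord0 i)) wi; rewrite addr0 in H.
  rewrite (_ : (fun n => (x + w n) ord0 i) = fun n => x ord0 i + w n ord0 i).
    exact: H.
  by apply/funext => n; rewrite mxE.
have [xB|xB] := pselect (box lo hi x).
  have E : box_ind lo hi x = 1 by rewrite /box_ind indicE mem_set.
  apply: cvg_near_cst.
  have : \forall n \near \oo, forall i, (x + w n) ord0 i \in `]lo ord0 i, hi ord0 i[.
    apply: filter_forall => i; have N := near_in_itvoo (xB i).
    exact: (cw i _ N).
  by apply: filterS => n nB; rewrite E /box_ind indicE mem_set.
have E : box_ind lo hi x = 0 by rewrite /box_ind indicE memNset.
apply: cvg_near_cst; move: xB => /existsNP[i xi].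
have : \forall n \near \oo, (x + w n) ord0 i \notin `]lo ord0 i, hi ord0 i[.
  have [n1 n2] := nxi i; move/negP : xi; rewrite in_itv/= negb_and -!leNgt => /orP[xl|xh].
    have xl' : x ord0 i < lo ord0 i by rewrite lt_neqAle n1.
    have /cvgr_lt/(_ _ xl') := cw i; apply: filterS => n h.
    by rewrite in_itv/= negb_and -!leNgt (ltW h).
  have xh' : hi ord0 i < x ord0 i by rewrite lt_neqAle eq_sym n2.
  have /cvgr_gt/(_ _ xh') := cw i; apply: filterS => n h.
  by rewrite in_itv/= negb_and -!leNgt (ltW h) orbT.
apply: filterS => n nB; rewrite E /box_ind indicE memNset// => /(_ i).
by rewrite (negbTE nB).
Qed.

End boxes.

(** * Box averages and the small-scale limit *)

Section approximate_identity.
Context {R : realType} {d : nat} (k : nat) (lo hi : 'rV[R]_d).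
Notation mu := (@borel_lebesgue R d).
Notation ind := (box_ind lo hi).
Implicit Types (f h : 'rV[R]_d -> R[i]) (x a w z : 'rV[R]_d).

Lemma box_ind_weight w x (r : R) j : `|w| <= r ->
  ind (x + w) <= (1 + (`|lo| + `|hi| + r)) ^+ j * (1 + `|x|) ^- j.
Proof.
move=> wr; have r0 : 0 <= r := le_trans (normr_ge0 _) wr.
have p0 : 0 < (1 + `|x|) ^+ j by rewrite exprn_gt0// onenorm_gt0.
have [xB|xB] := pselect (box lo hi (x + w)); last first.
  by rewrite /box_ind indicE memNset// divr_ge0 ?(ltW p0)// exprn_ge0// !addr_ge0.
have xM : `|x| <= `|lo| + `|hi| + r.
  by rewrite -[x](addrK w) (le_trans (ler_normB _ _)) ?lerD ?(box_bounded xB).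
rewrite (le_trans (box_ind_le1 _ _ _))// ler_pdivlMr// mul1r.
by rewrite lerXn2r ?nnegrE ?addr_ge0// lerD2l.
Qed.

Lemma rintegrable_box_growth j : rintegrable mu (fun x => ind x * (1 + `|x|) ^+ j).
Proof.
apply: (@rintegrable_le _ _ _ mu _
  (fun x => (1 + (`|lo| + `|hi| + 0)) ^+ (j + 2 * d) * (1 + `|x|) ^- (2 * d))).
- by apply: measurable_funM; [exact: measurable_box_ind|exact: measurable_onenorm].
- by apply: rintegrableZ; exact: rintegrable_weight.
move=> x; have j0 : 0 <= (1 + `|x|) ^+ j by rewrite exprn_ge0// ltW// onenorm_gt0.
rewrite ger0_norm ?mulr_ge0 ?box_ind_ge0//.
have /(_ 0 x 0 (j + 2 * d)%N) := box_ind_weight; rewrite addr0 normr0 lexx => /(_ isT) H.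
apply: le_trans (ler_wpM2r j0 H) _.
by rewrite -mulrA [X in _ * X <= _]mulrC onenorm_weight.
Qed.

Lemma rintegrable_box : rintegrable mu ind.
Proof.
have := rintegrable_box_growth 0; congr rintegrable.
by apply/funext => x; rewrite expr0 mulr1.
Qed.

Definition box_average f w := cintegral mu (fun x => (ind x)%:C * f (x + w)).

Lemma box_growth_le (C : R) f x w : 0 <= C ->
  (forall x, Normc.normc (f x) <= C * (1 + `|x|) ^+ k) ->
  Normc.normc ((ind x)%:C * f (x + w)) <=
    C * (1 + `|w|) ^+ k * (ind x * (1 + `|x|) ^+ k).
Proof.
move=> C0 fC; rewrite Normc.normcM normc_real ger0_norm ?box_ind_ge0//.
rewrite mulrCA ler_wpM2l ?box_ind_ge0// (le_trans (fC _))// -mulrA ler_wpM2l//.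
by rewrite -exprMn lerXn2r ?nnegrE ?mulr_ge0 ?addr_ge0// mulrC onenormD.
Qed.

Lemma cmeasurable_box_shift f w : cmeasurable f ->
  cmeasurable (fun x => (ind x)%:C * f (x + w)).
Proof.
move=> mf; apply: cmeasurableM.
  by apply: cmeasurable_real; exact: measurable_box_ind.
apply: (cmeasurable_comp mf); apply: measurable_rVD; first exact: measurable_id.
exact: measurable_cst.
Qed.

Lemma cintegrable_box_shift f w : growth k f ->
  cintegrable mu (fun x => (ind x)%:C * f (x + w)).
Proof.
move=> [mf [C C0 fC]]; apply: (@cintegrable_le _ _ _ mu _
    (fun x => C * (1 + `|w|) ^+ k * (ind x * (1 + `|x|) ^+ k))).
- exact: cmeasurable_box_shift.
- by apply: rintegrableZ; exact: rintegrable_box_growth.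
- by move=> x; exact: box_growth_le.
Qed.

Lemma normc_box_average f : growth k f -> exists2 K : R, 0 <= K &
  forall w, Normc.normc (box_average f w) <= K * (1 + `|w|) ^+ k.
Proof.
move=> [mf [C C0 fC]].
exists (2 * (C * \int[mu]_x (ind x * (1 + `|x|) ^+ k))).
  rewrite !mulr_ge0//; apply: Rintegral_ge0 => x _.
  by rewrite mulr_ge0 ?box_ind_ge0// exprn_ge0// ltW// onenorm_gt0.
move=> w; apply: le_trans (normc_cintegral (cmeasurable_box_shift w mf)
  (rintegrableZ (C * (1 + `|w|) ^+ k) (rintegrable_box_growth k)) _) _.
  by move=> x; exact: box_growth_le.
rewrite (RintegralZl (C * (1 + `|w|) ^+ k) measurableT (rintegrable_box_growth k)).
by rewrite -!mulrA ler_pM2l// ler_wpM2l// mulrC.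
Qed.

Lemma cmeasurable_box_average f : cmeasurable f -> cmeasurable (box_average f).
Proof.
move=> mf; apply: (@cmeasurable_cintegral _ _ _ _ _ mu (fun z : _ * _ => (ind z.2)%:C * f (z.2 + z.1))).
apply: cmeasurableM.
  apply: cmeasurable_real; apply: measurableT_comp; last exact: measurable_snd.
  exact: measurable_box_ind.
by apply: (cmeasurable_comp mf); apply: measurable_rVD;
  [exact: measurable_snd|exact: measurable_fst].
Qed.

(** The translation is moved from $f$ to the indicator, which is continuous almost everywhere, and
    dominated convergence applies. The bound [r] keeps all translated boxes in one bounded
    region. *)
Lemma box_average_cvg f (w : nat -> 'rV[R]_d) (r : R) : growth k f ->
  (forall n, `|w n| <= r) -> (fun n => `|w n|) @ \oo --> (0 : R) ->
  ccvg (fun n => box_average f (w n)) (box_average f 0).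
Proof.
move=> gf wr w0; have [mf [C C0 fC]] := gf.
have E (v : 'rV[R]_d) : box_average f v = cintegral mu (fun x => (ind (x - v))%:C * f x).
  have := cintegral_affine (- v) (oner_neq0 _) (cintegrable_box_shift v gf).
  rewrite normr1 expr1n invr1 mul1r => /esym H; apply: (etrans H); apply: eq_cintegral => x.
  by rewrite scale1r [- v + x]addrC subrK.
rewrite E; under eq_fun do rewrite E.
pose M := (1 + (`|lo| + `|hi| + r)) ^+ (k + 2 * d).
have r0 : 0 <= r := le_trans (normr_ge0 _) (wr 0%N).
have mI (v : 'rV[R]_d) : cmeasurable (fun x => (ind (x - v))%:C * f x).
  apply: cmeasurableM => //; apply: cmeasurable_real.
  apply: (measurableT_comp (measurable_box_ind _ _)).
  by apply: measurable_rVD; [exact: measurable_id|exact: measurable_cst].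
apply: (@cintegral_dct R _ _ mu _ _ (fun x => C * M * (1 + `|x|) ^- (2 * d))) => //.
- by apply: rintegrableZ; exact: rintegrable_weight.
- move=> n x; rewrite Normc.normcM normc_real ger0_norm ?box_ind_ge0//.
  rewrite mulrC -(onenorm_weight k) mulrACA ler_pM ?normc_ge0 ?box_ind_ge0//.
  by apply: box_ind_weight; rewrite normrN.
apply: filterS (box_ind_cvg lo hi) => x cx; apply: ccvgM; last exact: ccvg_cst.
split => /=; last exact: cvg_cst.
rewrite oppr0 addr0; apply: cx; apply: cvg_trans w0.
by under eq_fun do rewrite normrN.
Qed.

Definition box_convolution f h (s : R) := cintegral mu (fun a => (ind a)%:C *
  cintegral mu (fun z => f (a + s *: z) * h z)).

Lemma box_convolutionE f h (s : R) : growth k f -> decay k h ->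
  box_convolution f h s = cintegral mu (fun z => h z * box_average f (s *: z)).
Proof.
move=> gf dh; have [mf [C C0 fC]] := gf; have [mh [D D0 hD]] := dh.
pose F (p : 'rV[R]_d * 'rV[R]_d) := (ind p.1)%:C * (f (p.1 + s *: p.2) * h p.2).
have -> : box_convolution f h s =
    cintegral mu (fun a => cintegral mu (fun z => F (a, z))).
  apply: eq_cintegral => a; apply: esym.
  exact: (cintegralZ (ind a)%:C (growth_decay_integrable (growth_affine a s gf) dh)).
have mF : cmeasurable F.
  apply: cmeasurableM.
    apply: cmeasurable_real; apply: measurableT_comp; last exact: measurable_fst.
    exact: measurable_box_ind.
  apply: cmeasurableM; last exact: (cmeasurable_comp mh measurable_snd).
  apply: (cmeasurable_comp mf); apply: measurable_rVD; first exact: measurable_fst.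
  by apply: measurable_rVZ; exact: measurable_snd.
rewrite (@cintegral_fubini_prod _ _ _ _ _ mu mu F
  (fun a => ind a * (1 + `|a|) ^+ k)
  (fun z => C * (1 + `|s|) ^+ k * D * (1 + `|z|) ^- (2 * d)) mF).
- apply: eq_cintegral => z.
  rewrite -(cintegralZ (h z) (cintegrable_box_shift (s *: z) gf)).
  by apply: eq_cintegral => a; rewrite /F/= mulrA [RHS]mulrC.
- exact: rintegrable_box_growth.
- by apply: rintegrableZ; exact: rintegrable_weight.
move=> a z; rewrite Normc.normcM normc_real ger0_norm ?box_ind_ge0//= -mulrA.
rewrite ler_wpM2l ?box_ind_ge0// Normc.normcM.
apply: (@le_trans _ _ ((C * ((1 + `|a|) * (1 + `|s|)) ^+ k * (1 + `|z|) ^+ k) *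
  (D * (1 + `|z|) ^- (k + 2 * d)))).
  by rewrite ler_pM ?normc_ge0//; exact: growth_affine_bound.
rewrite -(onenorm_weight k) exprMn le_eqVlt; apply/orP; left; apply/eqP; ring.
Qed.

(** The approximate identity in weak form. After exchange the integrand is $h(z)$ times the box
    average of $f$ displaced by $sz$; it converges for each $z$, and is dominated because box
    averages inherit the growth of $f$. *)
Lemma box_convolution_cvg f h : growth k f -> decay k h ->
  ccvg (fun n => box_convolution f h n.+1%:R^-1)
    (cintegral mu h * box_average f 0).
Proof.
move=> gf dh; have [mf [C C0 fC]] := gf; have [mh [D D0 hD]] := dh.
have [K K0 fK] := normc_box_average gf.
have ih : cintegrable mu h.
  apply: (@cintegrable_le _ _ _ mu _ (fun z => D * (1 + `|z|) ^- (2 * d))) => //.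
    by apply: rintegrableZ; exact: rintegrable_weight.
  move=> x; rewrite (le_trans (hD x))// ler_wpM2l// exprD invfM ler_piMl//.
  by rewrite invf_le1 ?exprn_ege1 ?exprn_gt0 ?onenorm_gt0// lerDl.
have s1 n : n.+1%:R^-1 <= 1 :> R by rewrite invf_le1 ?ltr0Sn// ler1n.
rewrite mulrC -(cintegralZ (box_average f 0) ih).
have -> : (fun n => box_convolution f h n.+1%:R^-1) =
    fun n => cintegral mu (fun z => h z * box_average f (n.+1%:R^-1 *: z)).
  by apply/funext => n; exact: box_convolutionE.
apply: (@cintegral_dct R _ _ mu _ _ (fun x => D * K * (1 + `|x|) ^- (2 * d))).
- move=> n; apply: cmeasurableM => //.
  apply: (cmeasurable_comp (cmeasurable_box_average mf)).
  by apply: measurable_rVZ; exact: measurable_id.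
- by apply: cmeasurableM => //; exact: cmeasurable_cst.
- by apply: rintegrableZ; exact: rintegrable_weight.
- move=> n z; rewrite Normc.normcM -(onenorm_weight k).
  rewrite [_ ^+ k * _]mulrC [leRHS]mulrACA ler_pM ?normc_ge0//.
  rewrite (le_trans (fK _))// ler_wpM2l// lerXn2r ?nnegrE ?addr_ge0//.
  by rewrite lerD2l normrZ ger0_norm ?invr_ge0// ler_piMl.
apply: nearW => z; rewrite [box_average f 0 * _]mulrC; apply: ccvgM; first exact: ccvg_cst.
apply: (@box_average_cvg _ _ `|z|) => // [n|].
  by rewrite normrZ ger0_norm ?invr_ge0// ler_piMl.
under eq_fun do rewrite normrZ ger0_norm ?invr_ge0//.
have H := cvgM (@cvg_harmonic R) (cvg_cst `|z|); rewrite mul0r in H; exact: H.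
Qed.

End approximate_identity.

(** * The quadratic form of a Fourier multiplier *)

Section fourier_energy.
Context {R : realType} {d : nat}.
Notation mu := (@borel_lebesgue R d).
Implicit Types (g h chi : 'rV[R]_d -> R[i]) (x a w : 'rV[R]_d).

Lemma cintegrable_conj g : cintegrable mu g -> cintegrable mu (fun x => (g x)^*%R).
Proof.
move=> ig; apply: (cintegrable_le _ (cintegrable_normc ig)).
  by apply: cmeasurableJ; exact: cintegrable_measurable ig.
by move=> x; rewrite normcJ.
Qed.

Lemma normc_inverse_fourier g w : cintegrable mu g ->
  Normc.normc (inverse_fourier g w) <= 2 * \int[mu]_x Normc.normc (g x).
Proof.
move=> ig; apply: normc_cintegral.
- exact: cintegrable_measurable (cintegrable_phase w ig).
- exact: cintegrable_normc.
- by move=> x; rewrite Normc.normcM normc_expi mulr1.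
Qed.

Lemma cintegrable_inverse_fourierM g h : cintegrable mu g -> cintegrable mu h ->
  cintegrable mu (fun w => inverse_fourier g w * h w).
Proof.
move=> ig ih; apply: (@cintegrable_le _ _ _ mu _
  (fun w => 2 * (\int[mu]_x Normc.normc (g x)) * Normc.normc (h w))).
- apply: cmeasurableM; last exact: cintegrable_measurable ih.
  by apply: cmeasurable_inverse_fourier; exact: cintegrable_measurable ig.
- by apply: rintegrableZ; exact: cintegrable_normc.
- by move=> w; rewrite Normc.normcM ler_wpM2r ?normc_ge0//; exact: normc_inverse_fourier.
Qed.

(** The multiplication formula: Fubini, the phase being symmetric in $x$ and $w$. *)
Lemma inverse_fourier_exchange g h : cintegrable mu g -> cintegrable mu h ->
  cintegral mu (fun x => g x * inverse_fourier h x) =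
  cintegral mu (fun w => inverse_fourier g w * h w).
Proof.
move=> ig ih; have mg := cintegrable_measurable ig; have mh := cintegrable_measurable ih.
pose F (p : 'rV[R]_d * 'rV[R]_d) : R[i] :=
  g p.1 * h p.2 * expi (2 * pi * dotp p.1 p.2).
have mF : cmeasurable F.
  apply: cmeasurableM; first apply: cmeasurableM.
  - exact: (cmeasurable_comp mg measurable_fst).
  - exact: (cmeasurable_comp mh measurable_snd).
  - apply: cmeasurable_expi; apply: measurable_funM; first exact: measurable_cst.
    by apply: measurable_dotp; [exact: measurable_fst|exact: measurable_snd].
transitivity (cintegral mu (fun x => cintegral mu (fun w => F (x, w)))).
  apply: eq_cintegral => x; rewrite -(cintegralZ (g x) (cintegrable_phase x ih)).
  by apply: eq_cintegral => w; rewrite /F/= mulrA.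
rewrite (@cintegral_fubini_prod _ _ _ _ _ mu mu F (fun x => Normc.normc (g x))
  (fun w => Normc.normc (h w)) mF (cintegrable_normc ig) (cintegrable_normc ih)).
  apply: eq_cintegral => w; rewrite [RHS]mulrC -(cintegralZ (h w) (cintegrable_phase w ig)).
  by apply: eq_cintegral => x; rewrite /F/= dotpC mulrA [h w * _]mulrC.
by move=> x w; rewrite /F /= !Normc.normcM normc_expi mulr1.
Qed.

Lemma inverse_fourierN h a :
  cintegrable mu h -> inverse_fourier h (- a) = (inverse_fourier (fun w => (h w)^*%R) a)^*%R.
Proof.
move=> ih; rewrite -(cintegralJ (cintegrable_phase a (cintegrable_conj ih))).
apply: eq_cintegral => w; rewrite rmorphM /= conjCK; congr (_ * _).
by rewrite -expiN dotpNl mulrN.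
Qed.

(** Convolution with the transform of [chi] is diagonal in frequency. Two applications of
    [inverse_fourier_exchange] give this: one to the inner integral, with the translation by $a$
    absorbed as a phase in [chi], the other to the outer one. *)
Lemma fourier_energy g chi : cintegrable mu g -> cintegrable mu chi ->
  cintegral mu (fun a => (g a)^*%R *
    cintegral mu (fun x => g x * inverse_fourier chi (x - a))) =
  cintegral mu (fun w => chi w * (inverse_fourier g w * (inverse_fourier g w)^*%R)).
Proof.
move=> ig ic; pose h w := inverse_fourier g w * chi w.
have ih : cintegrable mu h := cintegrable_inverse_fourierM ig ic.
have inner a : cintegral mu (fun x => g x * inverse_fourier chi (x - a)) =
    (inverse_fourier (fun w => (h w)^*%R) a)^*%R.
  rewrite -inverse_fourierN//.
  pose ca w := chi w * expi (2 * pi * dotp (- a) w).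
  have ica : cintegrable mu ca := cintegrable_phase (- a) ic.
  transitivity (cintegral mu (fun x => g x * inverse_fourier ca x)).
    apply: eq_cintegral => x; congr (_ * _); apply: eq_cintegral => w.
    by rewrite /ca -[RHS]mulrA -expiD -mulrDr -dotpDl [- a + x]addrC.
  rewrite (inverse_fourier_exchange ig ica).
  by apply: eq_cintegral => w; rewrite /ca /h mulrA.
under eq_cintegral do rewrite inner -rmorphM/=.
rewrite cintegralJ; last first.
  under [X in cintegrable _ X]eq_fun do rewrite mulrC.
  exact: (cintegrable_inverse_fourierM (cintegrable_conj ih) ig).
rewrite (inverse_fourier_exchange ig (cintegrable_conj ih)) -cintegralJ; last first.
  exact: (cintegrable_inverse_fourierM ig (cintegrable_conj ih)).
apply: eq_cintegral => w; rewrite /h rmorphM /= conjCK; ring.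
Qed.

End fourier_energy.

(** * The mass of the low-pass kernel *)

Section lowpass_mass.
Context {R : realType} {d : nat} (k : nat).
Notation mu := (@borel_lebesgue R d).
Notation N := (k + 2 * d)%N.
Notation Phi := (@lowpass_kernel R d N).

(** Small enough for two purposes: for $x, w$ in the box, $|2\pi\, x\cdot w| \le 8 d \rho^2 \le
    1/2$, and $|sw| \le 1/(d+1)$ for $s \le 1$, where the filter equals $1$. *)
Let rho : R := (4 * d.+1%:R)^-1.
Let hi : 'rV[R]_d := const_mx rho.
Let ind := box_ind (- hi) hi.
Let m := \int[mu]_x ind x.
Let b := inverse_fourier (fun x => (ind x)%:C).

Let rho_gt0 : 0 < rho. Proof. by rewrite invr_gt0 mulr_gt0. Qed.

Let box_norm x : box (- hi) hi x -> `|x| <= rho.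
Proof.
move=> xB; apply: normr_rV_le => [|i]; first exact: ltW.
have := xB i; rewrite in_itv/= !mxE => /andP[/ltW lx /ltW xh].
by rewrite ler_norml lx.
Qed.

Let ind_conj x : ((ind x)%:C)^*%R = (ind x)%:C :> R[i].
Proof. by apply/eqP; rewrite eq_complex /= oppr0 !eqxx. Qed.

Let mass_gt0 : 0 < m.
Proof.
pose A (i : 'I_d) : set (measurableTypeR R) := `]- rho, rho[%classic.
have mE : mu (box (- hi) hi) = ((rho *+ 2) ^+ d)%:E.
  rewrite (_ : box _ _ = [set x : 'rV[R]_d | forall i, A i (x ord0 i)]); last first.
    by apply/seteqP; split => x /= xB i; have := xB i; rewrite !mxE.
  rewrite borel_lebesgue_box; last by move=> i; exact: measurable_itv.
  under eq_bigr do rewrite /A lebesgue_measure_itv/= lte_fin gtrN// -EFinB opprK -mulr2n.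
  by rewrite prodEFin prodr_const card_ord.
have -> : m = (rho *+ 2) ^+ d; last by rewrite exprn_gt0// mulrn_wgt0.
apply: (etrans _ (congr1 fine mE)); congr fine.
have := @integral_indic _ _ _ mu _ measurableT _ (@measurable_box R d (- hi) hi).
by rewrite setIT.
Qed.

(** For $x$ and $w$ in the box the phase is so small that its cosine is at least $1/2$. *)
Let energy_ge w : box (- hi) hi w -> m / 2 <= complex.Re (b w).
Proof.
move=> wB; rewrite /b /inverse_fourier /=.
have iR := rintegrable_box (- hi) hi.
rewrite /m mulrC -(RintegralZl 2^-1 measurableT iR).
have ic : cintegrable mu (fun x => (ind x)%:C) by split => //; exact: rintegrable0.
apply: le_Rintegral => //.
- exact: rintegrableZ.
- by have [] := cintegrable_phase w ic.
move=> x _; rewrite mul0r subr0.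
have [xB|xB] := pselect (box (- hi) hi x); last first.
  by rewrite /ind /box_ind indicE memNset// mulr0 mul0r.
rewrite mulrC ler_wpM2l ?box_ind_ge0//.
set t := 2 * pi * dotp w x.
have t2 : `|t| <= 1 / 2.
  have p4 : pi <= 4 :> R by have := @pihalf_02 R; lra.
  have D : `|dotp w x| <= d%:R * (rho * rho).
    rewrite (le_trans (normr_dotp _ _))// ler_wpM2l// ler_pM//; exact: box_norm.
  rewrite /t !normrM (@ger0_norm _ 2)// (@ger0_norm _ pi) ?pi_ge0//.
  have dr : d%:R * rho <= 4^-1.
    rewrite /rho invfM mulrCA ler_piMr// ler_pdivrMr// mul1r ler_nat//.
  have r4 : rho <= 4^-1 by rewrite /rho invfM ler_piMr// invf_le1// ler1n.
  have D2 : d%:R * (rho * rho) <= 16^-1.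
    rewrite mulrA (@le_trans _ _ (4^-1 * 4^-1))//; last by lra.
    by rewrite ler_pM// ?mulr_ge0// ltW.
  have p0 := @pi_ge0 R; have := normr_ge0 (dotp w x).
  nra.
have := cosB1_le t; rewrite ler_norml => /andP[c1 _].
have : `|t| * `|t| <= 1 / 2 by have := normr_ge0 t; nra.
lra.
Qed.

(* Fourier inversion would give mass [1]. Without it: for [f] the indicator of a small
   box, the average of the dilated convolution over that box is a Fourier energy that
   stays bounded below, while it converges to the mass times the volume of the box. *)
Theorem lowpass_mass_neq0 : cintegral mu Phi != 0.
Proof.
pose f x := (ind x)%:C : R[i].
have gf : growth k f.
  split; first by apply: cmeasurable_real; exact: measurable_box_ind.
  exists 1 => // x; rewrite mul1r normc_real ger0_norm ?box_ind_ge0//.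
  by rewrite (le_trans (box_ind_le1 _ _ _))// exprn_ege1// lerDl.
have ig : cintegrable mu f.
  by split => /=; [exact: rintegrable_box|exact: rintegrable0].
have C := box_convolution_cvg (- hi) hi gf (decay_lowpass_kernel k).
apply/negP => /eqP c0; rewrite c0 mul0r in C; case: C => C _.
(* The energy density is nonnegative everywhere and at least $(m/2)^2$ on the box, of volume $m$;
   the bound does not involve $s$. *)
have low (s : R) : 0 < s -> s <= 1 -> m / 2 * (m / 2) * m <= complex.Re (box_convolution (- hi) hi f Phi s).
  move=> s0 s1; pose chi (w : 'rV[R]_d) := (lowpass N (s *: w))%:C : R[i].
  have ic : cintegrable mu chi.
    apply: bounded_support_integrable.
    exact: test_function_bounded_support (test_function_lowpass N s0).
  have -> : box_convolution (- hi) hi f Phi s =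
      cintegral mu (fun w => chi w * (b w * (b w)^*%R)).
    rewrite -(fourier_energy ig ic); apply: eq_cintegral => a.
    by rewrite ind_conj (@lowpass_kernel_dilate R d k f a s gf s0).
  have iE : cintegrable mu (fun w => chi w * (b w * (b w)^*%R)).
    have := cintegrable_inverse_fourierM ig
      (cintegrable_conj (cintegrable_inverse_fourierM ig (cintegrable_conj ic))).
    congr cintegrable; apply/funext => w; rewrite rmorphM /= conjCK -/(b w); ring.
  rewrite -[leRHS]/(\int[mu]_x complex.Re (chi x * (b x * (b x)^*%R))) -(RintegralZl (m / 2 * (m / 2)) measurableT (rintegrable_box (- hi) hi)).
  apply: le_Rintegral => //.
  - by apply: rintegrableZ; exact: rintegrable_box.
  - by case: iE.
  have RE (r : R) (z : R[i]) :
      complex.Re (r%:C * (z * z^*%R)) = r * (complex.Re z ^+ 2 + complex.Im z ^+ 2).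
    by case: z => u v /=; ring.
  move=> w _; rewrite RE.
  have [wB|wB] := pselect (box (- hi) hi w); last first.
    rewrite /box_ind indicE memNset// mulr0 mulr_ge0 ?lowpass_ge0//.
    by rewrite addr_ge0 ?sqr_ge0.
  rewrite lowpass_near0; last first.
    rewrite normrZ gtr0_norm// (@le_trans _ _ (1 * rho))//.
      by rewrite ler_pM//; [exact: ltW|exact: box_norm].
    by rewrite mul1r /rho invfM ler_piMl// invf_le1// ler1n.
  have e := energy_ge wB; have m2 : 0 <= m / 2 by rewrite divr_ge0// ltW.
  rewrite mul1r; apply: le_trans (ler_piMr (mulr_ge0 m2 m2) (box_ind_le1 _ _ _)) _.
  apply: (@le_trans _ _ (complex.Re (b w) ^+ 2)); last by rewrite lerDl sqr_ge0.
  by rewrite expr2 ler_pM.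
have : m / 2 * (m / 2) * m <= 0.
  rewrite -[leRHS](cvg_lim (@Rhausdorff R) C); apply: limr_ge; first by apply: cvgP C.
  by apply: nearW => n; apply: low; rewrite ?invr_gt0// invf_le1// ler1n.
by apply/negP; rewrite -ltNge !mulr_gt0 ?invr_gt0.
Qed.

End lowpass_mass.

(** * Functions with vanishing integrals over boxes *)

Section box_null.
Context {R : realType} {d : nat}.
Notation mu := (@borel_lebesgue R d).
Implicit Types (lo hi x : 'rV[R]_d) (g : 'rV[R]_d -> R).

Definition boxes : set_system 'rV[R]_d := [set A | exists lo hi, A = box lo hi].

Lemma box_setI lo hi lo' hi' : box lo hi `&` box lo' hi' =
  box (\row_i Num.max (lo ord0 i) (lo' ord0 i)) (\row_i Num.min (hi ord0 i) (hi' ord0 i)).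
Proof.
apply/seteqP; split => [x [xB xB'] i|x xB].
  move: (xB i) (xB' i); rewrite !in_itv/= !mxE => /andP[l h] /andP[l' h'].
  by rewrite gt_max lt_min l h l' h'.
split=> i; move: (xB i); rewrite !in_itv/= !mxE gt_max lt_min;
  by move=> /andP[/andP[l l'] /andP[h h']]; rewrite ?l ?l' ?h ?h'.
Qed.

Lemma setI_closed_boxes : setI_closed boxes.
Proof.
move=> A B [lo [hi ->]] [lo' [hi' ->]]; rewrite box_setI.
by eexists; eexists.
Qed.

(** A half-space $x_i > a$ is a countable union of bounded boxes whose $i$-th lower end is $a$. *)
Lemma measurable_sub_boxes : (@measurable _ 'rV[R]_d : set_system _) `<=` <<s boxes >>.
Proof.
move=> A mA; have mid : measurable_fun setT (fun x : g_sigma_algebraType boxes => x : 'rV[R]_d).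
  apply: measurable_fun_rV => i.
  apply: (measurability _ (RGenOInfty.measurableE R)) => _ [_ [a ->] <-].
  rewrite setTI [X in measurable X](_ : _ = \bigcup_n
      box (\row_j if j == i then a else - n%:R) (const_mx n%:R)).
    by apply: bigcupT_measurable => n; apply: sub_sigma_algebra; eexists; eexists.
  apply/seteqP; split => x /=.
    rewrite in_itv/= andbT => ax.
    have [n _ xn] : \forall n \near \oo, `|x| < n%:R by exact: nbhs_infty_gtr.
    exists n => // j; have := le_lt_trans (normr_coord x j) (xn n (leqnn n)).
    rewrite ltr_norml in_itv/= !mxE => /andP[l ->]; rewrite andbT.
    by case: eqP => // ->.
  by move=> [n _ /(_ i)]; rewrite !in_itv/= !mxE eqxx andbT => /andP[].
by have := mid measurableT A mA; rewrite setTI.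
Qed.

(** Boxes form a generating system closed under intersection, so the vanishing integrals pass to all
    Borel sets by the monotone class argument, and then $g$ vanishes almost everywhere. *)
Lemma box_integral_null g : measurable_fun setT g ->
  (forall lo hi, rintegrable mu (fun x => box_ind lo hi x * g x)) ->
  (forall lo hi, \int[mu]_x (box_ind lo hi x * g x) = 0) ->
  {ae mu, forall x, g x = 0}.
Proof.
move=> mg ig g0.
have aeQ (n : nat) : {ae mu, forall x, box_ind (const_mx (- n%:R)) (const_mx n%:R) x * g x = 0}.
  set lo : 'rV[R]_d := const_mx _; set hi : 'rV[R]_d := const_mx _.
  (* Cutting [g] to a large box makes it integrable and puts the whole space in the class [H], since
     the integral of [G] is one over a box. *)
  pose G x := box_ind lo hi x * g x.
  have iG : rintegrable mu G := ig lo hi.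
  have mG := rintegrable_measurable iG.
  have mI (A : set 'rV[R]_d) : measurable A -> measurable_fun setT (fun x => \1_A x * G x).
    by move=> mA; apply: measurable_funM => //; exact: measurable_indic.
  have IG (A : set 'rV[R]_d) x : `|\1_A x * G x| <= `|G x|.
    by rewrite normrM ler_piMl// indicE ger0_norm// lern1 leq_b1.
  have iIG (A : set 'rV[R]_d) : measurable A -> rintegrable mu (fun x => \1_A x * G x).
    by move=> mA; apply: (rintegrable_le (mI A mA) (rintegrable_norm iG)).
  pose H : set_system 'rV[R]_d := [set A | measurable A /\ \int[mu]_x (\1_A x * G x) = 0].
  have HA (A : set 'rV[R]_d) : measurable A -> H A.
    move=> /measurable_sub_boxes; apply: (@lambda_system_subset _ boxes) => //.
    - exact: setI_closed_boxes.
    - split => //.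
      + split; first exact: measurableT.
        apply: etrans (g0 lo hi); apply: eq_Rintegral => x _.
        by rewrite indicT/= mul1r.
      + move=> A1 A2 A21 [m1 e1] [m2 e2]; split; first exact: measurableD.
        transitivity (\int[mu]_x (\1_A1 x * G x - \1_A2 x * G x)).
          apply: eq_Rintegral => x _; rewrite -mulrBl; congr (_ * _).
          rewrite !indicE in_setD.
          have [x2|x2] := boolP (x \in A2); last by rewrite andbT subr0.
          by rewrite (mem_set (A21 _ (set_mem x2))) subrr.
        by rewrite (RintegralB measurableT (iIG _ m1) (iIG _ m2)) e1 e2 subr0.
      + move=> F ndF HF; have mF i : measurable (F i) by case: (HF i).
        have mU : measurable (\bigcup_i F i) by exact: bigcupT_measurable.
        split => //.
        have C := @Rintegral_dct _ _ _ mu (fun n x => \1_(F n) x * G x)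
          (fun x => \1_(\bigcup_i F i) x * G x) _ (fun n => mI _ (mF n)) (mI _ mU)
          (rintegrable_norm iG) (fun n x => IG _ x).
        have {C} C : \int[mu]_x (\1_(F n) x * G x) @[n --> \oo] -->
            \int[mu]_x (\1_(\bigcup_i F i) x * G x).
          apply: C; apply: nearW => x; apply: cvgM; last exact: cvg_cst.
          have [[i _ Fx]|nF] := pselect ((\bigcup_i F i) x); last first.
            apply: cvg_near_cst; apply: nearW => i.
            by rewrite !indicE !memNset// => Fx; apply: nF; exists i.
          apply: cvg_near_cst; exists i => // j /= ij.
          have /subsetPset sub := ndF _ _ ij; have Fj : F j x := sub _ Fx.
          by rewrite !indicE !mem_set//; exists i.
        apply: (cvg_unique (@Rhausdorff R) C).
        have -> : (fun n => \int[mu]_x (\1_(F n) x * G x)) = fun=> 0.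
          by apply/funext => j; have [_ ->] := HF j.
        exact: cvg_cst.
    - move=> _ [lo' [hi' ->]]; split; first exact: measurable_box.
      apply: etrans (g0 (\row_i Num.max (lo' ord0 i) (lo ord0 i))
        (\row_i Num.min (hi' ord0 i) (hi ord0 i))).
      apply: eq_Rintegral => x _; rewrite /G mulrA; congr (_ * _).
      by rewrite /box_ind -box_setI indicI.
  have : ae_eq mu setT (EFin \o G) (cst 0%E).
    apply: integral_ae_eq => // A _ mA; rewrite integral0.
    have [_ e0] := HA A mA.
    have E : (\int[mu]_(x in A) (EFin \o G) x = \int[mu]_x (\1_A x * G x)%:E)%E.
      rewrite integral_mkcond; apply: eq_integral => x _.
      by rewrite restrict_EFin patch_indic/= mulrC.
    rewrite E -[LHS]fineK; first by rewrite -[fine _]/(\int[mu]_x (\1_A x * G x)) e0.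
    exact: (integrable_fin_num measurableT (iIG _ mA)).
  by apply: filterS => x /(_ I)/= [].
have : \forall x \ae mu, forall n : nat,
  box_ind (const_mx (- n%:R)) (const_mx n%:R) x * g x = 0 by exact: ae_foralln.
apply: filterS => x gx.
have [n _ xn] : \forall n \near \oo, `|x| < n%:R by exact: nbhs_infty_gtr.
have := gx n; rewrite /box_ind indicE mem_set ?mul1r// => i.
have := le_lt_trans (normr_coord x i) (xn n (leqnn n)).
by rewrite ltr_norml in_itv/= !mxE.
Qed.

End box_null.

(** * Recovery of a dilation-invariant function *)

Section lowpass_recovery.
Context {R : realType} {d : nat} (k : nat).
Notation mu := (@borel_lebesgue R d).
Notation Phi := (@lowpass_kernel R d (k + 2 * d)).
Implicit Types (f h : 'rV[R]_d -> R[i]) (lo hi x a z : 'rV[R]_d).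

Lemma growthD f h : growth k f -> growth k h -> growth k (fun x => f x + h x).
Proof.
move=> [mf [C C0 fC]] [mh [D D0 hD]]; split; first exact: cmeasurableD.
exists (C + D); first exact: addr_ge0.
by move=> x; rewrite (le_trans (normcD _ _))// mulrDl lerD.
Qed.

Lemma growthZ (c : R[i]) f : growth k f -> growth k (fun x => c * f x).
Proof.
move=> [mf [C C0 fC]]; split; first by apply: cmeasurableM => //; exact: cmeasurable_cst.
exists (Normc.normc c * C); first by rewrite mulr_ge0// normc_ge0.
by move=> x; rewrite Normc.normcM -mulrA ler_wpM2l// normc_ge0.
Qed.

Lemma growth_convolution f h : growth k f -> decay k h ->
  growth k (fun a => cintegral mu (fun z => f (a + z) * h z)).
Proof.
move=> gf dh; have [mf [C C0 fC]] := gf; have [mh [D D0 hD]] := dh.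
split.
  apply: (@cmeasurable_cintegral _ _ _ _ _ mu (fun p : 'rV[R]_d * 'rV[R]_d => f (p.1 + p.2) * h p.2)).
  apply: cmeasurableM; last exact: (cmeasurable_comp mh measurable_snd).
  by apply: (cmeasurable_comp mf); apply: measurable_rVD;
    [exact: measurable_fst|exact: measurable_snd].
exists (2 * (C * 2 ^+ k * D * \int[mu]_x (1 + `|x|) ^- (2 * d))).
  rewrite !mulr_ge0// ?exprn_ge0//; apply: Rintegral_ge0 => x _.
  by rewrite invr_ge0 exprn_ge0// ltW// onenorm_gt0.
move=> a; pose K := C * ((1 + `|a|) * 2) ^+ k * D.
have K0 : 0 <= C * ((1 + `|a|) * 2) ^+ k.
  by rewrite mulr_ge0// exprn_ge0// mulr_ge0// ltW// onenorm_gt0.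
have fa z : Normc.normc (f (a + z)) <= C * ((1 + `|a|) * 2) ^+ k * (1 + `|z|) ^+ k.
  have := growth_affine_bound a 1 z C0 fC.
  by rewrite scale1r normr1 (_ : 1 + 1 = 2).
apply: le_trans (normc_cintegral (h := fun z => K * (1 + `|z|) ^- (2 * d)) _ _ _) _.
- apply: cmeasurableM => //; apply: (cmeasurable_comp mf).
  by apply: measurable_rVD; [exact: measurable_cst|exact: measurable_id].
- by apply: rintegrableZ; exact: rintegrable_weight.
- exact: growth_decay_le K0 D0 fa hD.
rewrite (RintegralZl K measurableT (rintegrable_weight d)) /K exprMn.
by rewrite le_eqVlt; apply/orP; left; apply/eqP; ring.
Qed.

Lemma box_cintegral_null f : growth k f ->
  (forall lo hi, cintegral mu (fun x => (box_ind lo hi x)%:C * f x) = 0) ->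
  {ae mu, forall x, f x = 0}.
Proof.
move=> gf f0; have [[mR mI] _] := gf.
have ibf lo hi : cintegrable mu (fun x => (box_ind lo hi x)%:C * f x).
  have := cintegrable_box_shift lo hi 0 gf; congr cintegrable.
  by apply/funext => x; rewrite addr0.
have RE lo hi : (fun x => complex.Re ((box_ind lo hi x)%:C * f x)) =
    fun x => box_ind lo hi x * complex.Re (f x).
  by apply/funext => x; rewrite cReM /= mul0r subr0.
have IE lo hi : (fun x => complex.Im ((box_ind lo hi x)%:C * f x)) =
    fun x => box_ind lo hi x * complex.Im (f x).
  by apply/funext => x; rewrite cImM /= mul0r addr0.
have R0 : {ae mu, forall x, complex.Re (f x) = 0}.
  apply: box_integral_null => // lo hi.
    by rewrite -RE; case: (ibf lo hi).
  by have /(congr1 (@complex.Re R)) := f0 lo hi; rewrite /= RE.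
have I0 : {ae mu, forall x, complex.Im (f x) = 0}.
  apply: box_integral_null => // lo hi.
    by rewrite -IE; case: (ibf lo hi).
  by have /(congr1 (@complex.Im R)) := f0 lo hi; rewrite /= IE.
by apply: filterS2 R0 I0 => x; case: (f x) => u v /= -> ->.
Qed.

(** By dilation invariance the box averages of the convolution are the same at all scales $1/(n+1)$,
    hence equal to their limit, which is $c$ times the box average of $f$. Box averages determine a
    function almost everywhere. *)
Theorem lowpass_recovery f : growth k f ->
  (forall a (s : R), 0 < s -> cintegral mu (fun z => f (a + s *: z) * Phi z) =
    cintegral mu (fun z => f (a + z) * Phi z)) ->
  {ae mu, forall a, cintegral mu (fun z => f (a + z) * Phi z) = cintegral mu Phi * f a}.
Proof.
move=> gf dil; have dP := @decay_lowpass_kernel R d k.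
pose c := cintegral mu Phi; pose F a := cintegral mu (fun z => f (a + z) * Phi z).
have gF : growth k F := growth_convolution gf dP.
have gcf : growth k (fun a => - c * f a) := growthZ (- c) gf.
have H : {ae mu, forall a, F a + - c * f a = 0}.
  apply: box_cintegral_null; first exact: growthD.
  move=> lo hi; pose ind := box_ind lo hi.
  have i1 := cintegrable_box_shift lo hi 0 gF.
  have i2 := cintegrable_box_shift lo hi 0 gf.
  have cB : cintegral mu (fun a => (ind a)%:C * F (a + 0)) = c * box_average lo hi f 0.
    apply: (ccvg_unique _ (box_convolution_cvg lo hi gf dP)).
    rewrite (_ : (fun n => _) = fun=> cintegral mu (fun a => (ind a)%:C * F (a + 0))).
      exact: ccvg_cst.
    apply/funext => n; apply: eq_cintegral => a; congr (_ * _).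
    by rewrite dil ?invr_gt0// addr0.
  transitivity (cintegral mu (fun a => (ind a)%:C * F (a + 0) +
      - c * ((ind a)%:C * f (a + 0)))).
    by apply: eq_cintegral => a; rewrite addr0 mulrDr; congr (_ + _); rewrite mulrCA.
  rewrite (cintegralD i1 (cintegrableZ (- c) i2)) (cintegralZ (- c) i2) cB mulNr.
  exact: subrr.
apply: filterS H => a; rewrite mulNr => /eqP; rewrite subr_eq0 => /eqP //.
Qed.

End lowpass_recovery.

(** * From lines to polynomials *)

Section interpolation.
Context {R : realType} {d : nat} (k : nat).
Implicit Types (F : 'rV[R]_d -> R[i]) (x a v : 'rV[R]_d) (q : {poly R[i]}).

Definition node_poly (j : 'I_k.+1) : {poly R[i]} :=
  tnth (lagrange k.+1 (fun n => n%:R : R[i])) j.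

Lemma natr_complex_inj : injective (fun n => n%:R : R[i]).
Proof. by move=> m n /eqP; rewrite eqr_nat => /eqP. Qed.

Lemma size_node_poly j : (size (node_poly j) <= k.+1)%N.
Proof. by rewrite size_lagrange_//; exact: natr_complex_inj. Qed.

Lemma node_interpolation q z : (size q <= k.+1)%N ->
  q.[z] = \sum_(j < k.+1) q.[j%:R] * (node_poly j).[z].
Proof.
move=> sq; rewrite {1}(lagrange_gen (ltn0Sn k) natr_complex_inj sq) horner_sum.
by apply: eq_bigr => j _; rewrite hornerM hornerC.
Qed.

(** No limit of the polynomials $q$ is taken. Each satisfies the Lagrange formula at the nodes $0,
    \dots, k$ exactly, and [g] differs from it by at most $B/s$ at $t$ and at the nodes, so the
    formula holds for [g] up to a multiple of $1/s$. *)
Lemma approx_interpolation (g : R -> R[i]) :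
  (forall T : R, 0 < T -> exists2 B : R, 0 <= B & forall s, 1 <= s -> T <= s ->
    exists2 q : {poly R[i]}, (size q <= k.+1)%N &
      forall t, `|t| <= T -> Normc.normc (g t - q.[t%:C]) <= B / s) ->
  forall t, g t = \sum_(j < k.+1) g j%:R * (node_poly j).[t%:C].
Proof.
(* Large enough to contain both $t$ and all the nodes. *)
move=> gq t; pose T : R := `|t| + k.+1%:R.
have T0 : 0 < T by rewrite ltr_wpDl.
have [B B0 HB] := gq T T0.
pose S : R := 1 + \sum_(j < k.+1) Normc.normc (node_poly j).[t%:C].
have S0 : 0 <= S by rewrite addr_ge0// sumr_ge0// => j _; exact: normc_ge0.
set h := \sum_(j < k.+1) _.
have le s : 1 <= s -> T <= s -> Normc.normc (g t - h) <= B / s * S.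
  move=> s1 sT; have [q sq qB] := HB s s1 sT.
  have -> : g t - h = (g t - q.[t%:C]) +
      \sum_(j < k.+1) (q.[j%:R] - g j%:R) * (node_poly j).[t%:C].
    under eq_bigr do rewrite mulrBl.
    by rewrite sumrB -node_interpolation// addrA subrK.
  rewrite (le_trans (normcD _ _))// /S mulrDr mulr1 lerD//.
    by apply: qB; rewrite lerDl.
  rewrite mulr_sumr; elim/big_ind2 : _ => [|x1 y1 x2 y2 h1 h2|j _].
  - by rewrite Normc.normc0.
  - by rewrite (le_trans (normcD _ _))// lerD.
  rewrite Normc.normcM ler_wpM2r ?normc_ge0//.
  have := qB j%:R; rewrite rmorph_nat -normcN opprB; apply.
  by rewrite ger0_norm// /T ler_wpDl// ler_nat ltnW.
apply: subr0_eq; apply: Normc.eq0_normc; apply: le_anti.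
rewrite normc_ge0 andbT; apply/ler_addgt0Pl => e e0; rewrite addr0.
(* The last entry makes the error $BS/s$ at most [e]. *)
pose s := Num.max (Num.max 1 T) (B * S / e).
have s0 : 0 < s by rewrite !lt_max ltr01.
apply: (le_trans (le s _ _)); rewrite ?le_max ?lexx ?orbT//.
by rewrite mulrAC ler_pdivrMr// [e * _]mulrC -ler_pdivrMr// /s le_max lexx orbT.
Qed.

End interpolation.

(** * Polynomials in several variables *)

Section polynomial_functions.
Context {R : realType} {d : nat} (k : nat).
Implicit Types (F G : 'rV[R]_d -> R[i]) (x a v : 'rV[R]_d) (q : {poly R[i]}).
Notation mpolyC := (mpoly.mpoly d R[i]).
Notation eval := (fun x => mpoly.meval (fun i => (x ord0 i)%:C)).

Definition polynomial_fun F := exists p : mpolyC, forall x, F x = eval x p.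

Lemma polynomial_fun_cst (c : R[i]) : polynomial_fun (fun=> c).
Proof. by exists (mpoly.mpolyC d c) => x; rewrite mpoly.mevalC. Qed.

Lemma polynomial_funD F G : polynomial_fun F -> polynomial_fun G ->
  polynomial_fun (fun x => F x + G x).
Proof. by move=> [p pE] [q qE]; exists (p + q) => x; rewrite pE qE mpoly.mevalD. Qed.

Lemma polynomial_funM F G : polynomial_fun F -> polynomial_fun G ->
  polynomial_fun (fun x => F x * G x).
Proof. by move=> [p pE] [q qE]; exists (p * q) => x; rewrite pE qE mpoly.mevalM. Qed.

Lemma polynomial_fun_sum n (F : 'I_n -> 'rV[R]_d -> R[i]) :
  (forall j, polynomial_fun (F j)) -> polynomial_fun (fun x => \sum_(j < n) F j x).
Proof.
elim: n F => [|n IH] F pF.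
  by under eq_fun do rewrite big_ord0; exact: polynomial_fun_cst.
under eq_fun do rewrite big_ord_recl.
by apply: polynomial_funD => //; apply: IH => j.
Qed.

Lemma polynomial_fun_coord q i : polynomial_fun (fun x => q.[(x ord0 i)%:C]).
Proof.
elim/poly_ind: q => [|q c IH].
  by under eq_fun do rewrite horner0; exact: polynomial_fun_cst.
under eq_fun do rewrite hornerMXaddC.
apply: polynomial_funD; last exact: polynomial_fun_cst.
apply: polynomial_funM => //.
by exists (mpoly.mpolyX _ (mpoly.mnm1 i)) => x; rewrite mpoly.mevalXU.
Qed.

Definition freeze (s : seq 'I_d) a x : 'rV[R]_d :=
  \row_i if i \in s then x ord0 i else a ord0 i.

(** Coordinates are released one at a time. Interpolation along the $i$-th axis writes [F] as a
    polynomial in $x_i$ whose coefficients are its values with $x_i$ frozen at the nodes, polynomial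
    in the other free coordinates by induction. *)
Lemma polynomial_fun_freeze F :
  (forall a v t, F (a + t *: v) =
    \sum_(j < k.+1) F (a + j%:R *: v) * (node_poly j).[t%:C]) ->
  forall s a, polynomial_fun (fun x => F (freeze s a x)).
Proof.
move=> Fline; elim=> [|i s IH] a.
  rewrite (_ : (fun _ => _) = fun=> F a); first exact: polynomial_fun_cst.
  by apply/funext => x; congr F; apply/rowP => j; rewrite mxE.
have [si|si] := boolP (i \in s).
  rewrite (_ : (fun _ => _) = fun x => F (freeze s a x)); first exact: IH.
  apply/funext => x; congr F; apply/rowP => j; rewrite !mxE in_cons.
  by case: eqP => // ->; rewrite si.
pose b (j : nat) : 'rV[R]_d := \row_l if l == i then j%:R else a ord0 l.
rewrite (_ : (fun _ => _) = fun x => \sum_(j < k.+1)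
    F (freeze s (b j) x) * (node_poly j).[(x ord0 i)%:C]).
  apply: polynomial_fun_sum => j; apply: polynomial_funM; first exact: IH.
  exact: polynomial_fun_coord.
apply/funext => x; pose a0 := freeze s (b 0%N) x.
have line (t : R) l : (a0 + t *: delta_mx ord0 i) ord0 l =
    if l == i then t else if l \in s then x ord0 l else a ord0 l.
  rewrite !mxE eqxx /=; case: eqP => [->|_]; last by rewrite mulr0 addr0.
  by rewrite (negbTE si) mulr1 add0r.
rewrite (_ : freeze (i :: s) a x = a0 + x ord0 i *: delta_mx ord0 i).
  rewrite Fline; apply: eq_bigr => j _; congr (F _ * _).
  apply/rowP => l; rewrite line !mxE; case: eqP => [->|]//.
  by rewrite (negbTE si).
by apply/rowP => l; rewrite line mxE in_cons; case: eqP => [->|].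
Qed.

Lemma real_eq_poly q q' : (forall t : R, q.[t%:C] = q'.[t%:C]) -> q = q'.
Proof.
move=> qq; apply/eqP; rewrite -subr_eq0; apply/negPn/negP => nz.
pose rs := [seq n%:R : R[i] | n <- iota 0 (size (q - q'))].
have := @max_poly_roots _ (q - q') rs nz; rewrite size_map size_iota ltnn => H.
apply/notF/H.
- apply/allP => z /mapP[n _ ->]; rewrite rootE hornerD hornerN.
  by have := qq n%:R; rewrite rmorph_nat => ->; rewrite subrr.
- by rewrite map_inj_uniq ?iota_uniq//; exact: natr_complex_inj.
Qed.

(** Interpolation along the axes bounds the partial degrees only. On the line $tv$ monomials of
    total degree $n$ contribute to $t^n$, so those of degree above $k$ cancel at every $v$ and can
    be cut off from $p$ without changing its values. *)
Lemma polynomial_fun_degree F :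
  (forall v, exists2 q : {poly R[i]}, (size q <= k.+1)%N & forall t, F (t *: v) = q.[t%:C]) ->
  polynomial_fun F ->
  exists2 p : mpolyC, (mpoly.msize p <= k.+1)%N & forall x, F x = eval x p.
Proof.
move=> Fq [p pE]; pose T := [seq m <- mpoly.msupp p | (mpoly.mdeg m <= k)%N].
exists (\sum_(m <- T) mpoly.mcoeff m p *: mpoly.mpolyX _ m).
  apply: leq_trans (mpoly.msize_sum _ _ _) _; apply/bigmax_leqP_seq => m.
  rewrite mem_filter => /andP[mk _] _; apply: leq_trans (mpoly.msizeZ_le _ _) _.
  by rewrite mpoly.msizeX.
move=> v; have [q sq qE] := Fq v.
pose c (m : mpoly.multinom d) := mpoly.mcoeff m p * \prod_i ((v ord0 i)%:C ^+ m i).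
pose P := \sum_(m <- mpoly.msupp p) c m *: 'X^(mpoly.mdeg m).
have PE t : P.[t%:C] = q.[t%:C].
  rewrite -qE pE mpoly.mevalE horner_sum; apply: eq_bigr => m _.
  rewrite hornerZ hornerXn /c -mulrA; congr (_ * _).
  under [RHS]eq_bigr do rewrite mxE rmorphM exprMn.
  by rewrite big_split /= [RHS]mulrC mpoly.mdegE prodrXr.
have PQ : P = take_poly k.+1 P.
  by rewrite (real_eq_poly PE) take_poly_id.
have := qE 1; rewrite scale1r -PE PQ => ->.
rewrite /P !raddf_sum /= horner_sum big_filter [RHS]big_mkcond /=.
apply: eq_bigr => m _; rewrite mpoly.mevalZ mpoly.mevalX linearZ/= hornerZ.
rewrite rmorph1; case: leqP => mk.
  by rewrite take_poly_id ?size_polyXn// hornerXn expr1n mulr1.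
by rewrite -['X^_]mul1r take_polyMXn (eqP mk) take_poly0l mul0r horner0 mulr0.
Qed.

End polynomial_functions.

Section lowpass_polynomial.
Context {R : realType} {d : nat} (k : nat).
Notation mu := (@borel_lebesgue R d).
Notation Phi := (@lowpass_kernel R d (k + 2 * d)).

Lemma dilation_invariant_polynomial (f : 'rV[R]_d -> R[i]) : growth k f ->
  (forall a (s : R), 0 < s -> cintegral mu (fun z => f (a + s *: z) * Phi z) =
    cintegral mu (fun z => f (a + z) * Phi z)) ->
  exists2 p : mpoly.mpoly d R[i], (mpoly.msize p <= k.+1)%N &
    {ae mu, forall x : 'rV[R]_d, f x = mpoly.meval (fun i => (x ord0 i)%:C) p}.
Proof.
move=> gf dil; pose F (a : 'rV[R]_d) := cintegral mu (fun z => f (a + z) * Phi z).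
have Fline a v t : F (a + t *: v) =
    \sum_(j < k.+1) F (a + j%:R *: v) * (node_poly j).[t%:C].
  apply: (@approx_interpolation R k (fun t => F (a + t *: v))) => T T0.
  exact: lowpass_line_approx.
have [||p pk pE] := @polynomial_fun_degree R d k F.
- move=> v; exists (\sum_(j < k.+1) F (j%:R *: v) *: node_poly j).
    apply: leq_trans (size_sum _ _ _) _; apply/bigmax_leqP => j _.
    by rewrite (leq_trans (size_scale_leq _ _))// size_node_poly.
  move=> t; have := Fline 0 v t; rewrite add0r => ->.
  by rewrite horner_sum; apply: eq_bigr => j _; rewrite add0r hornerZ.
- have [p pE] := polynomial_fun_freeze Fline (enum 'I_d) 0.
  exists p => x; rewrite -pE; congr F; apply/rowP => i.
  by rewrite mxE mem_enum.
have c0 := @lowpass_mass_neq0 R d k; pose c := cintegral mu Phi.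
exists (c^-1 *: p); first exact: leq_trans (mpoly.msizeZ_le _ _) pk.
apply: filterS (lowpass_recovery gf dil) => x Fx.
by rewrite mpoly.mevalZ -pE /F Fx mulKf.
Qed.

End lowpass_polynomial.

(** * Completed measures *)

Section completion.
Context {d : measure_display} {T : measurableType d} {R : realType}.
Variable mu : {sigma_finite_measure set T -> \bar R}.
Notation CT := (caratheodory_type (mu^*)%mu).
Notation cmu := (@completed_measure_extension _ _ _ mu).
Local Open Scope ereal_scope.

Lemma sub_completion (A : set T) : measurable A -> measurable (A : set CT).
Proof. by move=> mA; apply: sub_caratheodory; exact: sub_sigma_algebra. Qed.

Lemma completionE (A : set T) : measurable A -> cmu A = mu A.
Proof. exact: measurable_mu_extE. Qed.

Lemma measurable_completion : measurable_fun setT (fun x : CT => x : T).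
Proof. by move=> _ A mA; rewrite setTI; exact: sub_completion. Qed.

Lemma measurable_fun_completion d' (U : measurableType d') (f : T -> U) :
  measurable_fun setT f -> measurable_fun setT (f : CT -> U).
Proof. by move=> mf; exact: (measurableT_comp mf measurable_completion). Qed.

(** The intersection of countable covers whose measures exceed the outer measure by at most
    $1/(n+1)$. *)
Lemma outer_hull (E : set T) : (mu^*)%mu E < +oo ->
  exists F, [/\ measurable F, E `<=` F & mu F = (mu^*)%mu E].
Proof.
move=> Eoo; have Efin : (mu^*)%mu E \is a fin_num by rewrite ge0_fin_numE// mu_ext_ge0.
have hull n : exists F, [/\ measurable F, E `<=` F &
    mu F <= (mu^*)%mu E + n.+1%:R^-1%:E].
  have n0 : (0 < n.+1%:R^-1 :> R)%R by rewrite invr_gt0.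
  have [_ [A [mA EA] <-] /ltW lA] := lb_ereal_inf_adherent n0 Efin.
  exists (\bigcup_k A k); split => //; first exact: bigcupT_measurable.
  apply: le_trans lA; apply: measure_sigma_subadditive => //.
  exact: bigcupT_measurable.
have [F /all_and3[mF EF lF]] := choice hull.
have mI : measurable (\bigcap_n F n) by exact: bigcapT_measurable.
have EI : E `<=` \bigcap_n F n by exact: sub_bigcap.
exists (\bigcap_n F n); split => //; apply/eqP; rewrite eq_le; apply/andP; split.
  apply/lee_addgt0Pr => e e0.
  have [n _ ne] : \forall n \near \oo, (n.+1%:R^-1 < e :> R)%R := near_infty_natSinv_lt (PosNum e0).
  have := ne n (leqnn n) => /ltW en.
  apply: (@le_trans _ _ (mu (F n))).
    by rewrite le_measure ?inE//; exact: bigcap_inf.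
  by rewrite (le_trans (lF n))// leeD2l// lee_fin.
by rewrite -(completionE mI); exact: le_mu_ext.
Qed.

(** On a piece of finite measure, the hull $F$ has the measure of $E$, so additivity makes $F
    \setminus E$ null, and this set in turn has a measurable null hull. Sigma-finiteness assembles
    the pieces. *)
Lemma completed_measurable_hull (E : set CT) : measurable E ->
  exists F N : set T, [/\ measurable F, measurable N, mu N = 0 &
    forall x, ~ N x -> (E x <-> F x)].
Proof.
move=> mE; have /sigma_finiteP[S [US _ mS]] := sigma_finiteT mu.
have hull n : exists p : set T * set T, [/\ measurable p.1, measurable p.2, mu p.2 = 0 &
    forall x, ~ p.2 x -> ((E `&` S n) x <-> p.1 x)].
  have [mSn Snoo] := mS n.
  have mES : measurable (E `&` S n : set CT) by apply: measurableI => //; exact: sub_completion.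
  have ESoo : (mu^*)%mu (E `&` S n) < +oo.
    apply: (@le_lt_trans _ _ (mu (S n))) => //.
    by rewrite -(completionE mSn); exact: le_mu_ext.
  have [F [mF EF muF]] := outer_hull ESoo.
  have FE0 : (mu^*)%mu (F `\` (E `&` S n)) = 0.
    have cF : cmu F = (mu^*)%mu (E `&` S n) by rewrite (completionE mF).
    have Foo : cmu F < +oo by rewrite cF.
    transitivity (cmu F - cmu (F `&` (E `&` S n))).
      exact: (@measureD _ _ _ cmu F (E `&` S n) (sub_completion mF) mES Foo).
    by rewrite (setIidr EF) cF subee// ge0_fin_numE// mu_ext_ge0.
  have [N [mN FEN muN]] := @outer_hull (F `\` (E `&` S n)) (eq_ind_r (fun z => z < +oo) (ltry 0) FE0).
  exists (F, N); split => //=; first by rewrite muN.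
  move=> x Nx; split=> [/EF//|Fx].
  by apply/not_notP => Ex; apply: Nx; apply: FEN.
have [p /all_and4[mF mN N0 FN]] := choice hull.
exists (\bigcup_n (p n).1), (\bigcup_n (p n).2); split.
- exact: bigcupT_measurable.
- exact: bigcupT_measurable.
- apply: measure_negligible; first exact: bigcupT_measurable.
  by apply: negligible_bigcup => n; exists (p n).2; split; [exact: mN|exact: N0|].
- move=> x Nx; split=> [Ex|[n _ Fx]].
    have [n _ Sx] : (\bigcup_n S n) x by rewrite -US.
    exists n => //; apply/FN => // Nnx; apply: Nx; exists n => //.
  by have [] : (E `&` S n) x by apply/FN => // Nnx; apply: Nx; exists n.
Qed.

Lemma completed_negligible (A : set CT) : cmu.-negligible A -> mu.-negligible A.
Proof.
move=> [B [mB B0 AB]].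
have [F [mF BF F0]] := @outer_hull B (eq_ind_r (fun z => z < +oo) (ltry 0) B0).
by exists F; split => //; [rewrite F0|exact: subset_trans BF].
Qed.

Lemma negligible_completion (A : set T) : mu.-negligible A -> cmu.-negligible (A : set CT).
Proof.
move=> [B [mB B0 AB]]; exists B; split => //; first exact: sub_completion.
by rewrite (completionE mB).
Qed.

Lemma ae_completion (P : T -> Prop) :
  (\forall x \ae cmu, P x) <-> (\forall x \ae mu, P x).
Proof. by split; [exact: completed_negligible|exact: negligible_completion]. Qed.

(** The sets $\{f > q\}$ with $q$ rational agree with measurable sets off a common null set [N];
    setting $f$ to $0$ on [N] makes all its level sets measurable. *)
Lemma completed_measurable_fun (f : CT -> R) : measurable_fun setT f ->
  exists2 g : T -> R, measurable_fun setT g & \forall x \ae mu, f x = g x.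
Proof.
move=> mf; pose E (q : rat) : set CT := [set x | (ratr q < f x)%R].
have mE q : measurable (E q).
  have := mf measurableT _ (measurable_itv `]ratr q, +oo[).
  rewrite setTI; congr measurable; apply/seteqP.
  by split => x /=; rewrite in_itv/= andbT.
have hull n : exists p : set T * set T, [/\ measurable p.1, measurable p.2, mu p.2 = 0 &
    forall x, ~ p.2 x -> (if unpickle n is Some q then E q x else True) <-> p.1 x].
  case: (unpickle n) => [q|]; last by exists (setT, set0); split;
    [exact: measurableT|exact: measurable0|exact: measure0|].
  by have [F [N [mF mN N0 FN]]] := completed_measurable_hull (mE q); exists (F, N).
have [p /all_and4[mF mN N0 FN]] := choice hull.
pose N := \bigcup_n (p n).2.
have mNN : measurable N by exact: bigcupT_measurable.
have muN : mu N = 0.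
  apply: measure_negligible => //.
  by apply: negligible_bigcup => n; exists (p n).2; split; [exact: mN|exact: N0|].
exists (fun x => if x \in N then 0%R else f x); last first.
  exists N; split => // x /= H; apply/not_notP => Nx; apply: H.
  by rewrite memNset.
apply: (measurability _ (RGenOInfty.measurableE R)) => _ [_ [a ->] <-].
(* The value $0$ given on [N] exceeds $a$ exactly when $a < 0$. *)
rewrite setTI (_ : _ @^-1` _ = (if (a < 0)%R then N else set0) `|`
    (\bigcup_(q in [set q : rat | (a <= ratr q)%R]) (p (pickle q)).1 `\` N)).
  apply: measurableU; first by case: ifP.
  apply: measurableD => //; rewrite bigcup_mkcond; apply: bigcupT_measurable_rat => q.
  by case: ifP.
apply/seteqP; split => x /=.
  rewrite in_itv/= andbT; case: ifPn => [/set_mem Nx a0|/negP xN ax].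
    by left; rewrite a0.
  have Nx : ~ N x by move=> /mem_set.
  right; split => //; have /rat_in_itvoo[q] := ax.
  rewrite in_itv/= => /andP[aq qf]; exists q; first exact: ltW.
  have Nq : ~ (p (pickle q)).2 x by move=> H; apply: Nx; exists (pickle q).
  by have [+ _] := FN _ _ Nq; apply; rewrite pickleK.
move=> [|[[q /= aq Fq] Nx]].
  by case: ifP => // a0 Nx; rewrite mem_set// in_itv/= a0.
rewrite memNset// in_itv/= andbT (le_lt_trans aq)//.
have /FN : ~ (p (pickle q)).2 x by move=> H; apply: Nx; exists (pickle q).
by rewrite pickleK => -[_ /(_ Fq)].
Qed.

Lemma ge0_integral_completion (g : T -> \bar R) : measurable_fun setT g ->
  (forall x, 0 <= g x) -> \int[cmu]_x g x = \int[mu]_x g x.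
Proof.
move=> mg g0.
pose nu : {measure set T -> \bar R} :=
  measure_function_pushforward__canonical__measure_function_Measure cmu measurable_completion.
have H : \int[nu]_x g x = \int[cmu]_x g x.
  exact: (@ge0_integral_pushforward _ _ CT T R _ measurable_completion cmu setT g
    measurableT mg (fun x _ => g0 x)).
rewrite -H; apply: (@eq_measure_integral _ _ _ setT mu nu) => A mA _.
exact: (completionE mA).
Qed.

Lemma measurable_fun_ae (f : CT -> R) (g : T -> R) :
  measurable_fun setT g -> (\forall x \ae mu, f x = g x) -> measurable_fun setT f.
Proof.
move=> mg fg; apply/measurable_EFinP.
have cmuC : measure_is_complete cmu by exact: measure_is_complete_caratheodory.
apply: (@ae_measurable_fun _ _ _ cmu cmuC setT (fun x => (g x)%:E)).
  have : {ae cmu, forall x, f x = g x} by exact/ae_completion.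
  by apply: filterS => x fgx _ /=; rewrite fgx.
by apply/measurable_EFinP; exact: measurable_fun_completion.
Qed.

Lemma ge0_integral_completion_ae (f : CT -> R) (g : T -> R) : measurable_fun setT g ->
  (forall x, 0 <= f x)%R -> (forall x, 0 <= g x)%R -> (\forall x \ae mu, f x = g x) ->
  \int[cmu]_x (f x)%:E = \int[mu]_x (g x)%:E.
Proof.
move=> mg f0 g0 fg; have mf := measurable_fun_ae mg fg.
have mg' : measurable_fun setT (fun x => (g x)%:E) by exact/measurable_EFinP.
rewrite -(ge0_integral_completion mg'); last by move=> x; rewrite lee_fin.
apply: ge0_ae_eq_integral.
- exact: measurableT.
- exact/measurable_EFinP.
- exact: measurable_fun_completion.
- by move=> x _; rewrite lee_fin.
- by move=> x _; rewrite lee_fin.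
- have : {ae cmu, forall x, f x = g x} by exact/ae_completion.
  by apply: filterS => x ->.
Qed.

Lemma integral_completion (g : T -> \bar R) : measurable_fun setT g ->
  \int[cmu]_x g x = \int[mu]_x g x.
Proof.
move=> mg; rewrite integralE [RHS]integralE; congr (_ - _).
  by apply: ge0_integral_completion => //; exact: measurable_funepos.
by apply: ge0_integral_completion => //; exact: measurable_funeneg.
Qed.

Lemma Rintegral_completion (f : CT -> R) (g : T -> R) :
  measurable_fun setT g -> (\forall x \ae mu, f x = g x) ->
  (\int[cmu]_x f x = \int[mu]_x g x)%R.
Proof.
move=> mg fg; transitivity (\int[cmu]_x (g x : R))%R.
  apply: Rintegral_ae; last exact/ae_completion.
    exact: measurable_fun_ae fg.
  exact: measurable_fun_completion.
by rewrite /Rintegral integral_completion//; exact/measurable_EFinP.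
Qed.

End completion.

(** * Comparison of the Euclidean norm with the sup norm *)

Section euclidean_norm.
Context {R : realType} {d : nat}.
Implicit Types x : 'rV[R]_d.

Lemma enorm_ge0 x : 0 <= enorm x. Proof. exact: sqrtr_ge0. Qed.

Lemma normr_le_enorm x : `|x| <= enorm x.
Proof.
by rewrite -[leLHS]ger0_norm// -sqrtr_sqr ler_wsqrtr// sqr_normr_dotp.
Qed.

Lemma enorm_le x : enorm x <= d%:R * `|x|.
Proof.
rewrite -[leRHS]ger0_norm ?mulr_ge0// -sqrtr_sqr ler_wsqrtr//.
apply: le_trans (ler_norm _) _; apply: le_trans (normr_dotp _ _) _.
rewrite exprMn -!expr2 ler_wpM2r ?exprn_ge0// expr2.
by case: (d) => [|n]; rewrite ?mulr0// ler_peMl// ler1n.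
Qed.

Lemma enorm_weight_le x k : (1 + enorm x) ^+ k <= (1 + d%:R) ^+ k * (1 + `|x|) ^+ k.
Proof.
rewrite -exprMn lerXn2r ?nnegrE ?mulr_ge0 ?addr_ge0 ?enorm_ge0//.
have := enorm_le x; have := normr_ge0 x; have : 0 <= d%:R :> R by [].
nra.
Qed.

Lemma onenorm_enorm_le x k : (1 + `|x|) ^+ k <= (1 + enorm x) ^+ k.
Proof.
by rewrite lerXn2r ?nnegrE ?addr_ge0 ?enorm_ge0// lerD2l normr_le_enorm.
Qed.

Lemma enorm_weight_gt0 x k : 0 < (1 + enorm x) ^+ k.
Proof. by rewrite exprn_gt0// ltr_pwDl// enorm_ge0. Qed.

Lemma enormZ (s : R) x : enorm (s *: x) = `|s| * enorm x.
Proof.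
rewrite /enorm dotpZl dotpZr mulrA -expr2 sqrtrM ?sqr_ge0//.
by rewrite sqrtr_sqr.
Qed.

Lemma enorm_gt0 x : x != 0 -> 0 < enorm x.
Proof. by rewrite -normr_gt0 => /lt_le_trans; apply; exact: normr_le_enorm. Qed.

Lemma measurable_enorm_weight k : measurable_fun setT (fun x => (1 + enorm x) ^+ k).
Proof.
apply: measurable_funX; apply: measurable_funD; first exact: measurable_cst.
apply: (measurableT_comp (continuous_measurable_fun (@sqrt_continuous R))).
by apply: measurable_dotp; exact: measurable_id.
Qed.

End euclidean_norm.

(** * Borel versions of the data *)

Section borel_versions.
Context {R : realType} {d : nat}.
Notation mu := (@borel_lebesgue R d).
Implicit Types (f g psi : 'rV[R]_d -> R[i]) (x t w : 'rV[R]_d).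

Lemma borel_version f : measurable_cfun f ->
  exists2 g, cmeasurable g & {ae mu, forall x, f x = g x}.
Proof.
move=> [mR mI].
have [gR mgR gRE] := @completed_measurable_fun _ _ _ mu _ mR.
have [gI mgI gIE] := @completed_measurable_fun _ _ _ mu _ mI.
have fgR : {ae mu, forall x, complex.Re (f x) = gR x} := gRE.
have fgI : {ae mu, forall x, complex.Im (f x) = gI x} := gIE.
exists (fun x => gR x +i* gI x); first by split.
by apply: filterS2 fgR fgI => x <- <-; case: (f x).
Qed.

Lemma integralC_borel f g : cmeasurable g ->
  {ae mu, forall x, f x = g x} -> integralC f = cintegral mu g.
Proof.
move=> [gR gI] fg.
have fgR : {ae mu, forall x, complex.Re (f x) = complex.Re (g x)}.
  by apply: filterS fg => x ->.
have fgI : {ae mu, forall x, complex.Im (f x) = complex.Im (g x)}.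
  by apply: filterS fg => x ->.
rewrite /integralC (@Rintegral_completion _ _ _ mu _ _ gR fgR).
by rewrite (@Rintegral_completion _ _ _ mu _ _ gI fgI).
Qed.

(** The essential bound holds almost everywhere only, so the Borel version is set to $0$ where the
    bound fails; the result obeys it everywhere. *)
Lemma growth_version k f : measurable_cfun f ->
  inLp +oo%E (fun x => f x * ((1 + enorm x) ^- k)%:C) ->
  exists2 g, growth k g & {ae mu, forall x, f x = g x}.
Proof.
move=> mf [_ foo]; have [f1 mf1 ff1] := borel_version mf.
have [M fM] : exists M : R, {ae mu, forall x, Normc.normc (f x) <= M * (1 + enorm x) ^+ k}.
  have [M HM] : exists M : R, {ae lebesgue_rV R d, forall x,
      Normc.normc (f x * ((1 + enorm x) ^- k)%:C) <= M}.
    move: foo; rewrite /finite_norm unlock; case: ifPn => [_|L0 _].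
      move=> /ess_sup_inf.ess_supr_bounded[M HM]; exists M; apply: filterS HM => x.
      by rewrite ger0_norm ?normc_ge0.
    (* When the whole space is null the norm for $p = \infty$ is $0$ by convention, and any bound
       holds almost everywhere. *)
    exists 0; exists setT; split => //.
    by apply/eqP; move: L0; rewrite -leNgt measure_le0.
  have HMmu : {ae mu, forall x, Normc.normc (f x * ((1 + enorm x) ^- k)%:C) <= M}.
    exact: (proj1 (@ae_completion _ _ _ mu _) HM).
  exists M; apply: filterS HMmu => x.
  rewrite Normc.normcM normc_real ger0_norm; last by rewrite invr_ge0 ltW// enorm_weight_gt0.
  by rewrite ler_pdivrMr// enorm_weight_gt0.
pose A : set 'rV[R]_d := [set x | Normc.normc (f1 x) <= `|M| * (1 + enorm x) ^+ k].
have mA : measurable A.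
  have mh : measurable_fun setT (fun x => `|M| * (1 + enorm x) ^+ k - Normc.normc (f1 x)).
    apply: measurable_funB; last exact: cmeasurable_normc.
    by apply: measurable_funM; [exact: measurable_cst|exact: measurable_enorm_weight].
  have := mh measurableT _ (measurable_itv `[0, +oo[); rewrite setTI.
  by congr measurable; apply/seteqP; split => x /=; rewrite in_itv/= andbT subr_ge0.
exists (fun x => (\1_A x)%:C * f1 x).
  split.
    by apply: cmeasurableM => //; apply: cmeasurable_real; exact: measurable_indic.
  exists (`|M| * (1 + d%:R) ^+ k); first by rewrite mulr_ge0// exprn_ge0// addr_ge0.
  move=> x; rewrite Normc.normcM normc_real ger0_norm ?indicE//.
  have [/set_mem xA|_] := boolP (x \in A); last first.
    by rewrite mul0r !mulr_ge0// exprn_ge0// addr_ge0.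
  by rewrite mul1r (le_trans xA)// -mulrA ler_wpM2l// enorm_weight_le.
apply: filterS2 ff1 fM => x fx1 fx; rewrite indicE mem_set ?mul1r//.
rewrite /A /= -fx1 (le_trans fx)// ler_wpM2r ?ler_norm// ltW//.
exact: enorm_weight_gt0.
Qed.

Lemma moment_version k psi : measurable_cfun psi ->
  inLp 1%E (fun x => psi x * ((1 + enorm x) ^+ k)%:C) ->
  exists2 g, moment k g & {ae mu, forall x, psi x = g x}.
Proof.
move=> mpsi [_]; rewrite /finite_norm Lnorm1 => ioo.
have [g mg pg] := borel_version mpsi; exists g => //; split => //.
pose h x := Normc.normc (g x) * (1 + enorm x) ^+ k.
have mh : measurable_fun setT h.
  by apply: measurable_funM; [exact: cmeasurable_normc|exact: measurable_enorm_weight].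
have h0 x : 0 <= h x by rewrite mulr_ge0 ?normc_ge0// ltW// enorm_weight_gt0.
apply: (@rintegrable_le _ _ _ mu _ h).
- by apply: measurable_funM; [exact: cmeasurable_normc|exact: measurable_onenorm].
- apply/integrableP; split; first exact/measurable_EFinP.
  have ae : {ae mu, forall x, `|Normc.normc (psi x * ((1 + enorm x) ^+ k)%:C)| = `|h x|}.
    apply: filterS pg => x ->.
    rewrite /h Normc.normcM normc_real (@ger0_norm _ ((1 + enorm x) ^+ k))//.
    by rewrite ltW// enorm_weight_gt0.
  have E := @ge0_integral_completion_ae _ _ _ mu _ _ (measurableT_comp (@normr_measurable R _) mh)
    (fun x => normr_ge0 _) (fun x => normr_ge0 _) ae.
  by rewrite -[X in (X < _)%E]E.
move=> x; rewrite ger0_norm ?mulr_ge0 ?normc_ge0// ?exprn_ge0 ?addr_ge0//.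
by rewrite /h ler_wpM2l ?normc_ge0// onenorm_enorm_le.
Qed.

Lemma ae_affine (P : 'rV[R]_d -> Prop) t (s : R) : s != 0 ->
  {ae mu, forall x, P x} -> {ae mu, forall x, P (t + s *: x)}.
Proof.
move=> s0 [N [mN N0 PN]]; exists ((fun x => t + s *: x) @^-1` N); split.
- by rewrite -[X in measurable X]setTI; exact: measurable_affine.
- have mP : measurable ((fun x => t + s *: x) @^-1` N).
    by rewrite -[X in measurable X]setTI; exact: measurable_affine.
  have mI : measurable_fun setT (fun x => (\1_N x : R)%:E).
    by apply/measurable_EFinP; exact: measurable_indic.
  have I0 x : (0 <= (\1_N x : R)%:E)%E by rewrite lee_fin indicE.
  have E := ge0_integral_affine t s0 mI I0.
  have N1 := @integral_indic _ _ _ mu _ measurableT _ mN; rewrite setIT in N1.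
  have P1 := @integral_indic _ _ _ mu _ measurableT _ mP; rewrite setIT in P1.
  apply: (etrans (esym P1)); apply: (etrans E).
  by rewrite (etrans N1 N0) mule0.
- by move=> x /= H; apply: PN => /=; exact: H.
Qed.

Lemma fourier_version psi g : cmeasurable g ->
  {ae mu, forall x, psi x = g x} -> fourier psi = fourier_borel g.
Proof.
move=> mg pg; apply/funext => w; apply: integralC_borel.
- by apply: cmeasurableM => //; exact: cmeasurable_phaseN.
- by apply: filterS pg => x ->.
Qed.

(** Substitution $x = t + sy$. The normalization $s^{-d/2}$ and the Jacobian only contribute nonzero
    factors, which are divided out at the end. *)
Lemma wavelet_version k f g psi h (s : R) t : 0 < s ->
  growth k g -> {ae mu, forall x, f x = g x} -> moment k h -> {ae mu, forall x, psi x = h x} ->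
  inner f (wavelet psi s t) = 0 ->
  cintegral mu (fun y => g (t + s *: y) * (h y)^*%R) = 0.
Proof.
move=> s0 gg fg mh ph; have sN0 : s != 0 by rewrite gt_eqF.
have sV0 : s^-1 != 0 by rewrite invr_eq0.
pose H y := g (t + s *: y) * (h y)^*%R.
have iH : cintegrable mu H.
  have [mg [C C0 gC]] := gg; have [mh0 ih] := mh.
  apply: (@cintegrable_le _ _ _ mu _ (fun y => C * ((1 + `|t|) * (1 + `|s|)) ^+ k *
      (Normc.normc (h y) * (1 + `|y|) ^+ k))).
  - apply: cmeasurableM; last exact: cmeasurableJ.
    exact: cmeasurable_comp mg (measurable_affine _ _).
  - exact: rintegrableZ.
  - move=> y; rewrite Normc.normcM normcJ [X in _ <= _ * X]mulrC mulrA.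
    by rewrite ler_wpM2r ?normc_ge0//; exact: growth_affine_bound.
pose c : R := s `^ (- (d%:R / 2)).
have c0 : c%:C != 0 :> R[i] by rewrite eq_complex /= eqxx andbT gt_eqF// powR_gt0.
have mHa : cmeasurable (fun x => c%:C * H (- (s^-1 *: t) + s^-1 *: x)).
  apply: cmeasurableM; first exact: cmeasurable_cst.
  exact: cmeasurable_comp (cintegrable_measurable iH) (measurable_affine _ _).
have E : inner f (wavelet psi s t) = cintegral mu (fun x => c%:C * H (- (s^-1 *: t) + s^-1 *: x)).
  apply: integralC_borel; first exact: mHa.
  apply: filterS2 fg (ae_affine (- (s^-1 *: t)) sV0 ph) => x fx px.
  rewrite /H /wavelet fx scalerBr [s^-1 *: x - _]addrC px -/c.
  have -> : t + s *: (- (s^-1 *: t) + s^-1 *: x) = x.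
    by rewrite scalerDr scalerN !scalerA divff// !scale1r addNKr.
  by rewrite rmorphM /= mulrCA; congr (_ * _); apply/eqP; rewrite eq_complex /= oppr0 !eqxx.
have iHa := cintegrable_affine (- (s^-1 *: t)) sV0 iH.
rewrite E (cintegralZ c%:C iHa) (cintegral_affine (- (s^-1 *: t)) sV0 iH).
move=> /eqP; rewrite !mulf_eq0 (negbTE c0) /= => /orP[|/eqP//].
rewrite eq_complex /= eqxx andbT invr_eq0 expf_eq0 normr_eq0 (negbTE sV0) andbF.
by [].
Qed.

End borel_versions.

Theorem theorem3 (R : realType) (d k : nat) (f psi : 'rV[R]_d -> R[i])
    (d_ge1 : (1 <= d)%N)
    (f_loc : locally_integrableC f)
    (f_growth : inLp +oo%E (fun x => f x * ((1 + enorm x) ^- k)%:C))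
    (psi_int : inLp 1%E psi)
    (psi_decay : inLp 1%E (fun x => psi x * ((1 + enorm x) ^+ k)%:C))
    (psi_hat_smooth : smooth_onC (~` [set 0]) (fourier psi))
    (wavelet_zero : forall (s : R) (t : 'rV[R]_d), 0 < s ->
      inner f (wavelet psi s t) = 0)
    (psi_hat_nontrivial : nontrivial_in_every_direction (fourier psi)) :
  exists p : mpoly.mpoly d R[i],
    (mpoly.msize p <= k.+1)%N /\
    \forall x \ae lebesgue_rV R d,
      f x = mpoly.meval (fun i => ((x : 'rV[R]_d) ord0 i)%:C) p.
Proof.
have [mf _] := f_loc; have [mpsi _] := psi_int.
have [g gg fg] := growth_version mf f_growth.
have [h mh ph] := moment_version mpsi psi_decay.
have hE : fourier psi = fourier_borel h.
  by apply: fourier_version => //; case: mh.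
rewrite hE in psi_hat_smooth psi_hat_nontrivial.
have sh : csmooth (k + 2 * d) (~` [set 0]) (fourier_borel h).
  move=> i; have [sR sI] := psi_hat_smooth (k + 2 * d)%N.
  by split; exact: Cn_on_smooth_along.
have nh w : w != 0 -> exists2 s : R, 0 < s & fourier_borel h (- s *: w) != 0.
  (* The unit vector opposite to $w$, since $\widehat\psi$ is evaluated at $-sw$. *)
  move=> w0; have e0 := enorm_gt0 w0; pose xi := - (enorm w)^-1 *: w.
  have xi1 : enorm xi = 1.
    by rewrite enormZ normrN ger0_norm ?invr_ge0 ?ltW// mulVf// gt_eqF.
  (* A set of positive measure is not empty. *)
  have [r [r0 hr]] : exists r, 0 < r /\ fourier_borel h (r *: xi) != 0.
    apply: contrapT => no_r; have := psi_hat_nontrivial xi xi1.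
    rewrite /nontrivial_in_direction (_ : [set r | _] = set0) ?measure0 ?ltxx//.
    by apply/seteqP; split => // r hr; apply: no_r; exists r.
  exists (r / enorm w); first by rewrite divr_gt0.
  by move: hr; rewrite /xi scalerA mulrN.
have wh (s : R) t : 0 < s -> cintegral (@borel_lebesgue R d)
    (fun y => g (t + s *: y) * (h y)^*%R) = 0.
  move=> s0; exact: (wavelet_version s0 gg fg mh ph (wavelet_zero s t s0)).
have dil a (s : R) := @lowpass_dilation R d k g h a s d_ge1 gg mh sh nh wh.
have [p pk pE] := dilation_invariant_polynomial gg dil.
exists p; split => //; apply/(@ae_completion _ _ _ (@borel_lebesgue R d)).
by apply: filterS2 fg pE => x -> ->.
Qed.
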